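(* Let $1<p<2$ and let $E\subset \mathbb{R}\times\{0\}\subset\mathbb{R}^2$ be a finite set with $\#E\geq 2$. Then there exists a linear map $T:L^{2,p}(E)\to L^{2,p}(\mathbb{R}^2)$ such that $Tf=f$ on $E$ and $\Vert Tf\Vert_{L^{2,p}(\mathbb{R}^2)}\leq C_p\Vert f\Vert_{L^{2,p}(E)}$ for every $f\in L^{2,p}(E)$, where the constant $C_p$ depends only on $p$. Moreover, $T$ can be taken independent of $p\in(1,2)$ and such that for each point $z\in\mathbb{R}^2$, the value of $Tf$ at $z$ is determined by the values of $f$ at at most $C$ points of $E$, where $C$ is an absolute constant.
   Context: $L^{2,p}(\mathbb{R}^2)$ is the homogeneous Sobolev space of functions $F:\mathbb{R}^2\to\mathbb{R}$ whose second-order distributional derivatives belong to $L^p(\mathbb{R}^2)$, with seminorm $\Vert F\Vert_{L^{2,p}(\mathbb{R}^2)}=\left(\sum_{|\alpha|=2}\int_{\mathbb{R}^2}|\partial^\alpha F|^p\right)^{1/p}$. Since $p>1$, such $F$ are continuous (after modification on a null set), so point values and restriction to $E$ make sense. $L^{2,p}(E)$ is the vector space of all functions $f:E\to\mathbb{R}$ with seminorm $\Vert f\Vert_{L^{2,p}(E)}=\inf\{\Vert F\Vert_{L^{2,p}(\mathbb{R}^2)}: F\in L^{2,p}(\mathbb{R}^2),\ F=f\text{ on }E\}$. Absolute constants do not depend on $E$, $f$, or $p$; the constant $C_p$ does not depend on $E$ or $f$. *)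

(* Defs.v *)
From HB Require Import structures.
From mathcomp Require Import all_boot all_order all_algebra.
From mathcomp Require Import finmap.
From mathcomp Require Import all_classical all_reals all_analysis.

Set Implicit Arguments.
Unset Strict Implicit.
Unset Printing Implicit Defensive.

Import Order.TTheory GRing.Theory Num.Theory.
Import numFieldNormedType.Exports.

Local Open Scope classical_set_scope.
Local Open Scope ring_scope.

Section Sobolev.
Context {R : realType}.

Local Notation plane := (R * R)%type.

Definition lebesgue2 := (@lebesgue_measure R \x @lebesgue_measure R)%E.

Definition partial1 (phi : plane -> R) : plane -> R :=
  fun z => 'D_(1, 0) phi z.

Definition partial2 (phi : plane -> R) : plane -> R :=
  fun z => 'D_(0, 1) phi z.

Definition partial (a : nat * nat) (phi : plane -> R) : plane -> R :=
  iter a.1 partial1 (iter a.2 partial2 phi).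

(* Class C^k. For k > 0, the first partial derivatives are continuous, so phi is
   automatically (Frechet) differentiable and continuous. *)
Fixpoint Ck (k : nat) (phi : plane -> R) : Prop :=
  if k is k'.+1 then
    [/\ forall z, derivable phi z (1, 0), forall z, derivable phi z (0, 1),
        Ck k' (partial1 phi) & Ck k' (partial2 phi)]
  else continuous phi.

Definition test_function (phi : plane -> R) : Prop :=
  (forall k, Ck k phi) /\ compact (closure [set z | phi z != 0]).

Definition L1loc (g : plane -> R) : Prop :=
  measurable_fun [set: measurableTypeR R * measurableTypeR R] g /\
  forall K : set plane, compact K -> lebesgue2.-integrable K (EFin \o g).

Definition is_weak_partial (a : nat * nat) (F g : plane -> R) : Prop :=
  [/\ L1loc F, L1loc g &
      forall phi, test_function phi ->
        \int[lebesgue2]_z (F z * partial a phi z) =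
        (-1) ^+ (a.1 + a.2) * \int[lebesgue2]_z (g z * phi z)].

(* The weak derivative is unique up to a null set; this picks a representative
   (and returns 0 if there is none). *)
Definition weak_partial (a : nat * nat) (F : plane -> R) : plane -> R :=
  xget (cst 0) [set g | is_weak_partial a F g].

(* Elements of L^{2,p}(R^2), p > 1, are represented by their unique continuous
   version, so that point values make sense. *)
Definition L2p (p : R) : set (plane -> R) :=
  [set F | continuous F /\
    forall a : nat * nat, (a.1 + a.2 = 2)%N ->
      exists2 g, is_weak_partial a F g & g \in Lfun lebesgue2 p%:E].

(* Meaningful for F in L2p p. The three multi-indices of order 2 are (i, 2 - i) for i = 0, 1, 2. *)
Definition L2p_seminorm (p : R) (F : plane -> R) : \bar R :=
  ((\sum_(i < 3) \int[lebesgue2]_z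
      (`|weak_partial (i : nat, 2 - i)%N F z| `^ p)%:E) `^ p^-1)%E.

Definition L2p_trace_seminorm (p : R) (E : {fset plane}) (f : {ffun E -> R^o})
    : \bar R :=
  ereal_inf [set L2p_seminorm p F |
    F in [set F | L2p p F /\ forall x : E, F (val x) = f x]].

End Sobolev.

(* Main.v *)
Require Import Defs.
From HB Require Import structures.
From mathcomp Require Import all_boot all_order all_algebra.
From mathcomp Require Import finmap.
From mathcomp Require Import all_classical all_reals all_analysis.
From mathcomp Require Import measurable_realfun.
From mathcomp Require Import ring lra zify.

(** Why the theorem is true. Let [X 0 < ... < X N] be the abscissas of [E], and let
    [scale k = 2 ^+ k * h0] where [h0] is small compared with the gaps of [E] and
    the top scale [scale K] is the diameter of [E].

    The operator. The data are interpolated by the line of each gap, and by the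
    chord of the whole set outside of it; this piecewise affine function is sampled
    on a grid of mesh [scale k], and the samples are the coefficients of a cubic
    spline, the layer [k]. The extension uses at height [y] the layers of mesh
    comparable with [|y|], blended by a partition of unity in [y] ([extension]).
    Near [E] the finest layer is affine, and the extension interpolates
    ([extension_interpolates]). A given point meets a bounded number of spline
    functions, each of whose coefficients depends on four data at most
    ([extension_local]). The exponent [p] does not enter.

    Upper bound. The second derivative of a layer, and the difference of two
    consecutive layers, are combinations of second differences of the samples
    ([sum_bspline2], [bspline_coarsen]). By bounded overlap, the second derivatives
    of the extension have an integral of [p]-th powers bounded by the sum over all
    nodes of [scale k `^ (2 - 2 * p)] times the [p]-th power of the second
    difference ([extension_bound]).

    Lower bound. It remains to bound this sum by the energy of an arbitrary
    competitor [F] ([trace_bound]). Let [G] be the trace of [F] on the line and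
    [H = |F_xx| + |F_xy|]. The deviation of [G] from its chord over an interval is
    at most a constant times the integral of [H] on the square above the interval
    ([three_point]): test [F] against a function whose derivatives transport the
    three-point functional upwards. The second difference of the samples is zero
    when its nodes lie in one gap. Otherwise it is the second difference of [G], plus
    that of the defect between the line of a gap and [G], at nodes close to [E].
    The defect vanishes at the ends of its gap, and by [three_point] its size [U k] at
    distance [scale k] of an end satisfies [U k <= U k.+1 / 2 + V k] where [V k] is an
    integral of [H] over a box of size [scale k]; since [p < 2], this recursion is
    contracting in the weighted space at hand ([recursion_sum]). Finally the weighted
    sum of the [p]-th powers of the integrals of [H] over boxes standing on the line
    is at most a constant times the integral of [H `^ p], by a Hardy inequality
    which needs [p > 1] ([hardy_sum]).

    The seminorm is defined through a choice of weak derivatives; these are unique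
    almost everywhere ([weak_zero]), which identifies those of the extension with
    the explicit ones. *)

Set Implicit Arguments.
Unset Strict Implicit.
Unset Printing Implicit Defensive.

Import Order.TTheory GRing.Theory Num.Theory.
Import numFieldNormedType.Exports.

Local Open Scope classical_set_scope.
Local Open Scope ring_scope.

(** * Measurability and local integrability in the plane *)

Section PlaneMeasure.
Context {R : realType}.
Local Notation plane := (R * R)%type.
Local Notation mplane := (measurableTypeR R * measurableTypeR R)%type.

Lemma measurable_rectangle (A B : set R) :
  measurable (A : set (measurableTypeR R)) ->
  measurable (B : set (measurableTypeR R)) ->
  measurable (A `*` B : set mplane).
Proof. by move=> mA mB; exact: measurableX. Qed.

(** The product topology has a countable base of rational squares, so that its
    open sets belong to the product of the Borel sigma-algebras. *)
Lemma plane_open_measurable (U : set plane) : open U ->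
  measurable (U : set mplane).
Proof.
move=> oU.
pose B (q1 q2 r : rat) : set plane :=
  ball (ratr q1 : R) (ratr r : R) `*` ball (ratr q2 : R) (ratr r : R).
have -> : U = \bigcup_(q1 : rat) \bigcup_(q2 : rat) \bigcup_(r : rat)
    (if `[< B q1 q2 r `<=` U >] then B q1 q2 r else set0).
  apply/seteqP; split=> [[x y] Uxy|z [q1 _] [q2 _] [r _]]; last first.
    by case: asboolP => // + Bz; exact.
  have /nbhs_ballP[e /= e0 eU] : nbhs (x, y) U by exact: open_nbhs_nbhs.
  have [r /itvP re] : exists r : rat, ratr r \in `]0, (e / 2)[.
    by apply: rat_in_itvoo; rewrite divr_gt0.
  have near_rat (t : R) : exists q : rat, ball (ratr q : R) (ratr r : R) t.
    have [q /itvP qt] : exists q : rat, ratr q \in `]t, (t + ratr r)[.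
      by apply: rat_in_itvoo; rewrite ltrDl re.
    exists q; rewrite -ball_normE /ball_/= ltr_distlC; apply/andP; split.
      by rewrite ltrBlDr qt.
    by rewrite (lt_trans (y := ratr q)) ?qt// ltrDl re.
  have [q1 q1x] := near_rat x; have [q2 q2y] := near_rat y.
  exists q1 => //; exists q2 => //; exists r => //; case: asboolP => //.
  case=> -[s t]; rewrite /B/= => -[q1s q2t]; apply: eU.
  rewrite /ball/= /prod_ball/=; split.
    apply: (@le_ball _ _ _ (ratr r + ratr r)).
      by rewrite (splitr e) lerD// ltW// re.
    by apply: ball_triangle q1s; exact: ball_sym.
  apply: (@le_ball _ _ _ (ratr r + ratr r)).
    by rewrite (splitr e) lerD// ltW// re.
  by apply: ball_triangle q2t; exact: ball_sym.
apply: bigcupT_measurable_rat => q1; apply: bigcupT_measurable_rat => q2.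
apply: bigcupT_measurable_rat => r; case: ifP => // _.
by apply: measurable_rectangle; exact: measurable_ball.
Qed.

Lemma plane_closed_measurable (K : set plane) : closed K ->
  measurable (K : set mplane).
Proof.
by move/closed_openC/plane_open_measurable/measurableC; rewrite setCK.
Qed.

Lemma plane_compact_measurable (K : set plane) : compact K ->
  measurable (K : set mplane).
Proof.
by move=> cK; apply: plane_closed_measurable; apply: compact_closed => //; exact: norm_hausdorff.
Qed.

Lemma plane_continuous_measurable (f : plane -> R) : continuous f ->
  measurable_fun [set: mplane] f.
Proof.
move=> /continuousP cf.
apply: (measurability _ (RGenOpens.measurableE R)).
move=> _ [_ [a [b ->] <-]]; rewrite setTI.
by apply: plane_open_measurable; apply: cf; exact: interval_open.
Qed.

Local Notation mu2 := (@lebesgue2 R).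

(** Compact supports are replaced by inclusion in such a box, over which Fubini
    and one-variable integration apply directly. *)
Definition box (A : R) : set plane := `[- A, A] `*` `[- A, A].

Lemma box_compact A : compact (box A).
Proof. by apply: compact_setX; exact: segment_compact. Qed.

Lemma box_measurable A : measurable (box A : set mplane).
Proof. by apply: measurable_rectangle; exact: measurable_itv. Qed.

Lemma boxP A (z : plane) : box A z <-> `|z.1| <= A /\ `|z.2| <= A.
Proof.
rewrite /box/= !in_itv/=; split=> [[]|[]].
  by move=> /andP[? ?] /andP[? ?]; rewrite !ler_norml; split; apply/andP.
by rewrite !ler_norml.
Qed.

Lemma sub_box (K : set plane) : compact K -> exists2 A, 0 < A & K `<=` box A.
Proof.
move=> /compact_bounded[M [Mr MK]].
exists (`|M| + 1) => [|z Kz]; first by rewrite ltr_wpDl.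
have := MK (`|M| + 1) _ z Kz; rewrite (le_lt_trans (ler_norm _)) ?ltrDl// => /(_ isT).
rewrite /= prod_normE ge_max => /andP[? ?]; exact/boxP.
Qed.

Lemma box_measure_lty A : (mu2 (box A) < +oo)%E.
Proof.
rewrite /mu2 /box product_measure1E; try exact: measurable_itv.
have fin : (lebesgue_measure (`[(- A)%R, A]%classic : set R) < +oo)%E.
  by apply: compact_finite_measure; exact: segment_compact.
by rewrite lte_mul_pinfty// ge0_fin_numE.
Qed.

Definition vanishes_off (A : R) (w : plane -> R) :=
  forall z, ~ box A z -> w z = 0.

Lemma test_function_box (phi : plane -> R) : test_function phi ->
  exists2 A, 0 < A & vanishes_off A phi.
Proof.
case=> _ /sub_box[A A0 sA]; exists A => // z; apply: contra_notP => /eqP phiz.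
by apply: sA; apply: subset_closure.
Qed.

Lemma box_test_function (phi : plane -> R) A :
  (forall k, Ck k phi) -> vanishes_off A phi -> test_function phi.
Proof.
move=> smooth_phi phi0; split => //.
apply: (subclosed_compact _ (box_compact (A := A))); first exact: closed_closure.
have bc : closed (box A).
  exact: (compact_closed (@norm_hausdorff _ _) (box_compact (A := A))).
rewrite closureE => z; apply; split => // t /= /eqP; apply: contra_notP.
exact: phi0.
Qed.

Lemma continuous_bounded_box (w : plane -> R) A : continuous w ->
  exists2 M, 0 < M & forall z, box A z -> `|w z| <= M.
Proof.
move=> cw.
have : compact (w @` box A).
  by apply: continuous_compact; [exact: continuous_subspaceT|exact: box_compact].
move=> /compact_bounded[M [Mr MK]].
exists (`|M| + 1) => [|z Kz]; first by rewrite ltr_wpDl.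
by apply: (MK (`|M| + 1)); [rewrite (le_lt_trans (ler_norm _)) ?ltrDl|exists z].
Qed.

Lemma L1loc_continuous (w : plane -> R) : continuous w -> L1loc w.
Proof.
move=> cw; split; first exact: plane_continuous_measurable.
move=> K cK.
have mK := plane_compact_measurable cK.
have [A A0 KA] := sub_box cK.
apply: (@integrableS _ _ _ mu2 (box A)) => //; first exact: box_measurable.
have [M M0 wM] := continuous_bounded_box A cw.
apply: measurable_bounded_integrable; [exact: box_measurable|exact: box_measure_lty|..].
  by apply: measurable_funTS; exact: plane_continuous_measurable.
exists M; split; first exact: num_real.
by move=> x Mx z /= Az; rewrite (le_trans (wM z Az))// ltW.
Qed.

Lemma L1loc_integrable (g : plane -> R) A : L1loc g -> vanishes_off A g ->
  mu2.-integrable [set: mplane] (EFin \o g).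
Proof.
move=> [mg Kg] g0.
have := Kg _ (box_compact (A := A)).
rewrite (integrable_mkcond _ (box_measurable A)).
congr (_.-integrable _ _); apply/funext => z /=.
by rewrite patchE; case: ifPn => //; rewrite notin_setE => /g0 /= ->.
Qed.

Lemma L1locM (g phi : plane -> R) : L1loc g -> continuous phi ->
  L1loc (fun z => g z * phi z).
Proof.
move=> [mg Kg] cphi; split.
  by apply: measurable_funM => //; exact: plane_continuous_measurable.
move=> K cK.
have mK := plane_compact_measurable cK.
have [A A0 KA] := sub_box cK.
have [M M0 wM] := continuous_bounded_box A cphi.
apply: (@integrableMl _ _ _ mu2 K mK (EFin \o g) phi (Kg _ cK)).
  by apply: measurable_funTS; exact: plane_continuous_measurable.
exists M; split; first exact: num_real.
by move=> x Mx z /= /KA Az; rewrite (le_trans (wM z Az))// ltW.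
Qed.

End PlaneMeasure.

(** * Integration by parts *)

Section IntegrationByParts.
Context {R : realType}.
Local Notation plane := (R * R)%type.
Local Notation mplane := (measurableTypeR R * measurableTypeR R)%type.
Local Notation mu2 := (@lebesgue2 R).

Lemma is_derive_slice1 (w : plane -> R) (x y : R) : derivable w (x, y) (1, 0) ->
  is_derive x (1 : R) (fun t => w (t, y)) (partial1 w (x, y)).
Proof.
have E : (fun h : R => h^-1 *: (w (h *: (1 : R) + x, y) - w (x, y))) =
         (fun h : R => h^-1 *: (w (h *: (1, 0) + (x, y)) - w (x, y))).
  by apply/funext => h; congr (_ *: (w _ - _)); congr pair; rewrite /= scaler0 add0r.
by move=> dw; split; [rewrite /derivable E|rewrite /partial1 /derive E].
Qed.

Lemma is_derive_slice2 (w : plane -> R) (x y : R) : derivable w (x, y) (0, 1) ->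
  is_derive y (1 : R) (fun t => w (x, t)) (partial2 w (x, y)).
Proof.
have E : (fun h : R => h^-1 *: (w (x, h *: (1 : R) + y) - w (x, y))) =
         (fun h : R => h^-1 *: (w (h *: (0, 1) + (x, y)) - w (x, y))).
  by apply/funext => h; congr (_ *: (w _ - _)); congr pair; rewrite /= scaler0 add0r.
by move=> dw; split; [rewrite /derivable E|rewrite /partial2 /derive E].
Qed.

Lemma vanishes_off_derive (w : plane -> R) A v : vanishes_off A w ->
  vanishes_off A (fun z => 'D_v w z).
Proof.
move=> w0 z Az; rewrite -(derive_cst (0 : R) z v); apply: near_eq_derive.
have : open (~` box A).
  by apply/closed_openC/(compact_closed (@norm_hausdorff _ _))/box_compact.
move=> oB; have nz : nbhs z (~` box A) by exact: open_nbhs_nbhs.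
by near=> t; rewrite w0//; near: t.
Unshelve. all: by end_near. Qed.

Lemma continuous_slice1 (w : plane -> R) y : continuous w ->
  continuous (fun x => w (x, y)).
Proof.
move=> cw x; have cp : {for x, continuous (fun t : R => (t, y))}.
  move=> B [[P Q] /= [nP nQ] PQ]; apply: filterS nP => t Pt; apply: PQ.
  by split => //=; exact: nbhs_singleton nQ.
exact: (continuous_comp cp (cw (x, y))).
Qed.

Lemma continuous_slice2 (w : plane -> R) x : continuous w ->
  continuous (fun y => w (x, y)).
Proof.
move=> cw y; have cp : {for y, continuous (fun t : R => (x, t))}.
  move=> B [[P Q] /= [nP nQ] PQ]; apply: filterS nQ => t Qt; apply: PQ.
  by split => //=; exact: nbhs_singleton nP.
exact: (continuous_comp cp (cw (x, y))).
Qed.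

Lemma integral_derivative_cpt (f df : R -> R) A :
  (forall x : R, is_derive x (1 : R) f (df x)) -> continuous df ->
  (forall x, A < `|x| -> f x = 0) ->
  (forall x, A < `|x| -> df x = 0) ->
  (\int[@lebesgue_measure R]_x (df x)%:E = 0)%E.
Proof.
move=> dfE cdf f0 df0; pose B := `|A| + 1.
have B0 : 0 < B by rewrite ltr_wpDl.
have AB : A < B by rewrite (le_lt_trans (ler_norm A))// ltrDl.
have -> : (\int[@lebesgue_measure R]_x (df x)%:E =
    \int[lebesgue_measure]_(x in `[(- B)%R, B]) (df x)%:E)%E.
  rewrite [RHS]integral_mkcond; apply: eq_integral => x _; rewrite patchE.
  case: ifPn => //; rewrite notin_setE/= in_itv/= => /negP; rewrite -ler_norml -ltNge => Bx.
  by rewrite df0// (lt_trans AB).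
rewrite (@continuous_FTC2 _ df f) //.
- by rewrite !f0 ?subee// ?normrN gtr0_norm.
- by rewrite gt0_cp.
- exact: continuous_subspaceT.
- have cf : continuous f.
    by move=> x; apply/differentiable_continuous/derivable1_diffP; have [] := dfE x.
  split.
  + by move=> x _; have [] := dfE x.
  + by apply: cvg_at_right_filter; exact: cf.
  + by apply: cvg_at_left_filter; exact: cf.
- by move=> x _; rewrite derive1E; have [_ ->] := dfE x.
Qed.

Lemma integral_partial1 (w : plane -> R) A :
  (forall z, derivable w z (1, 0)) -> continuous (partial1 w) ->
  vanishes_off A w -> (\int[mu2]_z (partial1 w z)%:E = 0)%E.
Proof.
move=> dw cw w0.
have iw : mu2.-integrable [set: mplane] (EFin \o partial1 w).
  by apply: (@L1loc_integrable _ _ A); [exact: L1loc_continuous|exact: vanishes_off_derive].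
rewrite -(integral21_prod_meas1 iw) /fubini_G/= integral0_eq// => y _.
apply: (@integral_derivative_cpt (fun x => w (x, y)) _ A).
- by move=> x; exact: is_derive_slice1.
- exact: continuous_slice1.
- by move=> x Ax; apply: w0 => /boxP[/=]; rewrite leNgt Ax.
- by move=> x Ax; apply: (@vanishes_off_derive w A (1, 0) w0) => /boxP[/=]; rewrite leNgt Ax.
Qed.

Lemma integral_partial2 (w : plane -> R) A :
  (forall z, derivable w z (0, 1)) -> continuous (partial2 w) ->
  vanishes_off A w -> (\int[mu2]_z (partial2 w z)%:E = 0)%E.
Proof.
move=> dw cw w0.
have iw : mu2.-integrable [set: mplane] (EFin \o partial2 w).
  by apply: (@L1loc_integrable _ _ A); [exact: L1loc_continuous|exact: vanishes_off_derive].
rewrite -(integral12_prod_meas1 iw) /fubini_F/= integral0_eq// => x _.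
apply: (@integral_derivative_cpt (fun y => w (x, y)) _ A).
- by move=> y; exact: is_derive_slice2.
- exact: continuous_slice2.
- by move=> y Ay; apply: w0 => /boxP[/= _]; rewrite leNgt Ay.
- by move=> y Ay; apply: (@vanishes_off_derive w A (0, 1) w0) => /boxP[/= _]; rewrite leNgt Ay.
Qed.

Lemma vanishes_offMr (g phi : plane -> R) A : vanishes_off A phi ->
  vanishes_off A (fun z => g z * phi z).
Proof. by move=> phi0 z /phi0 ->; rewrite mulr0. Qed.

(** The integral of a coordinate derivative of a compactly supported function
    vanishes, by Fubini and the fundamental theorem of calculus; this is applied
    to [U * phi]. Both coordinate directions are treated at once. *)
Lemma integration_by_parts_plane (v : plane) (U phi : plane -> R) A :
  v = (1, 0) \/ v = (0, 1) ->
  (forall z, derivable U z v) -> (forall z, derivable phi z v) ->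
  continuous U -> continuous phi ->
  continuous (fun z => 'D_v U z) -> continuous (fun z => 'D_v phi z) ->
  vanishes_off A phi ->
  \int[mu2]_z (U z * 'D_v phi z) = - \int[mu2]_z ('D_v U z * phi z).
Proof.
move=> hv dU dphi cU cphi cdU cdphi phi0.
have DE z : 'D_v (U * phi) z = U z * 'D_v phi z + 'D_v U z * phi z.
  by rewrite deriveM// [in RHS]addrC /GRing.scale/= addrC [phi z * _]mulrC addrC.
have dU' z : derivable (U * phi) z v by exact: derivableM.
have c1 : continuous (fun z => U z * 'D_v phi z).
  by move=> z; apply: cvgM; [exact: cU|exact: cdphi].
have c2 : continuous (fun z => 'D_v U z * phi z).
  by move=> z; apply: cvgM; [exact: cdU|exact: cphi].
have cD : continuous (fun z => 'D_v (U * phi) z).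
  have -> : (fun z => 'D_v (U * phi) z) = (fun z => U z * 'D_v phi z + 'D_v U z * phi z).
    exact/funext.
  by move=> z; apply: cvgD; [exact: c1|exact: c2].
have v0 : vanishes_off A (U * phi) by exact: (@vanishes_offMr U phi A phi0).
have i1 : mu2.-integrable [set: mplane] (EFin \o (fun z => U z * 'D_v phi z)).
  apply: (@L1loc_integrable _ _ A); first exact: L1loc_continuous.
  by apply: vanishes_offMr; exact: vanishes_off_derive.
have i2 : mu2.-integrable [set: mplane] (EFin \o (fun z => 'D_v U z * phi z)).
  apply: (@L1loc_integrable _ _ A); first exact: L1loc_continuous.
  exact: vanishes_offMr.
apply/eqP; rewrite -addr_eq0 -RintegralD//.
rewrite /Rintegral; under eq_integral do rewrite -DE.
case: hv => hv; move: dU' cD v0; rewrite hv => dU' cD v0.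
  by rewrite (integral_partial1 dU' cD v0).
by rewrite (integral_partial2 dU' cD v0).
Qed.

End IntegrationByParts.

(** * Smooth functions *)

Section SmoothFunctions.
Context {R : realType}.
Local Notation plane := (R * R)%type.

Definition smooth (phi : plane -> R) := forall k, Ck k phi.

Lemma smooth_continuous phi : smooth phi -> continuous phi.
Proof. by move=> /(_ 0%N). Qed.

Lemma smooth_derivable1 phi z : smooth phi -> derivable phi z (1, 0).
Proof. by move=> /(_ 1%N)[+ _ _ _]; exact. Qed.

Lemma smooth_derivable2 phi z : smooth phi -> derivable phi z (0, 1).
Proof. by move=> /(_ 1%N)[_ + _ _]; exact. Qed.

Lemma smooth_partial1 phi : smooth phi -> smooth (partial1 phi).
Proof. by move=> sphi k; have [_ _ + _] := sphi k.+1. Qed.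

Lemma smooth_partial2 phi : smooth phi -> smooth (partial2 phi).
Proof. by move=> sphi k; have [_ _ _ +] := sphi k.+1. Qed.

Lemma CkD k (f g : plane -> R) : Ck k f -> Ck k g -> Ck k (f + g).
Proof.
elim: k f g => [f g cf cg z|k IH f g [f1 f2 pf1 pf2] [g1 g2 pg1 pg2]].
  by apply: cvgD; [exact: cf|exact: cg].
split => [z|z||]; try exact: derivableD.
- have -> : partial1 (f + g) = partial1 f + partial1 g.
    by apply/funext => z; rewrite /partial1 deriveD.
  exact: IH.
- have -> : partial2 (f + g) = partial2 f + partial2 g.
    by apply/funext => z; rewrite /partial2 deriveD.
  exact: IH.
Qed.

Lemma smoothM (f g : plane -> R) : smooth f -> smooth g -> smooth (f * g).
Proof.
move=> sf sg k; elim: k f g sf sg => [f g sf sg z|k IH f g sf sg].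
  by apply: cvgM; [exact: smooth_continuous sf z|exact: smooth_continuous sg z].
have df1 z : derivable f z (1, 0) := @smooth_derivable1 _ z sf.
have dg1 z : derivable g z (1, 0) := @smooth_derivable1 _ z sg.
have df2 z : derivable f z (0, 1) := @smooth_derivable2 _ z sf.
have dg2 z : derivable g z (0, 1) := @smooth_derivable2 _ z sg.
split => [z|z||]; try exact: derivableM.
- have -> : partial1 (f * g) = f * partial1 g + g * partial1 f.
    by apply/funext => z; rewrite /partial1 deriveM.
  by apply: CkD; apply: IH => //; exact: smooth_partial1.
- have -> : partial2 (f * g) = f * partial2 g + g * partial2 f.
    by apply/funext => z; rewrite /partial2 deriveM.
  by apply: CkD; apply: IH => //; exact: smooth_partial2.
Qed.

(** A smooth function of one variable comes with the sequence of its
    derivatives, which avoids reasoning on iterated derivatives. *)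
Definition derivatives (d : nat -> R -> R) :=
  forall n x, is_derive x (1 : R) (d n) (d n.+1 x).

Lemma is_derive_fst (u : R -> R) du (z : plane) :
  is_derive z.1 (1 : R) u du -> is_derive z (1, 0) (fun z => u z.1) du.
Proof.
move=> [du1 du2].
have E : (fun h : R => h^-1 *: (u (h *: (1 : R) + z.1) - u z.1)) =
         (fun h : R => h^-1 *: ((fun z => u z.1) (h *: (1, 0) + z) - (fun z => u z.1) z)) by [].
by split; [move: du1; rewrite /derivable E|move: du2; rewrite /derive E].
Qed.

Lemma is_derive_snd (u : R -> R) du (z : plane) :
  is_derive z.2 (1 : R) u du -> is_derive z (0, 1) (fun z => u z.2) du.
Proof.
move=> [du1 du2].
have E : (fun h : R => h^-1 *: (u (h *: (1 : R) + z.2) - u z.2)) =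
         (fun h : R => h^-1 *: ((fun z => u z.2) (h *: (0, 1) + z) - (fun z => u z.2) z)) by [].
by split; [move: du1; rewrite /derivable E|move: du2; rewrite /derive E].
Qed.

Lemma is_derive_fst0 (u : R -> R) (z : plane) :
  is_derive z (0, 1) (fun z => u z.1) 0.
Proof.
have E : (fun h : R => h^-1 *: ((fun z => u z.1) (h *: (0, 1) + z) - (fun z => u z.1) z)) = cst 0.
  by apply/funext => h /=; rewrite scaler0 add0r subrr scaler0.
split; first by rewrite /derivable E; exact: is_cvg_cst.
by rewrite /derive E; exact: lim_cst.
Qed.

Lemma is_derive_snd0 (u : R -> R) (z : plane) :
  is_derive z (1, 0) (fun z => u z.2) 0.
Proof.
have E : (fun h : R => h^-1 *: ((fun z => u z.2) (h *: (1, 0) + z) - (fun z => u z.2) z)) = cst 0.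
  by apply/funext => h /=; rewrite scaler0 add0r subrr scaler0.
split; first by rewrite /derivable E; exact: is_cvg_cst.
by rewrite /derive E; exact: lim_cst.
Qed.

Lemma is_derive1_continuous (f df : R -> R) :
  (forall x, is_derive x (1 : R) f (df x)) -> continuous f.
Proof.
by move=> df1 x; apply/differentiable_continuous/derivable1_diffP; have [] := df1 x.
Qed.

Lemma Ck_cst0 k : Ck k (fun _ : plane => 0 : R).
Proof.
elim: k => [|k IH] /=; first by move=> z; exact: cvg_cst.
have E1 : partial1 (fun _ : plane => 0 : R) = fun=> 0.
  by apply/funext => z; exact: derive_cst.
have E2 : partial2 (fun _ : plane => 0 : R) = fun=> 0.
  by apply/funext => z; exact: derive_cst.
by split; rewrite ?E1 ?E2 // => z; exact: derivable_cst.
Qed.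

Lemma smooth_fst d : derivatives d -> smooth (fun z => d 0%N z.1).
Proof.
move=> dd k; elim: k 0%N => [n z|k IH n] /=.
  apply: (continuous_comp (f := fst)); first exact: cvg_fst.
  exact: (is_derive1_continuous (dd n)).
have E1 : partial1 (fun z => d n z.1) = fun z => d n.+1 z.1.
  by apply/funext => z; have [_] := is_derive_fst (dd n z.1).
have E2 : partial2 (fun z => d n z.1) = fun=> 0.
  by apply/funext => z; have [_] := is_derive_fst0 (d n) z.
split => [z|z||]; rewrite ?E1 ?E2 //; last exact: Ck_cst0.
- by have [] := is_derive_fst (dd n z.1).
- by have [] := is_derive_fst0 (d n) z.
Qed.

Lemma smooth_snd d : derivatives d -> smooth (fun z => d 0%N z.2).
Proof.
move=> dd k; elim: k 0%N => [n z|k IH n] /=.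
  apply: (continuous_comp (f := snd)); first exact: cvg_snd.
  exact: (is_derive1_continuous (dd n)).
have E1 : partial2 (fun z => d n z.2) = fun z => d n.+1 z.2.
  by apply/funext => z; have [_] := is_derive_snd (dd n z.2).
have E2 : partial1 (fun z => d n z.2) = fun=> 0.
  by apply/funext => z; have [_] := is_derive_snd0 (d n) z.
split => [z|z||]; rewrite ?E1 ?E2 //; last exact: Ck_cst0.
- by have [] := is_derive_snd0 (d n) z.
- by have [] := is_derive_snd (dd n z.2).
Qed.

Lemma is_derive_affine (a b x : R) :
  is_derive x (1 : R) (fun x => a * x + b) a.
Proof.
have h : is_derive x (1 : R) (a *: (id : R -> R) + cst b) (a *: 1 + 0).
  by apply: is_deriveD.
by apply: (is_derive_eq h); rewrite /GRing.scale/= mulr1 addr0.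
Qed.

Lemma derivatives_affine d a b : derivatives d ->
  derivatives (fun n x => a ^+ n * d n (a * x + b)).
Proof.
move=> dd n x.
have h := is_derive1_comp (g := fun x => a * x + b) (dd n (a * x + b)) (is_derive_affine a b x).
have h2 : is_derive x (1 : R) (a ^+ n *: (d n \o (fun x => a * x + b)))
    (a ^+ n *: (d n.+1 (a * x + b) * a)) by apply: is_deriveZ.
by apply: (is_derive_eq h2); rewrite /GRing.scale/= exprS; ring.
Qed.

Lemma pow_expR_bounded n : exists M : R, forall s, 0 <= s -> s ^+ n * expR (- s) <= M.
Proof.
case: n => [|n].
  exists 1 => s s0; rewrite expr0 mul1r expRN invf_le1 ?expR_gt0//.
  by rewrite (le_trans _ (expR_ge1Dx s))// lerDl.
exists (n.+1%:R ^+ n.+1) => s s0.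
rewrite expRN ler_pdivrMr ?expR_gt0//.
have -> : expR s = expR (s / n.+1%:R) ^+ n.+1.
  by rewrite -expRM_natl -mulr_natl mulrC divfK.
rewrite -exprMn lerXn2r ?nnegrE ?mulr_ge0 ?expR_ge0//.
rewrite mulrC -ler_pdivrMr//.
by rewrite (le_trans _ (expR_ge1Dx _))// lerDr.
Qed.

Lemma poly_expR_bounded (p : {poly R}) :
  exists2 M : R, 0 <= M & forall s, 0 <= s -> `|p.[s]| * expR (- s) <= M.
Proof.
have /choice[M HM] := pow_expR_bounded.
exists (\sum_(i < size p) `|p`_i| * M i) => [|s s0].
  apply: sumr_ge0 => i _; apply: mulr_ge0 => //.
  by apply: le_trans (HM i 0 (lexx _)); rewrite mulr_ge0// ?exprn_ge0 ?expR_ge0.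
rewrite horner_coef (le_trans (ler_wpM2r (expR_ge0 _) (ler_norm_sum _ _ _)))//.
rewrite mulr_suml ler_sum// => i _; rewrite normrM -mulrA ler_wpM2l//.
by rewrite ger0_norm ?exprn_ge0// HM.
Qed.

(** The derivatives of the flat function [exp (- 1 / t)] are [exp (- 1 / t)]
    times polynomials in [1 / t], given by this recursion. *)
Fixpoint flat_poly (n : nat) : {poly R} :=
  if n is m.+1 then 'X^2 * (flat_poly m - (flat_poly m)^`()) else 1.

Definition flat (n : nat) (t : R) : R :=
  if 0 < t then (flat_poly n).[t^-1] * expR (- t^-1) else 0.

Lemma is_derive_flat_gt0 n (t : R) : 0 < t -> is_derive t (1 : R) (flat n) (flat n.+1 t).
Proof.
move=> t0; have tn0 : t != 0 by rewrite gt_eqF.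
have dV : is_derive t (1 : R) (fun t : R => t^-1) (- t ^- 2 *: 1).
  exact: (is_deriveV (f := id)).
have dP := is_derive1_comp (is_derive_poly (flat_poly n) (t^-1)) dV.
have dE := is_derive1_comp (g := fun t => - t^-1) (is_derive_expR (- t^-1)) (is_deriveN dV).
have := is_deriveM dP dE.
rewrite /flat t0 /= => h.
apply: (@near_eq_is_derive _ _ _ (((fun x => (flat_poly n).[x]) \o (fun t : R => t^-1)) *
    (expR \o (fun t : R => - t^-1)))).
  near=> s; have s0 : 0 < s.
    by near: s; apply: open_nbhs_nbhs; split => //; exact: open_gt.
  by rewrite s0.
apply: is_derive_eq; rewrite /GRing.scale/= hornerM hornerXn hornerD hornerN.
by rewrite !mulr1 exprVn; ring.
Unshelve. all: by end_near. Qed.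

(** At [0] the difference quotient is again a polynomial in [1 / h] times
    [exp (- 1 / h)], hence tends to [0]. *)
Lemma is_derive_flat n t : is_derive t (1 : R) (flat n) (flat n.+1 t).
Proof.
have [t0|t0|<-] := ltgtP 0 t; first exact: is_derive_flat_gt0.
- rewrite {2}/flat ltNge ltW//=.
  have h : is_derive t (1 : R) (cst 0 : R -> R) 0 by exact: is_derive_cst.
  apply: near_eq_is_derive h.
  near=> s; rewrite /flat ltNge ltW//=; near: s.
  by apply: open_nbhs_nbhs; split => //; exact: open_lt.
rewrite {2}/flat ltxx.
have [M M0 HM] := poly_expR_bounded ('X^2 * flat_poly n).
have lim0 : h^-1 *: (flat n (h *: (1 : R) + 0) - flat n 0) @[h --> (0:R)^'] --> (0 : R).
  apply/cvgr0Pnorm_le => e e0.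
  near=> h.
  have h0 : h != 0 by near: h; exact: nbhs_dnbhs_neq.
  rewrite /flat ltxx subr0 addr0 /GRing.scale/= mulr1.
  case: ifPn => hp; last by rewrite mulr0 normr0 ltW.
  have hV0 : 0 <= h^-1 by rewrite invr_ge0 (ltW hp).
  have := HM _ hV0.
  rewrite hornerM hornerXn !normrM (ger0_norm (expR_ge0 _)).
  rewrite !(ger0_norm hV0) => le1.
  apply: (@le_trans _ _ (h * M)).
    rewrite (_ : h^-1 * _ = h * (h^-1 * h^-1 * `|(flat_poly n).[h^-1]| * expR (- h^-1))).
      by rewrite ler_wpM2l// ltW.
    by field.
  have : `|h| <= e / (M + 1).
    near: h; apply: dnbhs0_le; by rewrite divr_gt0// ltr_wpDl.
  rewrite gtr0_norm// ler_pdivlMr ?ltr_wpDl//; apply: le_trans.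
  by apply: ler_wpM2l; [exact: ltW|rewrite lerDl].
by split; [apply/cvg_ex; exists 0|apply/cvg_lim].
Unshelve. all: by end_near. Qed.

Lemma derivatives_flat : derivatives flat.
Proof. by move=> n x; exact: is_derive_flat. Qed.

Lemma flat0E t : flat 0 t = if 0 < t then expR (- t^-1) else 0.
Proof. by rewrite /flat /= hornerC mul1r. Qed.

Lemma flat0_ge0 t : 0 <= flat 0 t.
Proof. by rewrite flat0E; case: ifP => // _; exact: expR_ge0. Qed.

Lemma flat0_gt0 t : 0 < t -> 0 < flat 0 t.
Proof. by move=> t0; rewrite flat0E t0 expR_gt0. Qed.

Lemma flat0_le0 t : t <= 0 -> flat 0 t = 0.
Proof. by move=> t0; rewrite flat0E ltNge t0. Qed.

Lemma flat0_le1 t : flat 0 t <= 1.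
Proof.
rewrite flat0E; case: ifP => // t0; rewrite expRN invf_le1 ?expR_gt0//.
by rewrite (le_trans _ (expR_ge1Dx _))// lerDl invr_ge0 ltW.
Qed.

End SmoothFunctions.

(** * Uniqueness of weak derivatives *)

Section FundamentalLemma.
Context {R : realType}.
Local Notation plane := (R * R)%type.
Local Notation mplane := (measurableTypeR R * measurableTypeR R)%type.
Local Notation mu2 := (@lebesgue2 R).

Definition open_rect (a b c d : R) : set plane := `]a, b[ `*` `]c, d[.

Lemma open_rect_measurable a b c d : measurable (open_rect a b c d : set mplane).
Proof. by apply: measurable_rectangle; exact: measurable_itv. Qed.

(** Test functions increasing to the indicator of an open rectangle. *)
Definition rect_bump (a b c d : R) (n : nat) (z : plane) : R :=
  flat 0 (n.+1%:R * (z.1 - a)) * flat 0 (n.+1%:R * (b - z.1)) *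
  flat 0 (n.+1%:R * (z.2 - c)) * flat 0 (n.+1%:R * (d - z.2)).

Lemma rect_bump_smooth a b c d n : smooth (rect_bump a b c d n).
Proof.
pose N : R := n.+1%:R.
have F (s t : R) : smooth (fun z : plane => flat 0 (s * z.1 + t)).
  have := smooth_fst (derivatives_affine s t (@derivatives_flat R)).
  by congr smooth; apply/funext => z; rewrite expr0 mul1r.
have G (s t : R) : smooth (fun z : plane => flat 0 (s * z.2 + t)).
  have := smooth_snd (derivatives_affine s t (@derivatives_flat R)).
  by congr smooth; apply/funext => z; rewrite expr0 mul1r.
have -> : rect_bump a b c d n =
    (fun z => flat 0 (N * z.1 + - (N * a))) * (fun z => flat 0 (- N * z.1 + N * b)) *
    (fun z => flat 0 (N * z.2 + - (N * c))) * (fun z => flat 0 (- N * z.2 + N * d)).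
  apply/funext => z; rewrite /rect_bump -/N !fctE.
  by congr (flat 0 _ * flat 0 _ * flat 0 _ * flat 0 _); ring.
by apply: smoothM => //; apply: smoothM => //; exact: smoothM.
Qed.

Lemma rect_bump0 a b c d n z : ~ open_rect a b c d z -> rect_bump a b c d n z = 0.
Proof.
move=> nz; rewrite /rect_bump.
have [xa|xa] := leP z.1 a.
  by rewrite flat0_le0 ?mul0r// mulr_ge0_le0// subr_le0.
have [xb|xb] := leP b z.1.
  by rewrite (@flat0_le0 _ (_ * (b - _))) ?(mul0r, mulr0)// mulr_ge0_le0// subr_le0.
have [xc|xc] := leP z.2 c.
  by rewrite (@flat0_le0 _ (_ * (_ - c))) ?(mul0r, mulr0)// mulr_ge0_le0// subr_le0.
have [xd|xd] := leP d z.2.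
  by rewrite (@flat0_le0 _ (_ * (d - _))) ?(mul0r, mulr0)// mulr_ge0_le0// subr_le0.
by exfalso; apply: nz; split; rewrite /= in_itv/=; apply/andP.
Qed.

Lemma rect_bump_ge0 a b c d n z : 0 <= rect_bump a b c d n z.
Proof. by rewrite /rect_bump !mulr_ge0 ?flat0_ge0. Qed.

Lemma rect_bump_le1 a b c d n z : rect_bump a b c d n z <= 1.
Proof. by rewrite /rect_bump !mulr_ile1 ?mulr_ge0 ?flat0_ge0 ?flat0_le1. Qed.

Lemma flat0_cvg1 (t : R) : 0 < t -> flat 0 (n.+1%:R * t) @[n --> \oo] --> (1 : R).
Proof.
move=> t0.
have -> : (fun n : nat => flat 0 (n.+1%:R * t)) =
          (fun n : nat => expR (- (harmonic n * t^-1))).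
  by apply/funext => n; rewrite flat0E mulr_gt0//= invfM.
rewrite -[X in _ --> X]expR0 -oppr0 -[X in - X](mul0r t^-1).
apply: (@continuous_cvg _ _ _ _ _ _ expR); first exact: continuous_expR.
by apply: cvgN; apply: cvgM; [exact: cvg_harmonic|exact: cvg_cst].
Qed.

Lemma rect_bump_cvg a b c d z :
  rect_bump a b c d n z @[n --> \oo] --> (\1_(open_rect a b c d) z : R).
Proof.
rewrite indicE; case: (boolP (z \in _)) => [|nz]; last first.
  have -> : (fun n => rect_bump a b c d n z) = cst 0.
    by apply/funext => n; apply: rect_bump0; move: nz; rewrite notin_setE.
  exact: cvg_cst.
rewrite inE => -[]; rewrite /= !in_itv/= => /andP[xa xb] /andP[yc yd].
rewrite -[X in _ --> X]mulr1 -[X in X * 1]mulr1 -[X in X * 1 * 1]mulr1.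
by apply: cvgM; [apply: cvgM; [apply: cvgM|]|]; apply: flat0_cvg1; rewrite subr_gt0.
Qed.

Lemma open_rect_box a b c d :
  exists A, vanishes_off A (\1_(open_rect a b c d) : plane -> R).
Proof.
exists (`|a| + `|b| + `|c| + `|d|) => z; apply: contra_notP => /eqP.
rewrite indicE; case: (boolP (z \in _)); rewrite ?eqxx// inE => -[].
rewrite /= !in_itv/= => /andP[xa xb] /andP[yc yd] _; apply/boxP.
have := (ler_norm a, ler_norm b, ler_norm c, ler_norm d).
have := (lerNnormlW (lexx `|a|), lerNnormlW (lexx `|b|)).
have := (lerNnormlW (lexx `|c|), lerNnormlW (lexx `|d|)).
move=> [? ?] [? ?] [[[? ?] ?] ?].
rewrite !ler_norml; split; apply/andP; split; lra.
Qed.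

Variable g : plane -> R.
Hypothesis lg : L1loc g.
Hypothesis g0 : forall phi, test_function phi -> \int[mu2]_z (g z * phi z) = 0.

Lemma weak_zero_rect a b c d :
  (\int[mu2]_(z in open_rect a b c d) (g z)%:E = 0)%E.
Proof.
have [A RA] := open_rect_box a b c d.
have vb n : vanishes_off A (rect_bump a b c d n).
  move=> z /RA; rewrite indicE => /eqP; case: (boolP (z \in _)); rewrite ?oner_eq0// notin_setE.
  by move=> ? _; exact: rect_bump0.
pose f_ (n : nat) (z : mplane) := (g z * rect_bump a b c d n z)%:E.
pose f (z : mplane) := (g z * \1_(open_rect a b c d) z)%:E.
have mg : measurable_fun [set: mplane] g by have [] := lg.
have ig : mu2.-integrable [set: mplane] ((EFin \o (fun z => `|g z|)) \_ (box A)).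
  rewrite -(integrable_mkcond _ (box_measurable A)).
  by have := integrable_abse (lg.2 _ (box_compact (A := A))).
have [] := @dominated_convergence _ _ _ mu2 setT measurableT f_ f _ _ _ _ ig.
- move=> n; apply/measurable_EFinP; apply: measurable_funM => //.
  by apply: plane_continuous_measurable; exact/smooth_continuous/rect_bump_smooth.
- apply/measurable_EFinP; apply: measurable_funM => //.
  by apply: measurable_indic; exact: open_rect_measurable.
- apply: aeW => z _; apply: cvg_EFin; first by near=> n.
  by apply: cvgM; [exact: cvg_cst|exact: rect_bump_cvg].
- apply: aeW => z n _; rewrite /f_ /= patchE.
  case: ifPn => [_|]; last by rewrite notin_setE => /vb ->; rewrite mulr0 normr0.
  rewrite lee_fin normrM (ger0_norm (rect_bump_ge0 _ _ _ _ _ _)).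
  by rewrite ler_piMr// rect_bump_le1.
move=> _ _ lim0.
have -> : (\int[mu2]_(z in open_rect a b c d) (g z)%:E = \int[mu2]_z f z)%E.
  rewrite integral_mkcond; apply: eq_integral => z _; rewrite /f patchE indicE.
  by case: (boolP (z \in _)); rewrite ?mulr1 ?mulr0.
apply: (cvg_unique _ lim0); first exact: ereal_hausdorff.
rewrite (_ : (fun n => _) = cst 0%E); first exact: cvg_cst.
apply/funext => n /=.
have tf : test_function (rect_bump a b c d n).
  by apply: (box_test_function (A := A)) => //; exact: rect_bump_smooth.
have := g0 tf; rewrite /Rintegral => h.
rewrite -[LHS]fineK ?h//.
apply: integrable_fin_num => //; apply: (@L1loc_integrable _ _ A).
  by apply: L1locM => //; exact/smooth_continuous/rect_bump_smooth.
exact: vanishes_offMr.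
Unshelve. all: by end_near. Qed.

Definition open_rects : set (set plane) :=
  [set X | exists a b c d, X = open_rect a b c d].

Lemma open_rects_setI : setI_closed open_rects.
Proof.
move=> _ _ [a [b [c [d ->]]]] [a' [b' [c' [d' ->]]]].
exists (Num.max a a'), (Num.min b b'), (Num.max c c'), (Num.min d d').
apply/seteqP; split => -[x y]; rewrite /open_rect /= !in_itv/= !gt_max !lt_min.
  by move=> [[/andP[-> ->] /andP[-> ->]] [/andP[-> ->] /andP[-> ->]]].
by move=> [/andP[/andP[-> ->] /andP[-> ->]] /andP[/andP[-> ->] /andP[-> ->]]].
Qed.

Lemma measurable_open_rects : @measurable _ mplane `<=` <<s open_rects >>.
Proof.
pose T' := g_sigma_algebraType open_rects.
have nat_gt (x : R) : exists n : nat, `|x| < n%:R.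
  exists (Num.truncn `|x|).+1; exact: truncnS_gt.
have m1 : measurable_fun [set: T'] (fst : T' -> measurableTypeR R).
  apply: (measurability _ (RGenOpens.measurableE R)).
  move=> _ [_ [a [b ->] <-]]; rewrite setTI.
  have -> : fst @^-1` `]a, b[ = \bigcup_n (open_rect a b (- n%:R) n%:R).
    apply/seteqP; split=> [[x y] /= xab|[x y] [n _ []]] //=.
    have [n xn] := nat_gt y; exists n => //; split => //=.
    by rewrite in_itv/= -ltr_norml.
  apply: bigcupT_measurable => n; apply: sub_sigma_algebra.
  by exists a, b, (- n%:R), n%:R.
have m2 : measurable_fun [set: T'] (snd : T' -> measurableTypeR R).
  apply: (measurability _ (RGenOpens.measurableE R)).
  move=> _ [_ [a [b ->] <-]]; rewrite setTI.
  have -> : snd @^-1` `]a, b[ = \bigcup_n (open_rect (- n%:R) n%:R a b).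
    apply/seteqP; split=> [[x y] /= xab|[x y] [n _ []]] //=.
    have [n xn] := nat_gt x; exists n => //; split => //=.
    by rewrite in_itv/= -ltr_norml.
  apply: bigcupT_measurable => n; apply: sub_sigma_algebra.
  by exists (- n%:R), n%:R, a, b.
rewrite measurable_prod_measurableType; apply: smallest_sub.
  exact: smallest_sigma_algebra.
move=> _ [A mA [B mB <-]].
have -> : A `*` B = (fst @^-1` A) `&` (snd @^-1` B) by apply/seteqP; split.
apply: (@measurableI _ T').
  by rewrite -[X in measurable X]setTI; exact: m1.
by rewrite -[X in measurable X]setTI; exact: m2.
Qed.

(** Dominated convergence along [rect_bump] shows that the integral of [g] over
    every rectangle is zero. Rectangles form a pi-system generating the
    sigma-algebra, so that the integral of [g] over every measurable subset of a
    fixed square is zero as well. *)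
Lemma weak_zero : {ae mu2, forall z, g z = 0}.
Proof.
suff H (m : nat) : {ae mu2, forall z, open_rect (- m%:R) m%:R (- m%:R) m%:R z -> g z = 0}.
  have := ae_foralln H; apply: filterS => z gz.
  apply: (gz (Num.truncn (`|z.1| + `|z.2|)).+1).
  have h := truncnS_gt (`|z.1| + `|z.2|).
  split; rewrite /= in_itv/= -ltr_norml (le_lt_trans _ h)// ?lerDl ?lerDr//.
set D := open_rect _ _ _ _.
pose f : mplane -> \bar R := (EFin \o g) \_ D.
have mg : measurable_fun [set: mplane] g by have [] := lg.
have mD : measurable (D : set mplane) by exact: open_rect_measurable.
have intf : mu2.-integrable [set: mplane] f.
  rewrite /f -(integrable_mkcond _ mD).
  apply: (@integrableS _ _ _ mu2 (box m%:R)) => //.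
  - exact: box_measurable.
  - move=> z [/= z1 z2]; split => /=.
      by move: z1; rewrite !in_itv/= => /andP[/ltW -> /ltW ->].
    by move: z2; rewrite !in_itv/= => /andP[/ltW -> /ltW ->].
  - by apply: lg.2; exact: box_compact.
pose H : set (set mplane) := [set E | measurable E /\ (\int[mu2]_(z in E) f z = 0)%E].
have Hrect : open_rects `<=` H.
  move=> _ [a [b [c [d ->]]]]; split; first exact: open_rect_measurable.
  have [a' [b' [c' [d' E]]]] : open_rects (open_rect a b c d `&` D).
    by apply: open_rects_setI; [exists a, b, c, d|exists (- m%:R), m%:R, (- m%:R), m%:R].
  rewrite /f -integral_mkcondr E; exact: weak_zero_rect.
have HT : H setT.
  split => //; rewrite /f -integral_mkcondr setTI; exact: weak_zero_rect.
have dynH : dynkin H.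
  split => //.
  - move=> E [mE E0]; split; first exact: measurableC.
    have : (\int[mu2]_(z in E `|` ~` E) f z = 0)%E by rewrite setUCr; exact: HT.2.
    rewrite integral_setU//=.
    + by rewrite E0 add0e.
    + exact: measurableC.
    + by apply: measurable_funTS; exact: (measurable_int _ intf).
    + by rewrite /disj_set setICr.
  - move=> F tF HF.
    have mF k : measurable (F k) by have [] := HF k.
    have mUF : measurable (\bigcup_k F k) by exact: bigcupT_measurable.
    split => //.
    have := @charge_semi_sigma_additive _ _ _ (induced_charge intf) F mF tF mUF.
    move=> lim0; apply: (cvg_unique _ lim0); first exact: ereal_hausdorff.
    rewrite (_ : (fun n => _) = cst 0%E); first exact: cvg_cst.
    by apply/funext => n; rewrite big1// => i _; have [] := HF i.
have Hall E : measurable E -> (\int[mu2]_(z in E) f z = 0)%E.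
  move=> /measurable_open_rects mE.
  have lamH : lambda_system setT H by exact/dynkin_lambda_system.
  by have [] := lambda_system_subset open_rects_setI lamH Hrect (fun _ _ _ _ => I) mE.
have : ae_eq mu2 setT f (cst 0%E).
  apply: integral_ae_eq; [exact: measurableT|exact: intf|exact: measurable_cst|].
  by move=> E _ mE; rewrite Hall// integral_cst// mul0e.
apply: filterS => z /(_ I); rewrite /f patchE => + Dz.
by rewrite mem_set//= => -[].
Qed.

End FundamentalLemma.

(** * A smooth step *)

Section OneVariable.
Context {R : realType}.

Lemma derive_ge0_le (f df : R -> R) a b :
  (forall x, is_derive x (1 : R) f (df x)) ->
  (forall x, a < x < b -> 0 <= df x) -> a <= b -> f a <= f b.
Proof.
move=> dfE df0; rewrite le_eqVlt => /orP[/eqP -> //|ab].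
have [|c cab E] := @MVT _ f df a b ab (fun x _ => dfE x).
  exact/continuous_subspaceT/(is_derive1_continuous dfE).
by rewrite -subr_ge0 E mulr_ge0 ?df0 ?subr_ge0 ?ltW// -in_itv.
Qed.

Lemma derive0_cst (f df : R -> R) a b :
  (forall x, is_derive x (1 : R) f (df x)) ->
  (forall x, a < x < b -> df x = 0) -> a <= b -> f a = f b.
Proof.
move=> dfE df0 ab; apply/eqP; rewrite eq_le; apply/andP; split.
  by apply: derive_ge0_le dfE _ ab => x /df0 ->.
rewrite -lerN2; apply: (@derive_ge0_le (- f) (- df)) => //.
by move=> x /df0 dx0; rewrite /= !fctE dx0 oppr0.
Qed.

Lemma derivativesZ d (k : R) : derivatives d -> derivatives (fun n x => k * d n x).
Proof. by move=> dd n x; exact: is_deriveZ. Qed.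

Lemma derivativesD d e : derivatives d -> derivatives e ->
  derivatives (fun n x => d n x + e n x : R).
Proof. by move=> dd de n x; exact: is_deriveD. Qed.

Definition antideriv (f : R -> R) (x : R) : R :=
  \int[lebesgue_measure]_(t in `]-oo, x]) f t.

Section Antideriv.
Variable f : R -> R.
Hypotheses (cf : continuous f) (f0 : forall x, x <= 0 -> f x = 0).

Lemma antideriv_le0 x : x <= 0 -> antideriv f x = 0.
Proof.
move=> x0; rewrite /antideriv /Rintegral integral0_eq// => t /=.
by rewrite in_itv/= => tx; rewrite f0// (le_trans tx).
Qed.

Lemma is_derive_antideriv x : is_derive x (1 : R) (antideriv f) (f x).
Proof.
have xu : x < `|x| + 1 by rewrite (le_lt_trans (ler_norm x))// ltrDl.
have := @continuous_FTC1 _ f -oo%O x (`|x| + 1) xu.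
case.
- have i0 : lebesgue_measure.-integrable `[0, `|x| + 1] (EFin \o f).
    apply: continuous_compact_integrable; first exact: segment_compact.
    exact: continuous_subspaceT.
  have : lebesgue_measure.-integrable [set: R] ((EFin \o f) \_ `[0, `|x| + 1]).
    exact: ((@integrable_mkcond _ _ _ lebesgue_measure `[0, `|x| + 1]%classic
      (EFin \o f) (measurable_itv _)).1 i0).
  have -> : (EFin \o f) \_ `[0, `|x| + 1] = (EFin \o f) \_ `]-oo, `|x| + 1].
    apply/funext => t; rewrite !patchE /=.
    case: ifPn => [|tn].
      by rewrite inE/= in_itv/= => /andP[_ tx]; rewrite mem_set//= in_itv/=.
    case: ifPn => //; rewrite inE/= in_itv/= => tx.
    move: tn; rewrite notin_setE/= in_itv/= tx andbT => /negP; rewrite -ltNge => t0.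
    by rewrite f0// ltW.
  exact: (@integrable_mkcond _ _ _ lebesgue_measure `]-oo, `|x| + 1]%classic
    (EFin \o f) (measurable_itv _)).2.
- by rewrite ltNyr.
- exact: cf.
move=> dA; rewrite derive1E => AE.
by split; [exact: dA|exact: AE].
Qed.

End Antideriv.

Lemma derivatives_antideriv d : derivatives d ->
  (forall x, x <= 0 -> d 0%N x = 0) ->
  derivatives (fun n => if n is m.+1 then d m else antideriv (d 0%N)).
Proof.
move=> dd d0 [|n] x; last exact: dd.
by apply: is_derive_antideriv => //; exact: (is_derive1_continuous (dd 0%N)).
Qed.

Lemma derivatives_slice (phi : R * R -> R) : smooth phi ->
  derivatives (fun n x => iter n partial1 phi (x, 0)).
Proof.
move=> sphi n x; apply: is_derive_slice1; apply: smooth_derivable1.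
by elim: n => // n IH; exact: smooth_partial1.
Qed.

(** The step [st 1] is the normalised integral of the bump
    [flat 0 x * flat 0 (1 - x)]. Its antiderivative [st 0], equal to a translate
    of the positive part away from the unit interval, is what gets paired with
    second derivatives. *)
Lemma smooth_step_exists : exists (st : nat -> R -> R) (K m : R),
  [/\ derivatives st,
      forall x, x <= 0 -> [/\ st 0%N x = 0, st 1%N x = 0 & st 2%N x = 0],
      forall x, 1 <= x -> [/\ st 0%N x = x - m, st 1%N x = 1 & st 2%N x = 0],
      forall x, 0 <= st 1%N x <= 1 /\ 0 <= st 2%N x <= K
    & forall x, 0 <= x -> 0 <= st 0%N x <= x].
Proof.
have [d [dd d0E]] : exists d : nat -> R -> R, derivatives d /\
    forall x : R, d 0%N x = flat 0 x * flat 0 (1 - x).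
  pose phi : R * R -> R := (fun z => flat 0 z.1) *
     (fun z => (-1) ^+ 0 * flat 0 (-1 * z.1 + 1)).
  have sphi : smooth phi.
    apply: smoothM; first exact: (smooth_fst (@derivatives_flat R)).
    exact: (smooth_fst (derivatives_affine (-1) 1 (@derivatives_flat R))).
  exists (fun n x => iter n partial1 phi (x, 0)); split.
    exact: derivatives_slice.
  by move=> x; rewrite /phi/= fctE/= expr0 mul1r mulN1r addrC.
have d00 x : x <= 0 -> d 0%N x = 0.
  by move=> x0; rewrite d0E flat0_le0 ?mul0r.
have d01 x : 1 <= x -> d 0%N x = 0.
  by move=> x1; rewrite d0E (@flat0_le0 _ (1 - x)) ?mulr0// subr_le0.
have d0_ge0 x : 0 <= d 0%N x by rewrite d0E mulr_ge0 ?flat0_ge0.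
have d0_le1 x : d 0%N x <= 1 by rewrite d0E mulr_ile1 ?flat0_ge0 ?flat0_le1.
have dA := derivatives_antideriv dd d00.
pose A := antideriv (d 0%N).
have A0 x : x <= 0 -> A x = 0 by exact: antideriv_le0.
have Z0 : 0 < A 1.
  have [|c] := @MVT _ A (d 0%N) 0 1 ltr01 (fun x _ => dA 0%N x).
    exact/continuous_subspaceT/(is_derive1_continuous (dA 0%N)).
  rewrite in_itv/= => /andP[c0 c1]; rewrite (A0 0)// !subr0 mulr1 => ->.
  by rewrite d0E mulr_gt0// flat0_gt0// subr_gt0.
pose s (n : nat) (x : R) := (A 1)^-1 * (if n is m.+1 then d m else A) x.
have ds : derivatives s by exact: derivativesZ.
have s00 x : x <= 0 -> s 0%N x = 0 by move=> x0; rewrite /s (A0 x)// mulr0.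
have s10 x : x <= 0 -> s 1%N x = 0 by move=> x0; rewrite /s (d00 x)// mulr0.
have s11 x : 1 <= x -> s 1%N x = 0 by move=> x1; rewrite /s (d01 x)// mulr0.
have s1_ge0 x : 0 <= s 1%N x by rewrite mulr_ge0// invr_ge0 ltW.
have s01 x : 1 <= x -> s 0%N x = 1.
  have E : s 0%N 1 = 1 by rewrite /s mulVf// gt_eqF.
  move=> x1; rewrite -[RHS]E; apply/esym/(derive0_cst (ds 0%N)) => //.
  by move=> y /andP[y1 _]; rewrite s11// ltW.
have s0_ge0 x : 0 <= s 0%N x.
  have [x0|x0] := leP x 0; first by rewrite s00.
  rewrite -[leLHS](s00 0 (lexx _)); apply: derive_ge0_le (ds 0%N) _ (ltW x0).
  by move=> y _; exact: s1_ge0.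
have s0_le1 x : s 0%N x <= 1.
  have [x1|x1] := leP x 1; last by rewrite s01// ltW.
  rewrite -[leRHS](s01 1 (lexx _)); apply: derive_ge0_le (ds 0%N) _ x1.
  by move=> y _; exact: s1_ge0.
have dst := derivatives_antideriv ds s00.
pose B := antideriv (s 0%N).
have B0 x : x <= 0 -> B x = 0 by exact: antideriv_le0.
exists (fun n => if n is m.+1 then s m else B), (A 1)^-1, (1 - B 1); split => //.
- by move=> x x0; split; [exact: B0|exact: s00|exact: s10].
- move=> x x1; split; [|exact: s01|exact: s11].
  have dBid y : is_derive y (1 : R) (B - id) (s 0%N y - 1).
    by apply: is_deriveB; exact: (dst 0%N).
  have : (B - id) 1 = (B - id) x.
    apply: derive0_cst dBid _ x1 => y /andP[y1 _].
    by rewrite s01 ?subrr// ltW.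
  by rewrite !fctE; lra.
- move=> x; split; first by rewrite s0_ge0 s0_le1.
  by rewrite s1_ge0 /= /s ler_piMr// invr_ge0 ltW.
- move=> x x0; apply/andP; split.
    rewrite -[leLHS](B0 0 (lexx _)); apply: derive_ge0_le (dst 0%N) _ x0.
    by move=> y _; exact: s0_ge0.
  have dBid y : is_derive y (1 : R) (id - B) (1 - s 0%N y).
    by apply: is_deriveB; exact: (dst 0%N).
  have : (id - B) 0 <= (id - B) x.
    apply: derive_ge0_le dBid _ x0 => y _; by rewrite subr_ge0 s0_le1.
  by rewrite !fctE B0// subr0 subr_ge0.
Qed.

End OneVariable.

(** * The three-point inequality for traces *)

Section ThreePoint.
Context {R : realType}.
Local Notation plane := (R * R)%type.
Local Notation mplane := (measurableTypeR R * measurableTypeR R)%type.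
Local Notation mu2 := (@lebesgue2 R).

Definition rect (a b h : R) : set plane := `[a, b] `*` `[0, h].

Lemma rect_measurable a b h : measurable (rect a b h : set mplane).
Proof. by apply: measurable_rectangle; exact: measurable_itv. Qed.

Lemma rect_compact a b h : compact (rect a b h).
Proof. by apply: compact_setX; exact: segment_compact. Qed.

Lemma rectP a b h (z : plane) : rect a b h z <-> (a <= z.1 <= b) /\ (0 <= z.2 <= h).
Proof. by rewrite /rect/= !in_itv/=; split. Qed.

Definition mass (H : plane -> R) (a b h : R) : R := \int[mu2]_(z in rect a b h) H z.

Lemma mass_ge0 H a b h : (forall z, 0 <= H z) -> 0 <= mass H a b h.
Proof. by move=> H0; apply: Rintegral_ge0 => z _; exact: H0. Qed.

Lemma mass_le H a b h a' b' h' : L1loc H -> (forall z, 0 <= H z) ->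
  a' <= a -> b <= b' -> h <= h' -> mass H a b h <= mass H a' b' h'.
Proof.
move=> LH H0 aa bb hh; have [mH iH] := LH.
have int u v w : (\int[mu2]_(z in rect u v w) (H z)%:E)%E \is a fin_num.
  by apply: integrable_fin_num; [exact: rect_measurable|exact/iH/rect_compact].
apply: fine_le; [exact: int|exact: int|].
apply: ge0_subset_integral; [exact: rect_measurable|exact: rect_measurable|..].
- by apply/measurable_EFinP; exact: measurable_funTS.
- by move=> z _; rewrite lee_fin.
- move=> z /rectP[/andP[za zb] /andP[z0 zh]]; apply/rectP; split; apply/andP; split.
  + exact: le_trans za.
  + exact: le_trans bb.
  + by [].
  + exact: le_trans hh.
Qed.

Lemma L1loc_normD (g1 g2 : plane -> R) : L1loc g1 -> L1loc g2 ->
  L1loc (fun z => `|g1 z| + `|g2 z|).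
Proof.
move=> [m1 i1] [m2 i2]; split.
  by apply: measurable_funD; apply: measurableT_comp.
move=> K cK.
have mK := plane_compact_measurable cK.
have := integrableD mK (integrable_abse (i1 K cK)) (integrable_abse (i2 K cK)).
by congr (_.-integrable _ _); apply/funext => z.
Qed.

Lemma norm_integral_le_mass (H f : plane -> R) C a b h A :
  L1loc H -> (forall z, 0 <= H z) -> 0 <= C -> L1loc f -> vanishes_off A f ->
  (forall z, ~ rect a b h z -> f z = 0) ->
  (forall z, rect a b h z -> `|f z| <= C * H z) ->
  `|\int[mu2]_z f z| <= C * mass H a b h.
Proof.
move=> LH H0 C0 Lf f0 fr fC.
have -> : \int[mu2]_z f z = \int[mu2]_(z in rect a b h) f z.
  rewrite [RHS]Rintegral_mkcond; apply: eq_Rintegral => z _; rewrite patchE.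
  by case: ifPn => //; rewrite notin_setE => /fr.
have mr := rect_measurable a b h.
have fi : mu2.-integrable (rect a b h) (EFin \o f) by exact/Lf.2/rect_compact.
have Hi : mu2.-integrable (rect a b h) (EFin \o H) by exact/LH.2/rect_compact.
have CHi : mu2.-integrable (rect a b h) (EFin \o (fun z => C * H z)).
  have := integrableZl mr C Hi.
  by congr (_.-integrable _ _); apply/funext => z.
apply: (le_trans (le_normr_Rintegral mr fi)).
rewrite /mass -RintegralZl//; apply: le_Rintegral => //.
by have := integrable_abse fi; congr (_.-integrable _ _); apply/funext => z.
Qed.

Variables (F g20 g11 : plane -> R).
Hypothesis cF : continuous F.
Hypothesis w20 : is_weak_partial (2, 0)%N F g20.
Hypothesis w11 : is_weak_partial (1, 1)%N F g11.

Let H : plane -> R := fun z => `|g20 z| + `|g11 z|.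

Lemma H_ge0 z : 0 <= H z. Proof. exact: addr_ge0. Qed.

Lemma H_L1loc : L1loc H.
Proof. by apply: L1loc_normD; [have [] := w20|have [] := w11]. Qed.

Section Mollifier.
Variables (st : nat -> R -> R) (K m : R).
Hypothesis dst : derivatives st.
Hypothesis st_le0 : forall x, x <= 0 -> [/\ st 0%N x = 0, st 1%N x = 0 & st 2%N x = 0].
Hypothesis st_ge1 : forall x, 1 <= x -> [/\ st 0%N x = x - m, st 1%N x = 1 & st 2%N x = 0].
Hypothesis st_bound : forall x, 0 <= st 1%N x <= 1 /\ 0 <= st 2%N x <= K.
Hypothesis st0_bound : forall x, 0 <= x -> 0 <= st 0%N x <= x.

(** Scaled so that [ramp x e 1] goes from 0 to 1 on [[x, x + e]]; [ramp x e 0] is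
    its antiderivative. *)
Definition ramp (x e : R) (n : nat) (t : R) : R :=
  e * (e^-1 ^+ n * st n (e^-1 * t + - (e^-1 * x))).

Lemma rampE x e n t : ramp x e n t = e * (e^-1 ^+ n * st n ((t - x) / e)).
Proof. by rewrite /ramp; congr (_ * (_ * st n _)); ring. Qed.

Lemma derivatives_ramp x e : derivatives (ramp x e).
Proof. exact/derivativesZ/derivatives_affine. Qed.

Lemma ramp_le x e n t : 0 < e -> (n < 3)%N -> t <= x -> ramp x e n t = 0.
Proof.
move=> e0 n3 tx; rewrite rampE.
have [] := @st_le0 ((t - x) / e); first by rewrite pmulr_lle0 ?invr_gt0// subr_le0.
by case: n n3 => [|[|[|//]]] _ h0 h1 h2; rewrite ?h0 ?h1 ?h2 !mulr0.
Qed.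

Lemma ramp_ge x e t : 0 < e -> x + e <= t ->
  [/\ ramp x e 0 t = t - x - m * e, ramp x e 1 t = 1 & ramp x e 2 t = 0].
Proof.
move=> e0 xt; have e_neq0 : e != 0 by rewrite gt_eqF.
rewrite !rampE; have [] := @st_ge1 ((t - x) / e).
  by rewrite ler_pdivlMr// mul1r lerBrDl.
by move=> -> -> ->; split; rewrite ?mulr0 //; field.
Qed.

Lemma ramp1_bound x e t : 0 < e -> 0 <= ramp x e 1 t <= 1.
Proof.
move=> e0; rewrite rampE expr1 mulrA divff ?gt_eqF// mul1r.
by have [] := st_bound ((t - x) / e).
Qed.

Lemma ramp2_bound x e t : 0 < e -> 0 <= ramp x e 2 t <= K / e.
Proof.
move=> e0; have e_neq0 : e != 0 by rewrite gt_eqF.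
have -> : ramp x e 2 t = st 2%N ((t - x) / e) / e by rewrite rampE; field.
have [_ /andP[h1 h2]] := st_bound ((t - x) / e).
by rewrite divr_ge0 ?(ltW e0)//= ler_pM2r ?invr_gt0.
Qed.

Lemma ramp0_bound x e t : 0 < e -> x <= t -> 0 <= ramp x e 0 t <= t - x.
Proof.
move=> e0 xt; rewrite rampE expr0 mul1r.
have /st0_bound/andP[h1 h2] : 0 <= (t - x) / e by rewrite divr_ge0 ?(ltW e0)// subr_ge0.
rewrite mulr_ge0 ?(ltW e0)//= (le_trans (ler_wpM2l (ltW e0) h2))//.
by rewrite mulrC divfK ?gt_eqF.
Qed.

Lemma ramp_continuous x e n : continuous (ramp x e n).
Proof. exact: (is_derive1_continuous (derivatives_ramp x e n)). Qed.

Lemma integral_ramp2 x e : 0 < e ->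
  (\int[lebesgue_measure]_t (ramp x e 2 t)%:E = 1)%E.
Proof.
move=> e0.
have -> : (\int[lebesgue_measure]_t (ramp x e 2 t)%:E =
    \int[lebesgue_measure]_(t in `[x, (x + e)%R]) (ramp x e 2 t)%:E)%E.
  rewrite [RHS]integral_mkcond; apply: eq_integral => t _; rewrite patchE.
  case: ifPn => //; rewrite notin_setE/= in_itv/= => /negP; rewrite negb_and -!ltNge.
  case/orP => [tx|tx]; first by rewrite ramp_le// ltW.
  by have [_ _ ->] := ramp_ge e0 (ltW tx).
have xe : x < x + e by rewrite ltrDl.
have c1 := @ramp_continuous x e 1.
rewrite (@continuous_FTC2 _ (ramp x e 2) (ramp x e 1)) //.
- have [_ -> _] := ramp_ge e0 (lexx (x + e)).
  by rewrite (ramp_le e0)// sube0.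
- exact/continuous_subspaceT/ramp_continuous.
- split.
  + by move=> t _; have [] := derivatives_ramp x e 1 t.
  + by apply: cvg_at_right_filter; exact: c1.
  + by apply: cvg_at_left_filter; exact: c1.
- by move=> t _; rewrite derive1E; have [_ ->] := derivatives_ramp x e 1 t.
Qed.

(** An approximate identity at [(x, 0)] supported in the closed upper
    half-plane: point values of [F] are limits of integrals against it. *)
Definition bump2 (x e : R) (z : plane) : R := ramp x e 2 z.1 * ramp 0 e 2 z.2.

Lemma bump2_continuous x e : continuous (bump2 x e).
Proof.
move=> z; apply: cvgM.
  by apply: (continuous_comp (f := fst)); [exact: cvg_fst|exact: ramp_continuous].
by apply: (continuous_comp (f := snd)); [exact: cvg_snd|exact: ramp_continuous].
Qed.

Lemma bump2_ge0 x e z : 0 < e -> 0 <= bump2 x e z.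
Proof.
move=> e0; apply: mulr_ge0.
  by have /andP[] := ramp2_bound x z.1 e0.
by have /andP[] := ramp2_bound 0 z.2 e0.
Qed.

Lemma bump2_0 x e z : 0 < e -> ~ rect x (x + e) e z -> bump2 x e z = 0.
Proof.
move=> e0 nz; rewrite /bump2.
have [z1|z1] := leP z.1 x; first by rewrite (ramp_le e0)// mul0r.
have [z2|z2] := leP z.2 0; first by rewrite (@ramp_le 0)// mulr0.
have [z3|z3] := leP (x + e) z.1.
  by have [_ _ ->] := ramp_ge e0 z3; rewrite mul0r.
have [z4|z4] := leP (0 + e) z.2.
  by have [_ _ ->] := ramp_ge e0 z4; rewrite mulr0.
exfalso; apply: nz; apply/rectP; rewrite add0r in z4.
by split; apply/andP; split; exact: ltW.
Qed.

Lemma integral_bump2 x e : 0 < e -> \int[mu2]_z bump2 x e z = 1.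
Proof.
move=> e0.
have mb : measurable_fun [set: mplane] (bump2 x e).
  by apply: plane_continuous_measurable; exact: bump2_continuous.
rewrite /Rintegral fubini_tonelli1/=.
- under eq_integral => s _.
    rewrite /fubini_F/= /bump2/=; under eq_integral => t _ do rewrite EFinM.
    rewrite ge0_integralZl//; last 3 first.
    + by apply/measurable_EFinP; apply: continuous_measurable_fun; exact: ramp_continuous.
    + by move=> t _; rewrite lee_fin; have /andP[] := ramp2_bound 0 t e0.
    + by rewrite lee_fin; have /andP[] := ramp2_bound x s e0.
    rewrite integral_ramp2// mule1; over.
  by rewrite integral_ramp2.
- exact/measurable_EFinP.
- by move=> z; rewrite lee_fin bump2_ge0.
Qed.

Lemma rect_vanishes_off a b h (f : plane -> R) :
  (forall z, ~ rect a b h z -> f z = 0) -> exists A, vanishes_off A f.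
Proof.
move=> f0; have [A _ sA] := sub_box (rect_compact (a := a) (b := b) (h := h)).
by exists A => z nz; apply: f0 => /sA.
Qed.

Lemma integral_F_bump2 x (d : R) : 0 < d ->
  exists2 e0, 0 < e0 & forall e, 0 < e <= e0 ->
    `|\int[mu2]_z (F z * bump2 x e z) - F (x, 0)| <= d.
Proof.
move=> d0.
have /nbhs_ballP[r /= r0 rF] : nbhs (x, 0) [set z | `|F (x, 0) - F z| < d].
  by move/cvgrPdist_lt : (@cF (x, 0)) => /(_ d d0).
exists (r / 2); first by rewrite divr_gt0.
move=> e /andP[e0 er].
have [A vA] := rect_vanishes_off (fun z => @bump2_0 x e z e0).
have ib : mu2.-integrable [set: mplane] (EFin \o bump2 x e).
  by apply: (L1loc_integrable _ vA); exact/L1loc_continuous/bump2_continuous.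
have cFb : continuous (fun z => F z * bump2 x e z).
  by move=> z; apply: cvgM; [exact: cF|exact: bump2_continuous].
have iF : mu2.-integrable [set: mplane] (EFin \o (fun z => F z * bump2 x e z)).
  apply: (@L1loc_integrable _ _ A); first exact/L1loc_continuous.
  exact: vanishes_offMr.
have ibc (c : R) : mu2.-integrable [set: mplane] (EFin \o (fun z => c * bump2 x e z)).
  have := integrableZl measurableT c ib.
  by congr (_.-integrable _ _); apply/funext => z.
have -> : F (x, 0) = \int[mu2]_z (F (x, 0) * bump2 x e z).
  by rewrite RintegralZl// integral_bump2// mulr1.
rewrite -RintegralB//.
have -> : d = \int[mu2]_z (d * bump2 x e z).
  by rewrite RintegralZl// integral_bump2// mulr1.
have iB : mu2.-integrable [set: mplane] (EFin \o (fun z => F z * bump2 x e z - F (x, 0) * bump2 x e z)).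
  have := integrableB measurableT iF (ibc (F (x, 0))).
  by congr (_.-integrable _ _); apply/funext => z.
apply: (le_trans (le_normr_Rintegral measurableT iB)).
apply: le_Rintegral => //.
  by have := integrable_abse iB; congr (_.-integrable _ _); apply/funext => z.
move=> z _; rewrite -mulrBl normrM (ger0_norm (bump2_ge0 _ _ e0)).
have [zr|zr] := pselect (rect x (x + e) e z); last by rewrite bump2_0// !mulr0.
apply: ler_wpM2r; first exact: bump2_ge0.
rewrite distrC; apply/ltW/rF.
have [/andP[z1 z2] /andP[z3 z4]] := (rectP _ _ _ _).1 zr.
split; rewrite /= -ball_normE /ball_/= distrC ger0_norm ?subr_ge0//; lra.
Qed.

Section Tensor.
Implicit Types u v : R -> R.

Lemma partial1_tensor u du v :
  (forall x, is_derive x (1 : R) u (du x)) ->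
  partial1 (fun z => u z.1 * v z.2) = fun z => du z.1 * v z.2.
Proof.
move=> uE; apply/funext => z.
have [_ E] := is_deriveM (is_derive_fst (uE z.1)) (is_derive_snd0 v z).
by apply: (etrans E); rewrite /GRing.scale/= mulr0 add0r mulrC.
Qed.

Lemma partial2_tensor u v dv :
  (forall x, is_derive x (1 : R) v (dv x)) ->
  partial2 (fun z => u z.1 * v z.2) = fun z => u z.1 * dv z.2.
Proof.
move=> vE; apply/funext => z.
have [_ E] := is_deriveM (is_derive_fst0 u z) (is_derive_snd (vE z.2)).
by apply: (etrans E); rewrite /GRing.scale/= mulr0 addr0.
Qed.

Lemma derivatives_shift k (d : nat -> R -> R) : derivatives d ->
  derivatives (fun n => d (n + k)%N).
Proof. by move=> dd n x; exact: dd. Qed.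

Lemma smooth_tensor (d e : nat -> R -> R) k l : derivatives d -> derivatives e ->
  smooth (fun z => d k z.1 * e l z.2).
Proof.
move=> dd de; apply: (@smoothM _ (fun z => d k z.1) (fun z => e l z.2)).
  exact: (smooth_fst (derivatives_shift k dd)).
exact: (smooth_snd (derivatives_shift l de)).
Qed.

End Tensor.

Section Pairing.
Variables (a c b e : R).
Hypotheses (ac : a < c) (cb : c < b) (e0 : 0 < e) (eb : e <= b - a).

Let s := b - a.
Let ca := - ((b - c) / (b - a)).
Let cb' := - ((c - a) / (b - a)).

Let s0 : 0 < s. Proof. by rewrite subr_gt0 (lt_trans ac). Qed.

Let ca_bound : -1 <= ca <= 0.
Proof.
rewrite /ca lerN2 oppr_le0 divr_ge0 ?subr_ge0 ?(ltW cb) ?(ltW (lt_trans ac cb))// andbT.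
rewrite ler_pdivrMr// mul1r; have := (ac, cb); case; lra.
Qed.

Let cb_bound : -1 <= cb' <= 0.
Proof.
rewrite /cb' lerN2 oppr_le0 divr_ge0 ?subr_ge0 ?(ltW ac) ?(ltW (lt_trans ac cb))// andbT.
rewrite ler_pdivrMr// mul1r; have := (ac, cb); case; lra.
Qed.

(** With [n = 2] this is a mollification of the functional
    [delta_c - (b - c) / (b - a) * delta_a - (c - a) / (b - a) * delta_b].
    This functional kills affine functions, so that its first two antiderivatives
    [tau 1] and [tau 0] still vanish outside of [[a, b + e]]. *)
Let tau n t : R := ca * ramp a e n t + ramp c e n t + cb' * ramp b e n t.

Let dtau : derivatives tau.
Proof.
apply: derivativesD; first apply: derivativesD.
- exact/derivativesZ/derivatives_ramp.
- exact: derivatives_ramp.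
- exact/derivativesZ/derivatives_ramp.
Qed.

Let tau_le n t : (n < 3)%N -> t <= a -> tau n t = 0.
Proof.
move=> n3 ta; rewrite /tau !ramp_le ?mulr0 ?addr0//.
- by rewrite (le_trans ta)// ltW// (lt_trans ac).
- by rewrite (le_trans ta)// ltW.
Qed.

Let coefs : [/\ ca + 1 + cb' = 0 & ca * a + c + cb' * b = 0].
Proof.
have sn : b - a != 0 by rewrite gt_eqF// -/s.
by rewrite /ca /cb'; split; field.
Qed.

Let tau_ge n t : (n < 3)%N -> b + e <= t -> tau n t = 0.
Proof.
move=> n3 bt; rewrite /tau.
have [a0 a1 a2] : [/\ ramp a e 0 t = t - a - m * e, ramp a e 1 t = 1 & ramp a e 2 t = 0].
  by apply: ramp_ge => //; have := lt_trans ac cb; lra.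
have [c0 c1 c2] : [/\ ramp c e 0 t = t - c - m * e, ramp c e 1 t = 1 & ramp c e 2 t = 0].
  by apply: ramp_ge => //; have := cb; lra.
have [b0 b1 b2] := ramp_ge e0 bt.
have [k1 k2] := coefs.
case: n n3 => [|[|[|//]]] _.
- rewrite a0 b0 c0.
  have -> : ca * (t - a - m * e) + (t - c - m * e) + cb' * (t - b - m * e) =
    (ca + 1 + cb') * (t - m * e) - (ca * a + c + cb' * b) by ring.
  by rewrite k1 k2 mul0r subr0.
- by rewrite a1 b1 c1 !mulr1.
- by rewrite a2 b2 c2 !mulr0 !addr0.
Qed.

Let tau1_bound t : `|tau 1 t| <= 2.
Proof.
have /andP[a0 a1] := ramp1_bound a t e0.
have /andP[b0 b1] := ramp1_bound b t e0.
have /andP[c0 c1] := ramp1_bound c t e0.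
have /andP[? ?] := ca_bound; have /andP[? ?] := cb_bound.
by rewrite /tau ler_norml; apply/andP; split; nra.
Qed.

Let tau0_bound t : a <= t <= b + e -> `|tau 0 t| <= 4 * s.
Proof.
move=> /andP[ta tb].
have bnd x : a <= x -> 0 <= ramp x e 0 t <= 2 * s.
  move=> ax; have [xt|xt] := leP x t; last first.
    by rewrite (ramp_le (n := 0) e0 _ (ltW xt))// lexx mulr_ge0// ltW.
  have /andP[-> h] := ramp0_bound e0 xt; rewrite (le_trans h)//.
  by have := eb; rewrite /s; lra.
have /andP[a0 a1] := bnd a (lexx _).
have /andP[c0 c1] := bnd c (ltW ac).
have /andP[b0 b1] := bnd b (ltW (lt_trans ac cb)).
have /andP[? ?] := ca_bound; have /andP[? ?] := cb_bound.
by rewrite /tau ler_norml; apply/andP; split; nra.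
Qed.

(** [W 2] is the difference of the approximate identities of heights [e] and
    [s], and [W 1] is its compactly supported antiderivative. *)
Let W n t : R := ramp 0 e n t - ramp 0 s n t.

Let dW : derivatives W.
Proof. by move=> n x; apply: is_deriveB; exact: derivatives_ramp. Qed.

Let W1_bound t : `|W 1 t| <= 1.
Proof.
have /andP[? ?] := ramp1_bound 0 t e0; have /andP[? ?] := ramp1_bound 0 t s0.
by rewrite /W ler_norml; apply/andP; split; lra.
Qed.

Let W1_0 t : ~ (0 <= t <= s) -> W 1 t = 0.
Proof.
move=> nt; rewrite /W; have [t0|t0] := leP t 0.
  by rewrite !ramp_le// subrr.
have [ts|ts] := leP s t; last by exfalso; apply: nt; rewrite !ltW.
have [_ -> _] : [/\ ramp 0 e 0 t = t - 0 - m * e, ramp 0 e 1 t = 1 & ramp 0 e 2 t = 0].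
  by apply: ramp_ge => //; rewrite add0r (le_trans eb).
have [_ -> _] : [/\ ramp 0 s 0 t = t - 0 - m * s, ramp 0 s 1 t = 1 & ramp 0 s 2 t = 0].
  by apply: ramp_ge => //; rewrite add0r.
by rewrite subrr.
Qed.

Let ramp2_0 t : ~ (0 <= t <= s) -> ramp 0 s 2 t = 0.
Proof.
move=> nt; have [t0|t0] := leP t 0; first by rewrite !ramp_le.
have [ts|ts] := leP s t; last by exfalso; apply: nt; rewrite !ltW.
have [_ _ -> //] : [/\ ramp 0 s 0 t = t - 0 - m * s, ramp 0 s 1 t = 1 & ramp 0 s 2 t = 0].
by apply: ramp_ge => //; rewrite add0r.
Qed.

Let tau_off n t : (n < 3)%N -> ~ (a <= t <= b + e) -> tau n t = 0.
Proof.
move=> n3 nt; have [ta|ta] := leP t a; first exact: tau_le.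
have [tb|tb] := leP (b + e) t; first exact: tau_ge.
by exfalso; apply: nt; rewrite !ltW.
Qed.

Let phi1 (z : plane) : R := tau 0 z.1 * ramp 0 s 2 z.2.
Let phi2 (z : plane) : R := tau 1 z.1 * W 1 z.2.

Let phi1_off z : ~ rect a (b + e) s z -> phi1 z = 0.
Proof.
move=> nz; rewrite /phi1.
have [h1|h1] := pselect (a <= z.1 <= b + e); last by rewrite tau_off ?mul0r.
have [h2|h2] := pselect (0 <= z.2 <= s); last by rewrite ramp2_0 ?mulr0.
by exfalso; apply: nz; exact/rectP.
Qed.

Let phi2_off z : ~ rect a (b + e) s z -> phi2 z = 0.
Proof.
move=> nz; rewrite /phi2.
have [h1|h1] := pselect (a <= z.1 <= b + e); last by rewrite tau_off ?mul0r.
have [h2|h2] := pselect (0 <= z.2 <= s); last by rewrite W1_0 ?mulr0.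
by exfalso; apply: nz; exact/rectP.
Qed.

Let smooth1 : smooth phi1.
Proof. exact: (smooth_tensor _ _ dtau (@derivatives_ramp 0 s)). Qed.

Let smooth2 : smooth phi2.
Proof. exact: (smooth_tensor _ _ dtau dW). Qed.

Let dphi1 : partial (2, 0)%N phi1 = fun z => tau 2 z.1 * ramp 0 s 2 z.2.
Proof.
rewrite /partial/= /phi1 (partial1_tensor _ (dtau 0%N)).
by rewrite (partial1_tensor _ (dtau 1%N)).
Qed.

Let dphi2 : partial (1, 1)%N phi2 = fun z => tau 2 z.1 * W 2 z.2.
Proof.
rewrite /partial/= /phi2 (partial2_tensor _ (dW 1%N)).
by rewrite (partial1_tensor _ (dtau 1%N)).
Qed.

Let pairing (phi g : plane -> R) alpha : smooth phi ->
  (forall z, ~ rect a (b + e) s z -> phi z = 0) ->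
  is_weak_partial alpha F g -> ~~ odd (alpha.1 + alpha.2) ->
  \int[mu2]_z (F z * partial alpha phi z) = \int[mu2]_z (g z * phi z).
Proof.
move=> sphi phi0 [_ _ wg] ev; have [A vA] := rect_vanishes_off phi0.
rewrite wg; first by rewrite -signr_odd (negbTE ev) mul1r.
exact: (box_test_function (A := A)).
Qed.

Let pairing_mass (phi g : plane -> R) C : smooth phi -> 0 <= C ->
  (forall z, ~ rect a (b + e) s z -> phi z = 0) ->
  (forall z, rect a (b + e) s z -> `|phi z| <= C) ->
  L1loc g -> (forall z, `|g z| <= H z) ->
  `|\int[mu2]_z (g z * phi z)| <= C * mass H a (b + e) s.
Proof.
move=> sphi C0 phi0 phiC lg gH; have [A vA] := rect_vanishes_off phi0.
apply: (@norm_integral_le_mass _ _ _ _ _ _ A) => //.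
- exact: H_L1loc.
- exact: H_ge0.
- by apply: L1locM => //; exact: smooth_continuous.
- exact: vanishes_offMr.
- by move=> z nz; rewrite phi0 ?mulr0.
- by move=> z rz; rewrite normrM mulrC ler_pM// phiC.
Qed.

Let integrable_F (f : plane -> R) : continuous f ->
  (forall z, ~ rect a (b + e) s z -> f z = 0) ->
  mu2.-integrable [set: mplane] (EFin \o (fun z => F z * f z)).
Proof.
move=> cf f0; have [A vA] := rect_vanishes_off f0.
apply: (@L1loc_integrable _ _ A); last exact: vanishes_offMr.
by apply: L1loc_continuous => z; apply: cvgM; [exact: cF|exact: cf].
Qed.

(** The functional [tau 2] at height [e] is moved up to height [s]. The transport is
    the [y]-derivative of [tau 2 x * W 1 y], which costs one mixed derivative of [F]
    against the bounded function [tau 1 x * W 1 y]; at height [s] two integrations by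
    parts in [x] leave [F_xx] against [tau 0 x * ramp 0 s 2 y], where [tau 0] is of
    size [s] and the bump of size [1 / s]. *)
Lemma mollified_three_point :
  `|ca * \int[mu2]_z (F z * bump2 a e z) + \int[mu2]_z (F z * bump2 c e z) +
   cb' * \int[mu2]_z (F z * bump2 b e z)| <= (4 * K + 2) * mass H a (b + e) s.
Proof.
have K0 : 0 <= K by have [_ /andP[h1 /(le_trans h1)]] := st_bound 0.
have es : e <= s by [].
have sub x z : a <= x <= b -> rect x (x + e) e z -> rect a (b + e) s z.
  move=> /andP[ax xb] /rectP[/andP[z1 z2] /andP[z3 z4]].
  by apply/rectP; split; apply/andP; split; lra.
have b0 x z : a <= x <= b -> ~ rect a (b + e) s z -> bump2 x e z = 0.
  by move=> xab nz; apply: bump2_0 => // /(sub _ _ xab).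
have ia : a <= a <= b by rewrite lexx/= ltW// (lt_trans ac).
have ib : a <= b <= b by rewrite lexx andbT ltW// (lt_trans ac).
have ic : a <= c <= b by rewrite !ltW.
have ibump x : a <= x <= b -> mu2.-integrable [set: mplane] (EFin \o (fun z => F z * bump2 x e z)).
  by move=> xab; apply: integrable_F; [exact: bump2_continuous|move=> z; exact: b0].
have ibumpZ k x : a <= x <= b ->
    mu2.-integrable [set: mplane] (EFin \o (fun z => k * (F z * bump2 x e z))).
  move=> /ibump i0; have := integrableZl measurableT k i0.
  by congr (_.-integrable _ _); apply/funext => z.
have intZ k x : a <= x <= b -> k * \int[mu2]_z (F z * bump2 x e z) =
    \int[mu2]_z (k * (F z * bump2 x e z)).
  by move=> xab; rewrite RintegralZl//; exact: ibump.
rewrite (intZ ca a ia) (intZ cb' b ib).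
rewrite -RintegralD//; try exact: ibump; try exact: ibumpZ.
rewrite -RintegralD//; try exact: ibumpZ; last first.
  have := integrableD measurableT (ibumpZ ca _ ia) (ibump _ ic).
  by congr (_.-integrable _ _); apply/funext => z.
have i1 : mu2.-integrable [set: mplane] (EFin \o (fun z => F z * partial (2, 0)%N phi1 z)).
  apply: integrable_F.
    apply: smooth_continuous; rewrite dphi1.
    exact: (smooth_tensor _ _ dtau (@derivatives_ramp 0 s)).
  move=> z nz; rewrite dphi1.
  have [h1|h1] := pselect (a <= z.1 <= b + e); last by rewrite tau_off ?mul0r.
  have [h2|h2] := pselect (0 <= z.2 <= s); last by rewrite ramp2_0 ?mulr0.
  by exfalso; apply: nz; exact/rectP.
have i2 : mu2.-integrable [set: mplane] (EFin \o (fun z => F z * partial (1, 1)%N phi2 z)).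
  apply: integrable_F.
    by apply: smooth_continuous; rewrite dphi2; exact: (smooth_tensor _ _ dtau dW).
  move=> z nz; rewrite dphi2.
  have [h1|h1] := pselect (a <= z.1 <= b + e); last by rewrite tau_off ?mul0r.
  have [h2|h2] := pselect (0 <= z.2 <= s).
    by exfalso; apply: nz; exact/rectP.
  have -> : W 2 z.2 = 0; last by rewrite mulr0.
  have [t0|t0] := leP z.2 0; first by rewrite /W !ramp_le// subrr.
  have [ts|ts] := leP s z.2; last by exfalso; apply: h2; rewrite !ltW.
  rewrite /W ramp2_0// subr0.
  have [_ _ -> //] : [/\ ramp 0 e 0 z.2 = z.2 - 0 - m * e, ramp 0 e 1 z.2 = 1 & ramp 0 e 2 z.2 = 0].
  by apply: ramp_ge => //; rewrite add0r (le_trans eb).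
rewrite (_ : \int[mu2]_z _ = \int[mu2]_z (g20 z * phi1 z) + \int[mu2]_z (g11 z * phi2 z)).
  rewrite (le_trans (ler_normD _ _))// [leRHS]mulrDl; apply: lerD.
    apply: pairing_mass => //; first by rewrite mulr_ge0.
    - move=> z /rectP[z1 z2]; rewrite /phi1 normrM.
      have /andP[h1 h2] := ramp2_bound 0 z.2 s0.
      rewrite (ger0_norm h1) (_ : 4 * K = (4 * s) * (K / s)); last first.
        by field; rewrite gt_eqF.
      by apply: ler_pM => //; exact: tau0_bound.
    - by have [] := w20.
    - by move=> z; rewrite /H lerDl.
  apply: pairing_mass => //.
  - move=> z /rectP[z1 z2]; rewrite /phi2 normrM -[leRHS]mulr1.
    by apply: ler_pM.
  - by have [] := w11.
  - by move=> z; rewrite /H lerDr.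
rewrite -(pairing smooth1 phi1_off w20)// -(pairing smooth2 phi2_off w11)//.
transitivity (\int[mu2]_z (F z * partial (2, 0)%N phi1 z +
    F z * partial (1, 1)%N phi2 z)); last by rewrite (RintegralD measurableT i1 i2).
apply: eq_Rintegral => z _.
by rewrite dphi1 dphi2 /bump2 /W /tau; ring.
Qed.

End Pairing.

Lemma three_point_aux a c b eta : a < c -> c < b -> 0 < eta ->
  `|F (c, 0) - ((b - c) / (b - a) * F (a, 0) + (c - a) / (b - a) * F (b, 0))|
  <= (4 * K + 2) * mass H a (b + eta) (b - a).
Proof.
move=> ac cb eta0; apply/ler_addgt0Pr => d d0.
have d30 : 0 < d / 3 by rewrite divr_gt0.
have [ea ea0 Ha] := integral_F_bump2 a d30.
have [ec ec0 Hc] := integral_F_bump2 c d30.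
have [eb eb0 Hb] := integral_F_bump2 b d30.
have s0 : 0 < b - a by rewrite subr_gt0 (lt_trans ac).
pose e := Num.min eta (Num.min (b - a) (Num.min ea (Num.min ec eb))).
have e0 : 0 < e by rewrite !lt_min eta0 s0 ea0 ec0 eb0.
have : e <= e by []. rewrite {2}/e !le_min => /andP[e1 /andP[e2 /andP[e3 /andP[e4 e5]]]].
have := mollified_three_point ac cb e0 e2.
have := Ha e; rewrite e0 e3 => /(_ isT).
have := Hc e; rewrite e0 e4 => /(_ isT).
have := Hb e; rewrite e0 e5 => /(_ isT).
set Ia := \int[mu2]_z _; set Ic := \int[mu2]_z _; set Ib := \int[mu2]_z _.
have K0 : 0 <= K by have [_ /andP[h1 /(le_trans h1)]] := st_bound 0.
have : mass H a (b + e) (b - a) <= mass H a (b + eta) (b - a).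
  by apply: mass_le => //; [exact: H_L1loc|exact: H_ge0|rewrite lerD2l].
move=> /(ler_wpM2l (_ : 0 <= 4 * K + 2)); rewrite addr_ge0 ?mulr_ge0// => /(_ isT).
have al : 0 <= (b - c) / (b - a) <= 1.
  rewrite divr_ge0 ?subr_ge0 ?(ltW cb) ?(ltW (lt_trans ac cb))//=.
  by rewrite ler_pdivrMr// mul1r; lra.
have be : 0 <= (c - a) / (b - a) <= 1.
  rewrite divr_ge0 ?subr_ge0 ?(ltW ac) ?(ltW (lt_trans ac cb))//=.
  by rewrite ler_pdivrMr// mul1r; lra.
move: al be; set al := _ / _; set be := _ / _ => /andP[al0 al1] /andP[be0 be1].
set X := _ * mass _ _ _ _; set Y := _ * mass _ _ _ _.
move=> XY dB dC dA.
have sc (k u : R) : 0 <= k -> k <= 1 -> `|u| <= d / 3 -> `|k * u| <= d / 3.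
  move=> k0 k1 ud; rewrite normrM ger0_norm//; apply: le_trans ud.
  by rewrite ler_piMl.
have := sc al _ al0 al1 dA; have := sc be _ be0 be1 dB.
move: dC; rewrite !ler_norml => /andP[? ?] /andP[? ?] /andP[? ?] /andP[? ?].
by apply/andP; split; lra.
Qed.

End Mollifier.

End ThreePoint.

(** The limit of [mollified_three_point] when the mollification shrinks. The
    slack [eta] leaves room for the support of the last bump. *)
Lemma three_point (R : realType) : exists2 C0 : R, 0 < C0 &
  forall F g20 g11 : R * R -> R, continuous F ->
  is_weak_partial (2, 0)%N F g20 -> is_weak_partial (1, 1)%N F g11 ->
  forall a c b eta, a < c -> c < b -> 0 < eta ->
  `|F (c, 0) - ((b - c) / (b - a) * F (a, 0) + (c - a) / (b - a) * F (b, 0))|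
  <= C0 * mass (fun z => `|g20 z| + `|g11 z|) a (b + eta) (b - a).
Proof.
have [st [K [m [dst h1 h2 h3 h4]]]] := @smooth_step_exists R.
exists (4 * K + 2).
  have K0 : 0 <= K by have [_ /andP[k1 /(le_trans k1)]] := h3 0.
  by rewrite ltr_wpDl// mulr_ge0.
move=> F g20 g11 cF w20 w11 a c b eta.
exact: (three_point_aux cF w20 w11 dst h1 h2 h3 h4).
Qed.

(** * Inequalities for real powers *)

Section RealPowers.
Context {R : realType}.
Implicit Types p q t u v x : R.

(** The graph of the power lies above its tangents; this is Young's inequality
    for the exponents [p] and [p / (p - 1)]. *)
Lemma powR_tangent p u t : 1 < p -> 0 <= u -> 0 <= t ->
  t `^ p + p * t `^ (p - 1) * (u - t) <= u `^ p.
Proof.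
move=> p1 u0 t0; have p0 : 0 < p by rewrite (lt_trans _ p1).
have p10 : 0 < p - 1 by rewrite subr_gt0.
have := @conjugate_powR R u (t `^ (p - 1)) p (p / (p - 1)) u0 (powR_ge0 _ _) p0.
rewrite divr_gt0// => /(_ isT).
have -> : p^-1 + (p / (p - 1))^-1 = 1 by field; rewrite ?gt_eqF.
move=> /(_ erefl); rewrite -powRrM.
have -> : (p - 1) * (p / (p - 1)) = p by field; rewrite gt_eqF.
have tp : t * t `^ (p - 1) = t `^ p by exact: mulr_powRB1.
rewrite -(ler_pM2l p0) mulrDr.
have -> : p * (u `^ p / p) = u `^ p by field; rewrite gt_eqF.
have -> : p * (t `^ p / (p / (p - 1))) = (p - 1) * t `^ p by field; rewrite ?gt_eqF.
move=> h; rewrite -tp in h *.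
by move: h; set T := t `^ (p - 1); lra.
Qed.

(** Convexity at the point [(1 - l) * (u / (1 - l)) + l * (v / l)]. For small [l]
    the factor of the first term is close to [1], which allows to absorb it. *)
Lemma powR_split p l u v : 1 < p -> 0 < l < 1 -> 0 <= u -> 0 <= v ->
  (u + v) `^ p <= (1 - l) `^ (1 - p) * u `^ p + l `^ (1 - p) * v `^ p.
Proof.
move=> p1 /andP[l0 l1] u0 v0; have l10 : 0 < 1 - l by rewrite subr_gt0.
have p0 : 0 < p by rewrite (lt_trans _ p1).
have t0 : 0 <= u + v by exact: addr_ge0.
have scale (c w : R) : 0 < c -> 0 <= w -> c `^ (1 - p) * w `^ p = c * (w / c) `^ p.
  move=> c0 w0; rewrite powRM// ?invr_ge0 ?ltW// mulrCA mulrC; congr (_ * _).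
  rewrite -[in RHS]powR_inv1 ?ltW// -powRrM mulN1r powRB; last by rewrite (gt_eqF c0) implybT.
  by rewrite powRr1 ?ltW// powRN.
rewrite !scale//.
have h1 := powR_tangent p1 (divr_ge0 u0 (ltW l10)) t0.
have h2 := powR_tangent p1 (divr_ge0 v0 (ltW l0)) t0.
apply: (le_trans _ (lerD (ler_wpM2l (ltW l10) h1) (ler_wpM2l (ltW l0) h2))).
set T := (u + v) `^ (p - 1); set S := (u + v) `^ p.
rewrite [leRHS](_ : _ = S + p * T * (((1 - l) * (u / (1 - l)) + l * (v / l)) - (u + v))); last by ring.
have -> : (1 - l) * (u / (1 - l)) = u by field; rewrite gt_eqF.
have -> : l * (v / l) = v by field; rewrite gt_eqF.
by rewrite subrr mulr0 addr0.
Qed.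

Lemma ler_powR_norm p u v : 0 <= p -> 0 <= u -> u <= v -> u `^ p <= v `^ p.
Proof.
by move=> p0 u0 uv; apply: ge0_ler_powR; rewrite ?nnegrE// (le_trans u0).
Qed.

(** Each of the at most [N] nonzero terms is at most the largest one. *)
Lemma powR_sum_le (T : finType) (v : T -> R) (N : nat) p : 0 < p ->
  (#|[set j | v j != 0%R]%SET| <= N)%N ->
  `|\sum_j v j| `^ p <= N%:R `^ p * \sum_j `|v j| `^ p.
Proof.
move=> p0 cN; set S := [set j | v j != 0%R]%SET in cN.
have sumS : \sum_j v j = \sum_(j in S) v j.
  rewrite big_mkcond [in RHS]big_mkcond; apply: eq_bigr => j _ /=.
  by rewrite inE; case: eqP => // ->.
have rhs0 : 0 <= N%:R `^ p * \sum_j `|v j| `^ p.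
  by rewrite mulr_ge0 ?powR_ge0// sumr_ge0// => j _; exact: powR_ge0.
have [S0|[i0 i0S]] := set_0Vmem S.
  by rewrite sumS S0 big_set0 normr0 powR0// gt_eqF.
have [i iS imax] : exists2 i, i \in S & forall j, j \in S -> `|v j| <= `|v i|.
  by case: (Order.TotalTheory.arg_maxP (fun j => `|v j|) i0S) => i iS im; exists i.
apply: (@le_trans _ _ ((N%:R * `|v i|) `^ p)).
  apply: ler_powR_norm; [exact: ltW|by []|].
  rewrite sumS (le_trans (ler_norm_sum _ _ _))//.
  apply: (@le_trans _ _ (\sum_(j in S) `|v i|)); first exact: ler_sum.
  by rewrite sumr_const -[leLHS]mulr_natl ler_wpM2r// ler_nat.
rewrite powRM// ler_wpM2l ?powR_ge0// (bigD1 i)//= lerDl.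
by apply: sumr_ge0 => j _; exact: powR_ge0.
Qed.

Lemma powRD_le p u v : 0 < p -> 0 <= u -> 0 <= v ->
  (u + v) `^ p <= 2 `^ p * (u `^ p + v `^ p).
Proof.
move=> p0 u0 v0.
have := @powR_sum_le 'I_2 (fun j : 'I_2 => if j == 0 :> nat then u else v) 2 p p0.
rewrite !big_ord_recl !big_ord0/= !addr0 !ger0_norm ?addr_ge0//; apply.
by rewrite (leq_trans (max_card _))// card_ord.
Qed.

Lemma geometric_sum_le (q : R) n : 0 <= q -> q < 1 ->
  \sum_(k < n) q ^+ k <= (1 - q)^-1.
Proof.
move=> q0 q1; have q10 : 0 < 1 - q by rewrite subr_gt0.
have := subrX1 q n; rewrite -[X in _ = X * _ -> _]opprB mulNr.
move/(congr1 -%R); rewrite opprB opprK => E.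
by rewrite -(ler_pM2l q10) -E mulfV ?gt_eqF// gerBl exprn_ge0.
Qed.

(** A geometric sequence, switched on at the scales satisfying [c], is summed
    from the first such scale. *)
Lemma sum_from_first (q B : R) (c : nat -> bool) (r : nat -> R) n :
  0 <= q -> q < 1 -> 0 <= B ->
  (forall k, r k.+1 = q * r k) -> (forall k, 0 <= r k) ->
  (forall k, c k -> r k <= B) ->
  \sum_(k < n) (if c k then r k else 0) <= B / (1 - q).
Proof.
move=> q0 q1 B0; have q10 : 0 < 1 - q by rewrite subr_gt0.
elim: n c r => [|n IH] c r rS r0 rB; first by rewrite big_ord0 divr_ge0// ltW.
case c0 : (c 0%N); last first.
  rewrite big_ord_recl /= c0 add0r.
  by apply: (IH (fun k => c k.+1) (fun k => r k.+1)) => // k; [exact: rB].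
have rE k : r k = q ^+ k * r 0%N.
  by elim: k => [|k IHk]; rewrite ?expr0 ?mul1r// rS IHk exprS mulrA.
apply: (@le_trans _ _ (\sum_(k < n.+1) q ^+ k * r 0%N)).
  apply: ler_sum => k _; case: ifP => _; first by rewrite -rE.
  by rewrite mulr_ge0// exprn_ge0.
rewrite -mulr_suml mulrC; apply: ler_pM => //; last exact: geometric_sum_le.
- by apply: sumr_ge0 => k _; exact: exprn_ge0.
- exact: rB.
Qed.

(** Up to [V], the term [U k] is at most half of [U k.+1], whereas
    [w k = 2 `^ (2 * p - 2) * w k.+1]; hence [w k * U k `^ p] is at most
    [2 `^ (p - 2)] times [w k.+1 * U k.+1 `^ p], a factor less than one because
    [p < 2]. The loss in [powR_split] is kept so small that the sum is absorbed. *)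
Lemma recursion_sum p : 1 < p < 2 -> exists2 C : R, 0 < C &
  forall (U V : nat -> R) (w : nat -> R) kap,
  (forall k, 0 <= w k) -> (forall k, w k.+1 = 2 `^ (2 - 2 * p) * w k) ->
  (forall k, 0 <= U k) -> (forall k, 0 <= V k) ->
  (forall k, (k < kap)%N -> U k <= U k.+1 / 2 + V k) -> U kap <= V kap ->
  \sum_(k < kap.+1) w k * U k `^ p <= C * \sum_(k < kap.+1) w k * V k `^ p.
Proof.
move=> /andP[p1 p2]; have p0 : 0 < p by rewrite (lt_trans _ p1).
(* [l] is chosen so that [2 `^ (p - 2) * (1 - l) `^ (1 - p) < 1], that is
   [s < 1 - l]. *)
pose s : R := 2 `^ ((p - 2) / (p - 1)).
have s0 : 0 < s by exact: powR_gt0.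
have s1 : s < 1.
  rewrite /s -[p - 2]opprB mulNr powRN invf_lt1 ?powR_gt0//.
  apply: (@le_lt_trans _ _ (1 `^ ((2 - p) / (p - 1)))); first by rewrite powR1.
  by apply: gt0_ltr_powR; rewrite ?divr_gt0 ?subr_gt0 ?nnegrE// ltr1n.
pose l := (1 - s) / 2.
have l01 : 0 < l < 1 by rewrite /l; apply/andP; split; lra.
pose th := 2 `^ (p - 2) * (1 - l) `^ (1 - p).
have th0 : 0 < th by rewrite mulr_gt0 ?powR_gt0// subr_gt0; case/andP: l01.
have th1 : th < 1.
  rewrite /th.
  have -> : 2 `^ (p - 2) = s `^ (p - 1) :> R.
    by rewrite /s -powRrM; congr powR; field; rewrite gt_eqF// subr_gt0.
  have l10 : 0 < 1 - l by rewrite /l; lra.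
  rewrite -[1 - p]opprB powRN ltr_pdivrMr ?powR_gt0// mul1r.
  by apply: gt0_ltr_powR; rewrite ?nnegrE ?subr_gt0// /l; lra.
pose C1 := l `^ (1 - p) + 1.
have C10 : 0 < C1 by rewrite ltr_wpDl ?powR_ge0.
have th10 : 0 < 1 - th by rewrite subr_gt0.
exists (C1 / (1 - th)) => [|U V w kap w0 wS U0 V0 UV Ukap]; first exact: divr_gt0.
set D := fun k => w k * U k `^ p; set E := fun k => w k * V k `^ p.
have D0 k : 0 <= D k by rewrite mulr_ge0 ?powR_ge0.
have E0 k : 0 <= E k by rewrite mulr_ge0 ?powR_ge0.
have step k : (k < kap)%N -> D k <= th * D k.+1 + C1 * E k.
  move=> /UV h; have := @ler_powR_norm p _ _ (ltW p0) (U0 k) h.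
  move=> /le_trans/(_ (powR_split p1 l01 _ (V0 k))).
  rewrite divr_ge0// => /(_ isT) => hk.
  rewrite /D wS; apply: (le_trans (ler_wpM2l (w0 k) hk)).
  rewrite mulrDr; apply: lerD.
    rewrite powRM// ?invr_ge0// -[2^-1]powR_inv1// -powRrM mulN1r /th.
    rewrite [leLHS](_ : _ = (2 `^ (- p) * (1 - l) `^ (1 - p)) * (w k * U k.+1 `^ p)); last by ring.
    rewrite [leRHS](_ : _ = (2 `^ (p - 2) * 2 `^ (2 - 2 * p) * (1 - l) `^ (1 - p)) * (w k * U k.+1 `^ p)); last by ring.
    rewrite -powRD; last by rewrite pnatr_eq0 implybT.
    by rewrite (_ : p - 2 + (2 - 2 * p) = - p)//; ring.
  rewrite [leLHS](_ : _ = l `^ (1 - p) * E k); last by rewrite /E; ring.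
  by rewrite ler_wpM2r// lerDl.
have last_step : D kap <= C1 * E kap.
  apply: (@le_trans _ _ (E kap)); first by apply: ler_wpM2l => //; apply: ler_powR_norm => //; exact: ltW.
  by rewrite ler_peMl// lerDr powR_ge0.
set SD := \sum_(k < kap.+1) D k; set SE := \sum_(k < kap.+1) E k.
have : SD <= th * SD + C1 * SE.
  rewrite {1}/SD big_ord_recr/=.
  apply: (@le_trans _ _ (\sum_(k < kap) (th * D k.+1 + C1 * E k) + C1 * E kap)).
    by apply: lerD => //; apply: ler_sum => k _; exact: step.
  rewrite big_split/= -addrA /SE [X in _ <= _ + C1 * X]big_ord_recr/= mulrDr.
  rewrite [X in _ <= _ + (X + _)]mulr_sumr.
  rewrite lerD2r -mulr_sumr ler_wpM2l ?(ltW th0)//.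
  by rewrite /SD big_ord_recl/= lerDr.
move=> hSD; rewrite [leRHS](_ : _ = C1 * SE / (1 - th)); last by rewrite mulrAC.
by rewrite ler_pdivlMr// mulrBr mulr1 [SD * th]mulrC lerBlDl.
Qed.

End RealPowers.

(** * A Hardy inequality for boxes standing on the line *)

Section Hardy.
Context {R : realType}.
Local Notation plane := (R * R)%type.
Local Notation mplane := (measurableTypeR R * measurableTypeR R)%type.
Local Notation mu2 := (@lebesgue2 R).

Variables (H : plane -> R) (p : R).
Hypothesis LH : L1loc H.
Hypothesis H0 : forall z, 0 <= H z.
Hypothesis p1 : 1 < p.

Section Jensen.
Variables (a b h c : R).
Hypotheses (ab : a < b) (h0 : 0 < h) (c0 : 0 < c).

Let s (z : plane) : R := Num.sqrt (`|z.2| + c).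

Let s_gt0 z : 0 < s z.
Proof. by rewrite sqrtr_gt0 ltr_wpDl. Qed.

Let s_continuous : continuous s.
Proof.
move=> z; apply: (continuous_comp (f := fun z : plane => `|z.2| + c)); last exact: sqrt_continuous.
apply: cvgD; last exact: cvg_cst.
apply: (continuous_comp (f := snd)); [exact: cvg_snd|exact: norm_continuous].
Qed.

Let w (z : plane) : R := (s z)^-1.

Let w_continuous : continuous w.
Proof. by move=> z; apply: cvgV; [rewrite gt_eqF|exact: s_continuous]. Qed.

Let Z := \int[mu2]_(z in rect a b h) w z.

Let Z_le : 0 < Z /\ Z <= (b - a) * (2 * Num.sqrt (h + c)).
Proof.
have hc : Num.sqrt c < Num.sqrt (h + c) by rewrite ltr_sqrt ?ltrDr// addr_gt0.
suff -> : Z = (b - a) * (2 * (Num.sqrt (h + c) - Num.sqrt c)).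
  split; first by rewrite !mulr_gt0 ?subr_gt0.
  by rewrite ler_wpM2l ?subr_ge0 ?(ltW ab)// ler_wpM2l// gerBl sqrtr_ge0.
pose f (y : R) := (Num.sqrt (`|y| + c))^-1.
have f_ge0 y : 0 <= f y by rewrite invr_ge0 sqrtr_ge0.
have cf : continuous f.
  move=> y; apply: cvgV; first by rewrite gt_eqF// sqrtr_gt0 ltr_wpDl.
  apply: (continuous_comp (f := fun y : R => `|y| + c)); last exact: sqrt_continuous.
  by apply: cvgD; [exact: norm_continuous|exact: cvg_cst].
have If : (\int[lebesgue_measure]_(y in `[0%R, h]) (f y)%:E =
    (2 * (Num.sqrt (h + c) - Num.sqrt c))%:E)%E.
  pose G (y : R) := 2 * Num.sqrt (y + c).
  have dG y : - c < y -> is_derive y (1 : R) G (Num.sqrt (y + c))^-1.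
    move=> yc; have yc0 : 0 < y + c by rewrite -ltrBlDr sub0r.
    have h1 := is_derive1_comp (g := fun y => y + c) (is_derive1_sqrt yc0)
      (is_deriveD (is_derive_id y 1) (is_derive_cst c y 1)).
    have h2 : is_derive y (1 : R) (2 *: (Num.sqrt \o (fun y => y + c)))
       (2 *: ((2 * Num.sqrt (y + c))^-1 * (1 + 0))) by apply: is_deriveZ.
    apply: (is_derive_eq h2); rewrite /GRing.scale/= addr0 mulr1.
    by field; rewrite gt_eqF// sqrtr_gt0.
  have cG y : - c < y -> {for y, continuous G}.
    by move=> /dG[dy _]; apply/differentiable_continuous/derivable1_diffP.
  rewrite (@continuous_FTC2 _ f G) //.
  - by rewrite /G add0r -EFinB mulrBr.
  - exact: continuous_subspaceT.
  - split.
    + move=> y; rewrite in_itv/= => /andP[y0 _].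
      by have [] := dG y (lt_trans _ y0); rewrite // oppr_lt0.
    + by apply: cvg_at_right_filter; apply: cG; rewrite oppr_lt0.
    + by apply: cvg_at_left_filter; apply: cG; rewrite (lt_trans _ h0)// oppr_lt0.
  - move=> y; rewrite in_itv/= => /andP[y0 _].
    have [_ E] : is_derive y (1 : R) G (Num.sqrt (y + c))^-1.
      by apply: dG; rewrite (lt_trans _ y0)// oppr_lt0.
    by rewrite derive1E E /f ger0_norm// ltW.
have mI : measurable (`[a, b] : set (measurableTypeR R)) by exact: measurable_itv.
have mJ : measurable (`[0, h] : set (measurableTypeR R)) by exact: measurable_itv.
have mf : measurable_fun [set: measurableTypeR R] f by exact: continuous_measurable_fun.
have m1I (D : set R) : 'measurable D -> measurable_fun [set: measurableTypeR R] (\1_D : R -> R).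
  by move=> mD; exact: measurable_indic.
rewrite /Z /Rintegral integral_mkcond.
have E z : ((fun x => (w x)%:E) \_ (rect a b h)) z =
    ((\1_(`[a, b]) z.1)%:E * ((f z.2) * \1_(`[0, h]) z.2)%:E)%E.
  rewrite patchE -EFinM !indicE; case: ifPn => [/set_mem[h1 h2]|].
    by rewrite !mem_set// mul1r mulr1.
  rewrite notin_setE => nz; case: (boolP (z.1 \in _)) => [/set_mem h1|]; last by rewrite mul0r.
  case: (boolP (z.2 \in _)) => [/set_mem h2|]; last by rewrite mulr0 mulr0.
  by exfalso; apply: nz.
under eq_integral do rewrite E.
rewrite fubini_tonelli1; last 2 first.
- apply: emeasurable_funM; apply/measurable_EFinP.
    by apply: (measurableT_comp (m1I _ mI)); exact: measurable_fst.
  apply: measurable_funM.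
    by apply: (measurableT_comp mf); exact: measurable_snd.
  by apply: (measurableT_comp (m1I _ mJ)); exact: measurable_snd.
- by move=> z; rewrite -EFinM lee_fin !mulr_ge0// indicE.
have inner : (\int[lebesgue_measure]_y (f y * \1_(`[0, h]) y)%:E =
     (2 * (Num.sqrt (h + c) - Num.sqrt c))%:E)%E.
  rewrite -If [RHS]integral_mkcond; apply: eq_integral => y _.
  by rewrite patchE indicE; case: (boolP (y \in _)) => _; rewrite ?mulr1 ?mulr0.
under eq_integral => x _.
  rewrite /fubini_F/= ge0_integralZl//; last 2 first.
  - apply/measurable_EFinP; apply: measurable_funM => //; exact: m1I.
  - by move=> y _; rewrite lee_fin mulr_ge0// indicE.
  rewrite inner; over.
rewrite ge0_integralZr//; last 2 first.
- by apply/measurable_EFinP; exact: m1I.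
- by rewrite lee_fin !mulr_ge0// subr_ge0 ltW.
have -> : (\int[lebesgue_measure]_x (\1_(`[a, b]) x)%:E = (b - a)%:E)%E.
  rewrite integral_indic// setIT.
  have := lebesgue_measure_itv (`[a, b] : interval R).
  by rewrite /= lte_fin ab -EFinB => E1; exact: E1.
by rewrite -EFinM.
Qed.

(** Tangent inequality for [H * sqrt (y + c)] at its mean [t] with respect to the
    measure of density [1 / sqrt (y + c)] on the box, integrated against that
    measure. Compared with a uniform average, small heights are charged less:
    this is the gain that makes [hardy_sum] converge. *)
Lemma jensen_rect :
  ((mass H a b h `^ p)%:E <=
   (((b - a) * (2 * Num.sqrt (h + c))) `^ (p - 1))%:E *
   \int[mu2]_(z in rect a b h) (H z `^ p * Num.sqrt (`|z.2| + c) `^ (p - 1))%:E)%E.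
Proof.
have [Z0 Zle] := Z_le; have p0 : 0 < p by rewrite (lt_trans _ p1).
have p10 : 0 < p - 1 by rewrite subr_gt0.
have mr := rect_measurable a b h.
have [mH iH] := LH.
have M0 : 0 <= mass H a b h by exact: mass_ge0.
set M := mass H a b h in M0 *.
set X := (\int[mu2]_(z in rect a b h) _)%E.
have X0 : (0 <= X)%E.
  by apply: integral_ge0 => z _; rewrite lee_fin mulr_ge0 ?powR_ge0.
suff key : ((M `^ p)%:E <= (Z `^ (p - 1))%:E * X)%E.
  apply: (le_trans key); apply: lee_wpmul2r => //.
  by rewrite lee_fin; apply: ler_powR_norm; [exact: ltW|exact: ltW|].
pose t := M / Z; have t0 : 0 <= t by rewrite divr_ge0// ltW.
suff key : ((t `^ p * Z)%:E <= X)%E.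
  have -> : M `^ p = Z `^ (p - 1) * (t `^ p * Z).
    rewrite [RHS]mulrCA [Z `^ _ * Z]mulrC mulr_powRB1 ?(ltW Z0)// -powRM ?(ltW Z0)//.
    by rewrite divfK// gt_eqF.
  by rewrite EFinM; apply: lee_wpmul2l => //; rewrite lee_fin powR_ge0.
have [->|/eqP Xfin] := pselect (X = +oo%E); first exact: leey.
have mX : measurable_fun [set: mplane] (fun z => H z `^ p * s z `^ (p - 1)).
  apply: measurable_funM.
    by apply: (measurableT_comp (measurable_powR p)).
  apply: (measurableT_comp (measurable_powR (p - 1))).
  by apply: plane_continuous_measurable.
have iX : mu2.-integrable (rect a b h) (EFin \o (fun z => H z `^ p * s z `^ (p - 1))).
  apply/integrableP; split.
    by apply/measurable_EFinP; exact: measurable_funTS.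
  under eq_integral => z _ do rewrite /= ger0_norm ?mulr_ge0 ?powR_ge0//.
  by rewrite ltey.
have iHr : mu2.-integrable (rect a b h) (EFin \o H) by exact/iH/rect_compact.
have iw : mu2.-integrable (rect a b h) (EFin \o w).
  by have [_ ] := L1loc_continuous w_continuous; apply; exact: rect_compact.
pose k1 := p * t `^ (p - 1).
have iL : mu2.-integrable (rect a b h) (EFin \o (fun z => k1 * H z + (t `^ p - k1 * t) * w z)).
  have i1 := integrableZl mr k1 iHr.
  have i2 := integrableZl mr (t `^ p - k1 * t) iw.
  have := integrableD mr i1 i2.
  by congr (_.-integrable _ _); apply/funext => z.
have -> : X = (\int[mu2]_(z in rect a b h) (H z `^ p * s z `^ (p - 1)))%:E.
  rewrite /Rintegral fineK//.
  by apply: integrable_fin_num.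
have -> : t `^ p * Z = \int[mu2]_(z in rect a b h) (k1 * H z + (t `^ p - k1 * t) * w z).
  rewrite RintegralD//; last 2 first.
  - have := integrableZl mr k1 iHr.
    by congr (_.-integrable _ _); apply/funext => z.
  - have := integrableZl mr (t `^ p - k1 * t) iw.
    by congr (_.-integrable _ _); apply/funext => z.
  rewrite !RintegralZl// -/(mass H a b h) -/M -/Z.
  have -> : M = t * Z by rewrite /t divfK// gt_eqF.
  by ring.
rewrite lee_fin; apply: le_Rintegral => // z _.
have sz := s_gt0 z.
have := powR_tangent p1 (mulr_ge0 (H0 z) (ltW sz)) t0.
rewrite (powRM p (H0 z) (ltW sz)).
have -> : s z `^ p = s z * s z `^ (p - 1) by rewrite mulr_powRB1// ltW.
move=> /(ler_wpM2r (_ : 0 <= w z)); rewrite /w invr_ge0 (ltW sz) => /(_ isT).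
rewrite (_ : H z `^ p * (s z * s z `^ (p - 1)) / s z = H z `^ p * s z `^ (p - 1)); last first.
  by field; rewrite gt_eqF.
apply: le_trans; rewrite le_eqVlt; apply/orP; left; apply/eqP.
by rewrite -/k1; field; rewrite gt_eqF.
Qed.

End Jensen.

End Hardy.

(** A point of height [y] lies in boxes of all scales above [y]. By [jensen_rect]
    a box of scale [h] charges it with a factor [(y / h) `^ ((p - 1) / 2)], and
    these factors form a geometric series over the scales. This is a discrete
    Hardy inequality, and fails for [p = 1]. *)
Lemma hardy_sum (R : realType) (p A : R) (N : nat) : 1 < p -> 1 <= A ->
  exists2 C : R, 0 < C &
  forall H : R * R -> R, L1loc H -> (forall z, 0 <= H z) ->
  forall (T : finType) (kk : T -> nat) (al be : T -> R) (h0 : R), 0 < h0 ->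
  (forall j, al j < be j) ->
  (forall j, be j - al j <= A * (2 ^+ kk j * h0)) ->
  (forall k x, (#|[set j | (kk j == k) && (al j <= x <= be j)%R]%SET| <= N)%N) ->
  (\sum_j ((2 ^+ kk j * h0) `^ (2 - 2 * p) *
     mass H (al j) (be j) (A * (2 ^+ kk j * h0)) `^ p)%:E
   <= C%:E * \int[@lebesgue2 R]_z (H z `^ p)%:E)%E.
Proof.
move=> p1 A1; have A0 : 0 < A by rewrite (lt_le_trans _ A1).
have p0 : 0 < p by rewrite (lt_trans _ p1).
have p10 : 0 < p - 1 by rewrite subr_gt0.
pose q : R := (Num.sqrt 2)^-1 `^ (p - 1).
have s2 : 1 < Num.sqrt 2 :> R by rewrite -[ltLHS]sqrtr1 ltr_sqrt ?ltr1n.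
have q0 : 0 <= q by exact: powR_ge0.
have q1 : q < 1.
  apply: (@lt_le_trans _ _ (1 `^ (p - 1))); last by rewrite powR1.
  apply: gt0_ltr_powR; rewrite ?nnegrE ?invr_ge0 ?sqrtr_ge0//.
  by rewrite invf_lt1// (lt_trans _ s2).
pose A' := Num.sqrt (A + 1).
have A'0 : 0 < A' by rewrite sqrtr_gt0 addr_gt0.
pose C1 := (A * (2 * A')) `^ (p - 1).
have C10 : 0 < C1 by rewrite powR_gt0// !mulr_gt0.
pose B := A' `^ (p - 1).
have B0 : 0 < B by exact: powR_gt0.
exists (C1 * (N.+1%:R * (B / (1 - q)))).
  by rewrite !mulr_gt0 ?invr_gt0 ?subr_gt0.
move=> H LH H0 T kk al be h0 h00 ab bA overlap.
pose h k : R := 2 ^+ k * h0.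
have h_gt0 k : 0 < h k by rewrite mulr_gt0// exprn_gt0.
have h_ge k : h0 <= h k by rewrite ler_peMl ?(ltW h00)// exprn_ege1// ler1n.
have Ah k : 0 <= (A + 1) * h k by rewrite mulr_ge0 ?addr_ge0 ?(ltW A0) ?(ltW (h_gt0 _)).
have [mH iH] := LH.
pose r k (z : R * R) : R := (Num.sqrt (`|z.2| + h0) / Num.sqrt (h k)) `^ (p - 1).
have r0 k z : 0 <= r k z by exact: powR_ge0.
have rS k z : r k.+1 z = q * r k z.
  rewrite /r /q -powRM ?invr_ge0 ?divr_ge0 ?sqrtr_ge0//; congr (_ `^ _).
  by rewrite /h exprS -mulrA sqrtrM// invfM mulrCA.
have rB k z : 0 <= z.2 <= A * h k -> r k z <= B.
  move=> /andP[z0 z1]; apply: ler_powR_norm; rewrite ?(ltW p10) ?divr_ge0 ?sqrtr_ge0//.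
  rewrite ler_pdivrMr ?sqrtr_gt0// -sqrtrM ?addr_ge0 ?(ltW A0)// ler_sqrt ?Ah//.
  by rewrite ger0_norm// mulrDl mul1r lerD.
pose f j (z : R * R) : R := H z `^ p * (r (kk j) z * \1_(rect (al j) (be j) (A * h (kk j))) z).
have mr k : measurable_fun [set: measurableTypeR R * measurableTypeR R] (r k).
  apply: (measurableT_comp (measurable_powR (p - 1))).
  apply: plane_continuous_measurable => z; apply: cvgM; last exact: cvg_cst.
  apply: (continuous_comp (f := fun z : R * R => `|z.2| + h0)); last exact: sqrt_continuous.
  apply: cvgD; last exact: cvg_cst.
  apply: (continuous_comp (f := snd)); [exact: cvg_snd|exact: norm_continuous].
have mHp : measurable_fun [set: measurableTypeR R * measurableTypeR R] (fun z => H z `^ p).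
  exact: (measurableT_comp (measurable_powR p)).
have f0 j z : 0 <= f j z by rewrite !mulr_ge0 ?powR_ge0// indicE.
have mf j : measurable_fun [set: measurableTypeR R * measurableTypeR R] (f j).
  apply: measurable_funM => //; apply: measurable_funM => //.
  by apply: measurable_indic; exact: rect_measurable.
have one j : (((h (kk j)) `^ (2 - 2 * p) * mass H (al j) (be j) (A * h (kk j)) `^ p)%:E
    <= C1%:E * \int[@lebesgue2 R]_z (f j z)%:E)%E.
  set k := kk j; have hk := h_gt0 k.
  have Ah0 : 0 < A * h k by rewrite mulr_gt0.
  have J := jensen_rect LH H0 p1 (ab j) Ah0 h00.
  rewrite EFinM; apply: (le_trans (lee_wpmul2l _ J)); first by rewrite lee_fin powR_ge0.
  rewrite muleA -EFinM.
  have -> : (\int[@lebesgue2 R]_z (f j z)%:E = \int[@lebesgue2 R]_(z in rect (al j) (be j) (A * h k))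
      (((Num.sqrt (h k))^-1 `^ (p - 1))%:E * (H z `^ p * Num.sqrt (`|z.2| + h0) `^ (p - 1))%:E))%E.
    rewrite [RHS]integral_mkcond; apply: eq_integral => z _; rewrite patchE /f indicE -/k.
    case: ifPn => _; last by rewrite !mulr0.
    rewrite -EFinM mulr1 /r powRM ?sqrtr_ge0 ?invr_ge0 ?sqrtr_ge0//.
    by congr (_%:E); ring.
  rewrite ge0_integralZl//; last 3 first.
  - exact: rect_measurable.
  - apply/measurable_EFinP; apply: measurable_funTS; apply: measurable_funM => //.
    apply: (measurableT_comp (measurable_powR (p - 1))).
    apply: plane_continuous_measurable => z.
    apply: (continuous_comp (f := fun z : R * R => `|z.2| + h0)); last exact: sqrt_continuous.
    apply: cvgD; last exact: cvg_cst.
    apply: (continuous_comp (f := snd)); [exact: cvg_snd|exact: norm_continuous].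
  - by move=> z _; rewrite lee_fin mulr_ge0 ?powR_ge0.
  rewrite muleA -EFinM; apply: lee_wpmul2r.
    by apply: integral_ge0 => z _; rewrite lee_fin mulr_ge0 ?powR_ge0.
  rewrite lee_fin.
  set S := Num.sqrt (h k); have S0 : 0 < S by rewrite sqrtr_gt0.
  have hS : h k = S ^+ 2 by rewrite sqr_sqrtr// ltW.
  have bnd : (be j - al j) * (2 * Num.sqrt (A * h k + h0)) <= (A * (2 * A')) * S ^+ 3.
    rewrite [leRHS](_ : _ = (A * h k) * (2 * (A' * S))); last by rewrite hS; ring.
    apply: ler_pM; [by rewrite subr_ge0 ltW|by rewrite mulr_ge0 ?sqrtr_ge0|exact: bA|].
    rewrite ler_pM2l// /A' /S -sqrtrM ?addr_ge0 ?(ltW A0)// ler_sqrt ?Ah//.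
    by rewrite mulrDl mul1r lerD2l.
  have {}bnd : ((be j - al j) * (2 * Num.sqrt (A * h k + h0))) `^ (p - 1) <= C1 * (S ^+ 3) `^ (p - 1).
    rewrite -powRM ?exprn_ge0 ?(ltW S0) ?mulr_ge0 ?(ltW A0) ?(ltW A'0)//.
    by apply: ler_powR_norm; rewrite ?(ltW p10) ?mulr_ge0 ?sqrtr_ge0 ?subr_ge0 ?(ltW (ab j)).
  apply: (le_trans (ler_wpM2l (powR_ge0 _ _) bnd)).
  rewrite mulrCA ler_pM2l// le_eqVlt; apply/orP; left; apply/eqP.
  have -> : 2 - 2 * p = - 2 * (p - 1) :> R by ring.
  rewrite powRrM -powRM ?powR_ge0 ?exprn_ge0 ?(ltW S0)//; congr (_ `^ _).
  rewrite powRN powR_mulrn ?(ltW hk)// hS; field.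
  by rewrite gt_eqF.
apply: (@le_trans _ _ (\sum_j C1%:E * \int[@lebesgue2 R]_z (f j z)%:E)%E).
  by apply: lee_sum => j _; exact: one.
rewrite -ge0_sume_distrr; last first.
  by move=> j _; apply: integral_ge0 => z _; rewrite lee_fin.
rewrite EFinM -muleA; apply: lee_wpmul2l; first by rewrite lee_fin ltW.
rewrite -ge0_integral_sum//; last 2 first.
- by move=> j; exact/measurable_EFinP.
- by move=> j z _; rewrite lee_fin.
rewrite -ge0_integralZl//; last 3 first.
- exact/measurable_EFinP.
- by move=> z _; rewrite lee_fin powR_ge0.
- by rewrite lee_fin !mulr_ge0 ?(ltW B0)// invr_ge0 subr_ge0 ltW.
apply: ge0_le_integral => //.
- by move=> z _; apply: sume_ge0 => j _; rewrite lee_fin.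
- apply: emeasurable_sum => j; exact/measurable_EFinP.
- apply/measurable_EFinP; exact: measurable_funM.
move=> z _; rewrite sumEFin -EFinM lee_fin /f -mulr_sumr mulrC ler_wpM2r ?powR_ge0//.
(* Above a given point there are at most [N] boxes of each scale. *)
have [n kn] : exists n, forall j, (kk j < n)%N.
  exists (\max_j kk j).+1 => j; rewrite ltnS; exact: leq_bigmax.
pose c k := (0 <= z.2 <= A * h k).
apply: (@le_trans _ _ (\sum_(k < n) N%:R * (if c k then r k z else 0))).
  rewrite (partition_big (fun j => Ordinal (kn j)) xpredT)//=.
  apply: ler_sum => k _.
  pose P := [set j | (kk j == k) && (al j <= z.1 <= be j)%R]%SET.
  apply: (@le_trans _ _ (\sum_(j in P) (if c k then r k z else 0))).
    rewrite [leRHS]big_mkcond/= big_mkcond/=; apply: ler_sum => j _.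
    rewrite /P inE (_ : (Ordinal (kn j) == k) = (kk j == k))//.
    have [kj|nkj] := eqVneq (kk j) (k : nat); last by [].
    rewrite indicE kj; case: (boolP (z \in _)) => [/set_mem/rectP[z1 z2]|_].
      by rewrite z1 mulr1 /c z2.
    by rewrite mulr0; case: ifP => // _; case: ifP.
  rewrite sumr_const -[leLHS]mulr_natl ler_wpM2r//; first by case: ifP.
  by rewrite ler_nat; exact: overlap.
rewrite -mulr_sumr; apply: ler_pM => //.
- by apply: sumr_ge0 => k _; case: ifP.
- by rewrite ler_nat.
apply: (@sum_from_first R q B c (fun k => r k z)) => //; first exact: ltW.
by move=> k; exact: rB.
Qed.

(** * The trace inequality *)

Section GridCount.
Context {R : realType}.

Lemma card_grid_le (M A : nat) (o h c : R) : 0 < h ->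
  (#|[set n : 'I_M | (`|o + n%:R * h - c| <= A%:R * h)%R]%SET| <= (2 * A).+1)%N.
Proof.
move=> h0; set S := [set n | _]%SET.
have [->|[n1 n1S]] := set_0Vmem S; first by rewrite cards0.
have [n0 n0S nmin] : exists2 n0 : 'I_M, n0 \in S & forall n, n \in S -> (n0 <= n)%N.
  by case: (arg_minnP (fun n : 'I_M => n : nat) n1S) => n0 n0S nm; exists n0.
have bnd n : n \in S -> (n - n0 < (2 * A).+1)%N.
  move=> nS; have n0n := nmin n nS; rewrite ltnS leq_subLR.
  move: nS n0S; rewrite !inE !ler_norml => /andP[_ h1] /andP[h2 _].
  have : (n%:R : R) * h <= (n0%:R + 2 * A%:R) * h by lra.
  by rewrite ler_pM2r// -natrM -natrD ler_nat.
pose g (n : 'I_M) : 'I_(2 * A).+1 := inord (n - n0).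
have ginj : {in S &, injective g}.
  move=> n n' nS n'S /(congr1 val); rewrite /= !inordK ?bnd// => e.
  apply: val_inj => /=.
  by rewrite -(subnK (nmin n nS)) e subnK// nmin.
by rewrite -(card_in_imset ginj) (leq_trans (max_card _))// card_ord.
Qed.

End GridCount.

Section TraceInequality.
Context {R : realType}.
Local Notation plane := (R * R)%type.
Local Notation mu2 := (@lebesgue2 R).

(** The abscissas are [X 0 < ... < X N] and carry the values [Y]. The gap [i] lies
    between [X i.-1] and [X i]; on both unbounded gaps [0] and [N.+1] the line is
    the chord of the whole set. *)
Variables (X Y : nat -> R) (N : nat).

Definition gap_index (s : R) : nat := find (fun j => s < X j) (iota 0 N.+1).

Definition bounded_gap (i : nat) := (0 < i <= N)%N.
Definition anchorl i := if bounded_gap i then i.-1 else 0%N.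
Definition anchorr i := if bounded_gap i then i else N.
Definition gap_slope i := (Y (anchorr i) - Y (anchorl i)) / (X (anchorr i) - X (anchorl i)).
Definition gap_line i t := Y (anchorl i) + gap_slope i * (t - X (anchorl i)).

Definition in_gap i s := ((0 < i)%N -> X i.-1 <= s) /\ ((i <= N)%N -> s < X i).

Lemma gap_index_le s : (gap_index s <= N.+1)%N.
Proof. by rewrite -[leqRHS](size_iota 0) find_size. Qed.

Lemma gap_indexP s : in_gap (gap_index s) s.
Proof.
split=> [i0|iN].
  have := @before_find _ 0%N (fun j => s < X j) (iota 0 N.+1) (gap_index s).-1.
  rewrite -/(gap_index s) prednK// leqnn => /(_ isT).
  rewrite nth_iota ?add0n; last by rewrite prednK// gap_index_le.
  by move=> /negbT; rewrite -leNgt.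
have : has (fun j => s < X j) (iota 0 N.+1).
  by rewrite has_find size_iota ltnS.
by move=> /(nth_find 0%N); rewrite -/(gap_index s) nth_iota ?ltnS// add0n.
Qed.

Variables (h0 : R) (K : nat).
Hypothesis N0 : (0 < N)%N.
Hypothesis h00 : 0 < h0.
Hypothesis gap16 : forall i, (i < N)%N -> 16 * h0 <= X i.+1 - X i.

Definition scale k : R := 2 ^+ k * h0.

Hypothesis top_scale : X N - X 0%N <= scale K <= 2 * (X N - X 0%N).

Lemma scale_gt0 k : 0 < scale k.
Proof. by rewrite mulr_gt0// exprn_gt0. Qed.

Lemma scaleS k : scale k.+1 = 2 * scale k.
Proof. by rewrite /scale exprS mulrA. Qed.

Lemma scale_ge k : h0 <= scale k.
Proof. by rewrite ler_peMl ?(ltW h00)// exprn_ege1// ler1n. Qed.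

Lemma scale_le k l : (k <= l)%N -> scale k <= scale l.
Proof.
by move=> kl; rewrite ler_wpM2r ?(ltW h00)// ler_weXn2l// ler1n.
Qed.

Lemma X_far i j : (i < j)%N -> (j <= N)%N -> X i + 16 * h0 <= X j.
Proof.
elim: j => // j IH; rewrite ltnS leq_eqVlt => /orP[/eqP ->|ij] jN.
  by have := gap16 jN; lra.
by have := IH ij (ltnW jN); have := gap16 jN; have := h00; lra.
Qed.

Lemma X_le i j : (i <= j)%N -> (j <= N)%N -> X i <= X j.
Proof.
rewrite leq_eqVlt => /orP[/eqP -> //|ij] jN.
by have := X_far ij jN; have := h00; lra.
Qed.

Lemma gap_index_mono s s' : s <= s' -> (gap_index s <= gap_index s')%N.
Proof.
move=> ss'; rewrite leqNgt; apply/negP => lt.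
have [_ h1] := gap_indexP s'; have [h2 _] := gap_indexP s.
have i0 : (0 < gap_index s)%N by exact: leq_ltn_trans lt.
have le1 : (gap_index s' <= (gap_index s).-1)%N by rewrite -ltnS prednK.
have le2 : ((gap_index s).-1 <= N)%N by rewrite -ltnS prednK// gap_index_le.
have := h1 (leq_trans le1 le2); have := h2 i0; have := X_le le1 le2; lra.
Qed.

Lemma gap_index_neq s s' : s <= s' -> gap_index s != gap_index s' ->
  exists2 j, (j <= N)%N & s < X j <= s'.
Proof.
move=> ss' ne; have lt : (gap_index s < gap_index s')%N.
  by rewrite ltn_neqAle ne gap_index_mono.
have iN : (gap_index s <= N)%N by rewrite -ltnS (leq_trans lt)// gap_index_le.
exists (gap_index s) => //; have [_ -> //] := gap_indexP s; rewrite /=.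
have [h1 _] := gap_indexP s'; apply: le_trans (h1 (leq_ltn_trans (leq0n _) lt)).
apply: X_le; first by rewrite -ltnS prednK// (leq_ltn_trans _ lt).
by rewrite -ltnS prednK ?gap_index_le// (leq_ltn_trans _ lt).
Qed.

(** The piecewise affine function to be sampled. Because of the shift by [2 * h0],
    the line of the gap on the right of [X i] is used from [X i - 2 * h0] on: all
    nodes that contribute to the finest spline at [X i] then lie on one line, which
    passes through the datum at [X i]. *)
Definition sample t := gap_line (gap_index (t + 2 * h0)) t.

Variables (G : R -> R) (H : plane -> R) (C0 p : R).
Hypothesis YG : forall i, Y i = G (X i).
Hypothesis LH : L1loc H.
Hypothesis H0 : forall z, 0 <= H z.
Hypothesis C00 : 0 < C0.
Hypothesis p12 : 1 < p < 2.
Hypothesis TP : forall a c b, a < c -> c < b ->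
  `|G c - ((b - c) / (b - a) * G a + (c - a) / (b - a) * G b)|
  <= C0 * mass H a (b + h0) (b - a).

(** For a fixed line the defect has the same second differences as [- G], and it
    vanishes at the two points that define the line. *)
Definition defect i t := gap_line i t - G t.

Lemma anchors_lt i : X (anchorl i) + 16 * h0 <= X (anchorr i).
Proof.
rewrite /anchorl /anchorr; case: ifPn => [/andP[i0 iN]|_]; last exact: X_far.
by apply: X_far => //; rewrite prednK.
Qed.

Lemma defect_anchorl i : defect i (X (anchorl i)) = 0.
Proof. by rewrite /defect /gap_line subrr mulr0 addr0 YG subrr. Qed.

Lemma defect_anchorr i : defect i (X (anchorr i)) = 0.
Proof.
have ne : X (anchorr i) - X (anchorl i) != 0.
  by rewrite gt_eqF//; have := anchors_lt i; have := h00; lra.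
by rewrite /defect /gap_line /gap_slope divfK// !YG; ring.
Qed.

Lemma defect_TP i a c b : a < c -> c < b ->
  `|defect i c - ((b - c) / (b - a) * defect i a + (c - a) / (b - a) * defect i b)|
  <= C0 * mass H a (b + h0) (b - a).
Proof.
move=> ac cb; have ne : b - a != 0 by rewrite gt_eqF// subr_gt0 (lt_trans ac).
rewrite -normrN (_ : - _ = G c - ((b - c) / (b - a) * G a + (c - a) / (b - a) * G b)).
  exact: TP.
by rewrite /defect /gap_line; field.
Qed.

Let m := mass H.

Let m_le a b h a' b' h' : a' <= a -> b <= b' -> h <= h' -> m a b h <= m a' b' h'.
Proof. exact: mass_le. Qed.

Let m_ge0 a b h : 0 <= m a b h. Proof. exact: mass_ge0. Qed.

Section ThreePointConsequences.
Variables (i : nat).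
Let u := defect i.

Lemma defect_inside x y t : u x = 0 -> x <= t <= y ->
  `|u t| <= `|u y| + C0 * m x (y + h0) (y - x).
Proof.
move=> ux /andP[]; rewrite le_eqVlt => /orP[/eqP <- _|xt].
  by rewrite ux normr0 addr_ge0// mulr_ge0// ltW.
rewrite le_eqVlt => /orP[/eqP <-|ty].
  by rewrite lerDl mulr_ge0// ltW.
have := defect_TP i xt ty; rewrite -/u ux mulr0 add0r => h.
have yx : 0 < y - x by rewrite subr_gt0 (lt_trans xt).
have -> : u t = (t - x) / (y - x) * u y + (u t - (t - x) / (y - x) * u y) by ring.
apply: (le_trans (ler_normD _ _)); apply: lerD => //.
rewrite normrM ler_piMl// ger0_norm ?divr_ge0 ?subr_ge0 ?(ltW xt) ?(ltW (lt_trans xt ty))//.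
by rewrite ler_pdivrMr// mul1r lerD2r ltW.
Qed.

Lemma defect_inside_left x y t : u x = 0 -> y <= t <= x ->
  `|u t| <= `|u y| + C0 * m y (x + h0) (x - y).
Proof.
move=> ux /andP[]; rewrite le_eqVlt => /orP[/eqP <- _|yt].
  by rewrite lerDl mulr_ge0// ltW.
rewrite le_eqVlt => /orP[/eqP ->|tx].
  by rewrite ux normr0 addr_ge0// mulr_ge0// ltW.
have := defect_TP i yt tx; rewrite -/u ux mulr0 addr0 => h.
have xy : 0 < x - y by rewrite subr_gt0 (lt_trans yt).
have -> : u t = (x - t) / (x - y) * u y + (u t - (x - t) / (x - y) * u y) by ring.
apply: (le_trans (ler_normD _ _)); apply: lerD => //.
rewrite normrM ler_piMl// ger0_norm ?divr_ge0 ?subr_ge0 ?(ltW tx) ?(ltW (lt_trans yt tx))//.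
by rewrite ler_pdivrMr// mul1r lerD2l lerN2 ltW.
Qed.

Lemma defect_outside x y t c : u x = 0 -> t < x -> x < y -> x - t <= c * (y - x) ->
  `|u t| <= c * `|u y| + (1 + c) * (C0 * m t (y + h0) (y - t)).
Proof.
move=> ux tx xy xty.
have := defect_TP i tx xy; rewrite -/u ux.
have yx0 : 0 < y - x by rewrite subr_gt0.
have xt0 : 0 < x - t by rewrite subr_gt0.
have yt0 : 0 < y - t by rewrite subr_gt0 (lt_trans tx).
set L := _ - _ => hL.
have -> : u t = - ((x - t) / (y - x) * u y) + - ((y - t) / (y - x)) * L.
  by rewrite /L; field; rewrite !gt_eqF.
apply: (le_trans (ler_normD _ _)); apply: lerD.
  rewrite normrN normrM ler_wpM2r// ger0_norm; last by rewrite divr_ge0 ?(ltW yx0)// ltW.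
  by rewrite ler_pdivrMr.
rewrite normrM normrN; apply: ler_pM => //.
rewrite ger0_norm; last by rewrite divr_ge0 ?(ltW yx0)// ltW.
by rewrite ler_pdivrMr//; lra.
Qed.

Lemma defect_outside_right x y t c : u x = 0 -> x < t -> y < x -> t - x <= c * (x - y) ->
  `|u t| <= c * `|u y| + (1 + c) * (C0 * m y (t + h0) (t - y)).
Proof.
move=> ux xt yx xty.
have := defect_TP i yx xt; rewrite -/u ux.
have yx0 : 0 < x - y by rewrite subr_gt0.
have tx0 : 0 < t - x by rewrite subr_gt0.
have yt0 : 0 < t - y by rewrite subr_gt0 (lt_trans yx).
set L := _ - _ => hL.
have -> : u t = - ((t - x) / (x - y) * u y) + - ((t - y) / (x - y)) * L.
  by rewrite /L; field; rewrite !gt_eqF.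
apply: (le_trans (ler_normD _ _)); apply: lerD.
  rewrite normrN normrM ler_wpM2r// ger0_norm; last by rewrite divr_ge0 ?(ltW yx0)// ltW.
  by rewrite ler_pdivrMr.
rewrite normrM normrN; apply: ler_pM => //.
rewrite ger0_norm; last by rewrite divr_ge0 ?(ltW yx0)// ltW.
by rewrite ler_pdivrMr//; lra.
Qed.

(** The three-point inequality at [x], [x + r], [x + 2 * r] where the value at [x]
    is zero: this is the halving step of [recursion_sum]. *)
Lemma defect_double_right x r : u x = 0 -> 0 < r ->
  `|u (x + r)| <= `|u (x + 2 * r)| / 2 + C0 * m x (x + 2 * r + h0) (2 * r).
Proof.
move=> ux r0; have xr : x < x + r by rewrite ltrDl.
have rr : x + r < x + 2 * r by lra.
have := defect_TP i xr rr; rewrite -/u ux mulr0 add0r.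
have -> : x + 2 * r - x = 2 * r by ring.
have -> : (x + r - x) / (2 * r) = 2^-1 by field; rewrite gt_eqF.
have -> : u (x + r) = 2^-1 * u (x + 2 * r) + (u (x + r) - 2^-1 * u (x + 2 * r)) by ring.
move=> h; apply: (le_trans (ler_normD _ _)); apply: lerD.
  by rewrite normrM ger0_norm ?invr_ge0// mulrC.
by move: h; congr (`|_| <= _); ring.
Qed.

Lemma defect_double_left x r : u x = 0 -> 0 < r ->
  `|u (x - r)| <= `|u (x - 2 * r)| / 2 + C0 * m (x - 2 * r) (x + h0) (2 * r).
Proof.
move=> ux r0; have xr : x - r < x by rewrite gtrBl.
have rr : x - 2 * r < x - r by lra.
have := defect_TP i rr xr; rewrite -/u ux mulr0 addr0.
have -> : x - (x - 2 * r) = 2 * r by ring.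
have -> : (x - (x - r)) / (2 * r) = 2^-1 by field; rewrite gt_eqF.
have -> : u (x - r) = 2^-1 * u (x - 2 * r) + (u (x - r) - 2^-1 * u (x - 2 * r)) by ring.
move=> h; apply: (le_trans (ler_normD _ _)); apply: lerD.
  by rewrite normrM ger0_norm ?invr_ge0// mulrC.
by move: h; congr (`|_| <= _); ring.
Qed.

End ThreePointConsequences.

Variables (CR CH : R).
Hypothesis CR0 : 0 < CR.
Hypothesis RS : forall (U V : nat -> R) (w : nat -> R) kap,
  (forall k, 0 <= w k) -> (forall k, w k.+1 = 2 `^ (2 - 2 * p) * w k) ->
  (forall k, 0 <= U k) -> (forall k, 0 <= V k) ->
  (forall k, (k < kap)%N -> U k <= U k.+1 / 2 + V k) -> U kap <= V kap ->
  \sum_(k < kap.+1) w k * U k `^ p <= CR * \sum_(k < kap.+1) w k * V k `^ p.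

Definition weight k : R := scale k `^ (2 - 2 * p).

Lemma weight_ge0 k : 0 <= weight k. Proof. exact: powR_ge0. Qed.

Lemma weightS k : weight k.+1 = 2 `^ (2 - 2 * p) * weight k.
Proof. by rewrite /weight scaleS powRM// ltW// scale_gt0. Qed.

Let p0 : 0 < p. Proof. by have /andP[p1 _] := p12; rewrite (lt_trans _ p1). Qed.

Definition ray_const : R := 2 `^ p * (CR + 1).

(** Along a ray, [U k] is the defect at distance of order [scale k] from the base
    point and [V k] bounds the three-point error. Up to the scale [kap] of the gap the
    recursion applies; beyond it the error alone bounds the defect. *)
Lemma ray_sum (U V : nat -> R) kap : (kap <= K)%N ->
  (forall k, 0 <= U k) -> (forall k, 0 <= V k) ->
  (forall k, (k < kap)%N -> U k <= U k.+1 / 2 + V k) -> U kap <= V kap ->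
  \sum_(k < K.+1) weight k * (if (k <= kap)%N then U k + V k else V k) `^ p
  <= ray_const * \sum_(k < K.+1) weight k * V k `^ p.
Proof.
move=> kK U0 V0 UV Ukap.
have := RS weight_ge0 weightS U0 V0 UV Ukap.
rewrite (big_ord_widen K.+1 (fun k => weight k * U k `^ p)) ?ltnS// => hU.
have hV : \sum_(k < kap.+1) weight k * V k `^ p <= \sum_(k < K.+1) weight k * V k `^ p.
  rewrite (big_ord_widen K.+1 (fun k => weight k * V k `^ p)) ?ltnS// big_mkcond/=.
  by apply: ler_sum => k _; case: ifP => // _; rewrite mulr_ge0 ?weight_ge0 ?powR_ge0.
apply: (@le_trans _ _ (2 `^ p * (\sum_(k < K.+1 | (k < kap.+1)%N) weight k * U k `^ p +
    \sum_(k < K.+1) weight k * V k `^ p))).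
  rewrite [X in _ <= _ * (X + _)]big_mkcond/= -big_split/= mulr_sumr.
  apply: ler_sum => k _; rewrite ltnS; case: ifP => _.
    rewrite -mulrDr mulrCA ler_wpM2l ?weight_ge0//; exact: powRD_le.
  rewrite add0r ler_peMl ?mulr_ge0 ?weight_ge0 ?powR_ge0//.
  rewrite -[leLHS](powRr0 2) ler_powR ?ler1n//; exact: ltW.
rewrite /ray_const -mulrA ler_wpM2l ?powR_ge0// mulrDl mul1r lerD2r.
by apply: (le_trans hU); rewrite ler_wpM2l// ltW.
Qed.

(** Each gap is explored from its two ends, according to the boolean; an unbounded
    gap has only one end. The box of index [k] contains all points used by the
    three-point inequalities at scale [k], with the margin demanded by [TP]. *)
Definition base i (sd : bool) : R :=
  if bounded_gap i then (if sd then X i.-1 else X i)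
  else if i == 0%N then X 0%N else X N.

Definition boxl i (sd : bool) k : R :=
  if bounded_gap i then
    if sd then X i.-1 - 2 * h0 else Num.max (X i - 8 * scale k) (X i.-1) - 2 * h0
  else if i == 0%N then X 0%N - 8 * scale k else X N - 2 * scale k.

Definition boxr i (sd : bool) k : R :=
  if bounded_gap i then
    if sd then Num.min (X i.-1 + 8 * scale k) (X i) + h0 else X i + h0
  else if i == 0%N then X 0%N + 2 * scale k else X N + 8 * scale k + h0.

Definition boxmass i sd k : R := 9 * (C0 * m (boxl i sd k) (boxr i sd k) (13 * scale k)).

Lemma boxmass_ge0 i sd k : 0 <= boxmass i sd k.
Proof. by rewrite !mulr_ge0// ltW. Qed.

Lemma le_boxmass c a b h i sd k : c <= 9 -> boxl i sd k <= a -> b <= boxr i sd k ->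
  h <= 13 * scale k -> c * (C0 * m a b h) <= boxmass i sd k.
Proof.
move=> c9 la br hh; apply: (@le_trans _ _ (9 * (C0 * m a b h))).
  by rewrite ler_wpM2r// mulr_ge0// ltW.
by rewrite ler_wpM2l// ler_wpM2l ?(ltW C00)//; exact: m_le.
Qed.

Lemma le_boxmass1 a b h i sd k : boxl i sd k <= a -> b <= boxr i sd k ->
  h <= 13 * scale k -> C0 * m a b h <= boxmass i sd k.
Proof.
by move=> ? ? ?; rewrite -[leLHS]mul1r; apply: le_boxmass => //; rewrite ler1n.
Qed.

(** [kap] is the last index for which four times the scale fits in a gap of
    length [l]. *)
Lemma crossover (l : R) : 4 * h0 <= l -> l < 4 * scale K -> exists2 kap, (kap < K)%N &
  forall k, (k <= kap)%N = (4 * scale k <= l).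
Proof.
move=> l0 lK; pose q k := l < 4 * scale k.
have ex : exists k, q k by exists K.
have [k1 qk1 k1min] := ex_minnP ex.
have k10 : (0 < k1)%N.
  by case: k1 qk1 k1min => // + _; rewrite /q /scale expr0 mul1r ltNge l0.
exists k1.-1; first by rewrite prednK// k1min.
move=> k; rewrite -ltnS prednK//; apply/idP/idP => [kk1|kl].
  by rewrite leNgt; apply/negP => /k1min; rewrite leqNgt kk1.
rewrite ltnNge; apply/negP => /scale_le h.
by move: qk1; rewrite /q ltNge => /negP; apply; apply: le_trans kl; rewrite ler_pM2l.
Qed.

(** The defect at the points at distance at most [2 * scale k] of the base point
    is bounded by a sequence whose weighted sum is controlled by the boxes. *)
Definition ray_ok i sd := exists2 E : nat -> R,
  (forall k, 0 <= E k) /\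
  \sum_(k < K.+1) weight k * E k `^ p
    <= ray_const * \sum_(k < K.+1) weight k * boxmass i sd k `^ p &
  forall k t, (k <= K)%N -> in_gap i (t + 2 * h0) ->
    `|t + 2 * h0 - base i sd| <= 2 * scale k -> `|defect i t| <= E k.

Let E_ge0 (U V : nat -> R) kap k : (forall k, 0 <= U k) -> (forall k, 0 <= V k) ->
  0 <= (if (k <= kap)%N then U k + V k else V k).
Proof. by move=> U0 V0; case: ifP => // _; rewrite addr_ge0. Qed.

Let gap_length i : bounded_gap i -> [/\ X i.-1 + 16 * h0 <= X i,
  X i - X i.-1 < 4 * scale K, defect i (X i.-1) = 0 & defect i (X i) = 0].
Proof.
move=> bi; have /andP[i0 iN] := bi.
have l0 := defect_anchorl i; have r0 := defect_anchorr i.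
have lr := anchors_lt i; rewrite /anchorl /anchorr bi in l0 r0 lr.
split => //.
have /andP[tK _] := top_scale; have := scale_gt0 K.
have := X_le (leq0n i.-1) (leq_trans (leq_pred i) iN); have := X_le iN (leqnn N).
lra.
Qed.

Lemma ray_interior_left i : bounded_gap i -> ray_ok i true.
Proof.
move=> bi; have [xx' lK ux ux'] := gap_length bi.
have [|kap kapK kapP] := @crossover (X i - X i.-1) _ lK.
  by have := h00; lra.
pose U k := `|defect i (X i.-1 + 4 * scale k)|.
pose V k := boxmass i true k.
have bl k : boxl i true k = X i.-1 - 2 * h0 by rewrite /boxl bi.
have br k : boxr i true k = Num.min (X i.-1 + 8 * scale k) (X i) + h0 by rewrite /boxr bi.
have U0 k : 0 <= U k by exact: normr_ge0.
have V0 k : 0 <= V k by exact: boxmass_ge0.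
have hpos := h00.
exists (fun k => if (k <= kap)%N then U k + V k else V k).
  split; first by move=> k; exact: E_ge0.
  apply: ray_sum => //; first exact: ltnW.
  - move=> k kk; have s0 := scale_gt0 k.
    have := kapP k.+1; rewrite kk scaleS => /esym l8.
    have s4 : 0 < 4 * scale k by rewrite mulr_gt0.
    have := defect_double_right ux s4.
    rewrite /U scaleS (_ : 2 * (4 * scale k) = 4 * (2 * scale k)); last by ring.
    move=> h; apply: (le_trans h); rewrite lerD2l; apply: le_boxmass1.
    + by rewrite bl; lra.
    + rewrite br lerD2r le_min; apply/andP; split; lra.
    + lra.
  - have s0 := scale_gt0 kap.
    have := kapP kap; rewrite leqnn => /esym l4.
    have := kapP kap.+1; rewrite ltnn scaleS => /esym/negbT; rewrite -ltNge => l8.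
    have := @defect_inside i (X i.-1) (X i) (X i.-1 + 4 * scale kap) ux.
    rewrite ux' normr0 add0r => h; apply: (le_trans (h _)).
      by apply/andP; split; lra.
    apply: le_boxmass1; [rewrite bl; lra| |lra].
    by rewrite br lerD2r le_min lexx andbT; lra.
move=> k t kK hs1; have [_ hs] := hs1; rewrite /base bi => hn.
have /andP[i0 iN] := bi; have {}hs := hs iN.
have s0 := scale_gt0 k; have sh := scale_ge k.
have [/(_ i0) hs0 _] := hs1.
have tn : t - X i.-1 <= 2 * scale k - 2 * h0.
  by move: hn; rewrite ger0_norm; lra.
have [kk|kk] := leqP k kap.
  have := kapP k; rewrite kk => /esym l4.
  have hi : X i.-1 + 4 * scale k + h0 <= boxr i true k.
    by rewrite br lerD2r le_min; apply/andP; split; lra.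
  have [xt|tx] := leP (X i.-1) t.
    apply: (le_trans (@defect_inside i _ (X i.-1 + 4 * scale k) t ux _)).
      by apply/andP; split; lra.
    by rewrite /U lerD2l; apply: le_boxmass1 => //; [rewrite bl; lra|lra].
  apply: (le_trans (@defect_outside i _ (X i.-1 + 4 * scale k) t 1 ux tx _ _)).
  - lra.
  - lra.
  rewrite mul1r /U lerD2l; apply: le_boxmass => //; last lra.
  + lra.
  + by rewrite bl; lra.
have := kapP k; rewrite leqNgt kk => /esym/negbT; rewrite -ltNge => l4.
have hi : X i + h0 <= boxr i true k.
  by rewrite br lerD2r le_min lexx andbT; lra.
have [xt|tx] := leP (X i.-1) t.
  apply: (le_trans (@defect_inside i _ (X i) t ux _)).
    by apply/andP; split; lra.
  by rewrite ux' normr0 add0r; apply: le_boxmass1 => //; [rewrite bl; lra|lra].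
apply: (le_trans (@defect_outside i _ (X i) t 1 ux tx _ _)).
- lra.
- lra.
rewrite ux' normr0 mulr0 add0r; apply: le_boxmass => //; last lra.
- lra.
- by rewrite bl; lra.
Qed.

Lemma ray_interior_right i : bounded_gap i -> ray_ok i false.
Proof.
move=> bi; have [xx' lK ux ux'] := gap_length bi.
have hpos := h00.
have [|kap kapK kapP] := @crossover (X i - X i.-1) _ lK; first by lra.
pose U k := `|defect i (X i - 4 * scale k)|.
pose V k := boxmass i false k.
have bl k : boxl i false k = Num.max (X i - 8 * scale k) (X i.-1) - 2 * h0 by rewrite /boxl bi.
have br k : boxr i false k = X i + h0 by rewrite /boxr bi.
have U0 k : 0 <= U k by exact: normr_ge0.
have V0 k : 0 <= V k by exact: boxmass_ge0.
exists (fun k => if (k <= kap)%N then U k + V k else V k).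
  split; first by move=> k; exact: E_ge0.
  apply: ray_sum => //; first exact: ltnW.
  - move=> k kk; have s0 := scale_gt0 k.
    have := kapP k.+1; rewrite kk scaleS => /esym l8.
    have s4 : 0 < 4 * scale k by rewrite mulr_gt0.
    have := defect_double_left ux' s4.
    rewrite /U scaleS (_ : 2 * (4 * scale k) = 4 * (2 * scale k)); last by ring.
    move=> h; apply: (le_trans h); rewrite lerD2l; apply: le_boxmass1.
    + rewrite bl lerBlDr ge_max; apply/andP; split; lra.
    + by rewrite br.
    + lra.
  - have s0 := scale_gt0 kap.
    have := kapP kap; rewrite leqnn => /esym l4.
    have := kapP kap.+1; rewrite ltnn scaleS => /esym/negbT; rewrite -ltNge => l8.
    have := @defect_inside_left i (X i) (X i.-1) (X i - 4 * scale kap) ux'.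
    rewrite ux normr0 add0r => h; apply: (le_trans (h _)).
      by apply/andP; split; lra.
    apply: le_boxmass1; [|by rewrite br|lra].
    by rewrite bl lerBlDr ge_max; apply/andP; split; lra.
move=> k t kK hs1; have [_ hs] := hs1; rewrite /base bi => hn.
have /andP[i0 iN] := bi; have {}hs := hs iN.
have s0 := scale_gt0 k; have sh := scale_ge k.
have [/(_ i0) hs0 _] := hs1.
have tn : X i - t <= 2 * scale k + 2 * h0.
  by move: hn; rewrite ler0_norm; lra.
have [kk|kk] := leqP k kap.
  have := kapP k; rewrite kk => /esym l4.
  apply: (le_trans (@defect_inside_left i _ (X i - 4 * scale k) t ux' _)).
    by apply/andP; split; lra.
  rewrite /U lerD2l; apply: le_boxmass1 => //; [|by rewrite br|lra].
  by rewrite bl lerBlDr ge_max; apply/andP; split; lra.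
have := kapP k; rewrite leqNgt kk => /esym/negbT; rewrite -ltNge => l4.
have lo : boxl i false k <= X i.-1 - 2 * h0.
  by rewrite bl lerD2r ge_max lexx andbT; lra.
have [xt|tx] := leP (X i.-1) t.
  apply: (le_trans (@defect_inside i _ (X i) t ux _)).
    by apply/andP; split; lra.
  by rewrite ux' normr0 add0r; apply: le_boxmass1 => //; [lra|rewrite br|lra].
apply: (le_trans (@defect_outside i _ (X i) t 1 ux tx _ _)).
- lra.
- lra.
rewrite ux' normr0 mulr0 add0r; apply: le_boxmass => //.
- lra.
- lra.
- by rewrite br.
- lra.
Qed.

(** At the top scale the recursion starts from the two zeros [X 0] and [X N] of the
    defect with respect to the chord. *)
Lemma ray_exterior_right sd : ray_ok N.+1 sd.
Proof.
have nb : bounded_gap N.+1 = false by rewrite /bounded_gap ltnn andbF.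
have hpos := h00.
have ux := defect_anchorl N.+1; have ux' := defect_anchorr N.+1.
have far := X_far N0 (leqnn N).
rewrite /anchorl /anchorr nb in ux ux'.
pose U k := `|defect N.+1 (X N + 4 * scale k)|.
pose V k := boxmass N.+1 sd k.
have bl k : boxl N.+1 sd k = X N - 2 * scale k by rewrite /boxl nb.
have br k : boxr N.+1 sd k = X N + 8 * scale k + h0 by rewrite /boxr nb.
have U0 k : 0 <= U k by exact: normr_ge0.
have V0 k : 0 <= V k by exact: boxmass_ge0.
exists (fun k => if (k <= K)%N then U k + V k else V k).
  split; first by move=> k; exact: E_ge0.
  apply: ray_sum => //.
  - move=> k kk; have s0 := scale_gt0 k.
    have s4 : 0 < 4 * scale k by rewrite mulr_gt0.
    have := defect_double_right ux' s4.
    rewrite /U scaleS (_ : 2 * (4 * scale k) = 4 * (2 * scale k)); last by ring.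
    move=> h; apply: (le_trans h); rewrite lerD2l; apply: le_boxmass1.
    + by rewrite bl; lra.
    + by rewrite br; lra.
    + lra.
  - have s0 := scale_gt0 K; have /andP[t1 t2] := top_scale.
    have := @defect_outside_right N.+1 (X N) (X 0%N) (X N + 4 * scale K) 8 ux'.
    rewrite ux normr0 mulr0 add0r => h; apply: (le_trans (h _ _ _)); try lra.
    apply: le_boxmass; [lra|rewrite bl; lra|rewrite br; lra|lra].
move=> k t kK [hs _]; rewrite /base nb /= => hn; rewrite kK.
have {}hs : X N <= t + 2 * h0 by exact: hs.
have s0 := scale_gt0 k; have sh := scale_ge k.
have tn : t - X N <= 2 * scale k - 2 * h0.
  by move: hn; rewrite ger0_norm; lra.
have [xt|tx] := leP (X N) t.
  apply: (le_trans (@defect_inside N.+1 _ (X N + 4 * scale k) t ux' _)).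
    by apply/andP; split; lra.
  by rewrite /U lerD2l; apply: le_boxmass1; [rewrite bl; lra|rewrite br; lra|lra].
apply: (le_trans (@defect_outside N.+1 _ (X N + 4 * scale k) t 1 ux' tx _ _)).
- lra.
- lra.
rewrite mul1r /U lerD2l.
by apply: le_boxmass; [lra|rewrite bl; lra|rewrite br; lra|lra].
Qed.

Lemma ray_exterior_left sd : ray_ok 0 sd.
Proof.
have nb : bounded_gap 0 = false by [].
have hpos := h00.
have ux := defect_anchorl 0; have ux' := defect_anchorr 0.
have far := X_far N0 (leqnn N).
rewrite /anchorl /anchorr nb in ux ux'.
pose U k := `|defect 0 (X 0%N - 4 * scale k)|.
pose V k := boxmass 0 sd k.
have bl k : boxl 0 sd k = X 0%N - 8 * scale k by rewrite /boxl nb.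
have br k : boxr 0 sd k = X 0%N + 2 * scale k by rewrite /boxr nb.
have U0 k : 0 <= U k by exact: normr_ge0.
have V0 k : 0 <= V k by exact: boxmass_ge0.
exists (fun k => if (k <= K)%N then U k + V k else V k).
  split; first by move=> k; exact: E_ge0.
  apply: ray_sum => //.
  - move=> k kk; have s0 := scale_gt0 k; have sh := scale_ge k.
    have s4 : 0 < 4 * scale k by rewrite mulr_gt0.
    have := defect_double_left ux s4.
    rewrite /U scaleS (_ : 2 * (4 * scale k) = 4 * (2 * scale k)); last by ring.
    move=> h; apply: (le_trans h); rewrite lerD2l; apply: le_boxmass1.
    + by rewrite bl; lra.
    + by rewrite br; lra.
    + lra.
  - have s0 := scale_gt0 K; have /andP[t1 t2] := top_scale; have sh := scale_ge K.
    have := @defect_outside 0 (X 0%N) (X N) (X 0%N - 4 * scale K) 8 ux.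
    rewrite ux' normr0 mulr0 add0r => h; apply: (le_trans (h _ _ _)); try lra.
    apply: le_boxmass; [lra|rewrite bl; lra|rewrite br; lra|lra].
move=> k t kK [_ hs]; rewrite /base nb /= => hn; rewrite kK.
have {}hs : t + 2 * h0 < X 0%N by exact: hs.
have s0 := scale_gt0 k; have sh := scale_ge k.
have tn : X 0%N - t <= 2 * scale k + 2 * h0.
  by move: hn; rewrite ler0_norm; lra.
apply: (le_trans (@defect_inside_left 0 _ (X 0%N - 4 * scale k) t ux _)).
  by apply/andP; split; lra.
by rewrite /U lerD2l; apply: le_boxmass1; [rewrite bl; lra|rewrite br; lra|lra].
Qed.

Lemma ray_exists i sd : (i <= N.+1)%N -> ray_ok i sd.
Proof.
rewrite leq_eqVlt => /orP[/eqP ->|]; first exact: ray_exterior_right.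
rewrite ltnS => iN; case: (posnP i) => [->|i0]; first exact: ray_exterior_left.
have bi : bounded_gap i by rewrite /bounded_gap i0.
by case: sd; [exact: ray_interior_left|exact: ray_interior_right].
Qed.

(** The endpoint of the own gap that lies on the side of [X j] separates [s] from
    [X j]. *)
Lemma near_base i s j r : (i <= N.+1)%N -> in_gap i s -> (j <= N)%N -> `|s - X j| <= r ->
  exists sd, `|s - base i sd| <= r.
Proof.
move=> iN1 [h1 h2] jN sj.
have case_left x : x <= s -> X j <= x -> `|s - x| <= r.
  move=> xs jx; apply: le_trans sj; rewrite !ger0_norm ?subr_ge0//; last exact: le_trans xs.
  by rewrite lerD2l lerN2.
have case_right x : s < x -> x <= X j -> `|s - x| <= r.
  move=> sx xj; apply: le_trans sj.
  rewrite !ler0_norm ?subr_le0 ?(ltW sx)// ?(le_trans (ltW sx))//.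
  by rewrite !opprB lerD2r.
rewrite /base; case bi : (bounded_gap i).
  have /andP[i0 iN] := bi.
  have [ji|ij] := ltnP j i.
    exists true; apply: case_left; first exact: h1.
    by apply: X_le; [rewrite -ltnS prednK|rewrite (leq_trans (leq_pred i))].
  by exists false; apply: case_right; [exact: h2|exact: X_le].
move/negbT: bi; rewrite /bounded_gap negb_and -leqNgt leqn0 -ltnNge => /orP[i0|Ni].
  exists true; rewrite i0; apply: case_right; last exact: X_le.
  by have := h2; rewrite (eqP i0); apply.
exists true; have -> : (i == 0%N) = false by rewrite gtn_eqF// (leq_ltn_trans _ Ni).
have iE : i = N.+1 by apply/eqP; rewrite eqn_leq iN1.
by apply: case_left; [have := h1; rewrite iE; apply|exact: X_le].
Qed.

Hypothesis CH0 : 0 < CH.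
Hypothesis HS : forall (T : finType) (kk : T -> nat) (al be : T -> R),
  (forall j, al j < be j) ->
  (forall j, be j - al j <= 13 * (2 ^+ kk j * h0)) ->
  (forall k x, (#|[set j | (kk j == k) && (al j <= x <= be j)%R]%SET| <= 8)%N) ->
  (\sum_j ((2 ^+ kk j * h0) `^ (2 - 2 * p) *
     mass H (al j) (be j) (13 * (2 ^+ kk j * h0)) `^ p)%:E
   <= CH%:E * \int[mu2]_z (H z `^ p)%:E)%E.

Lemma box_bounds i sd k : bounded_gap i ->
  X i.-1 - 2 * h0 <= boxl i sd k /\ boxr i sd k <= X i + h0.
Proof.
move=> bi; rewrite /boxl /boxr bi; case: sd; split; rewrite ?lexx//.
  by rewrite lerD2r ge_min lexx orbT.
by rewrite lerD2r le_max lexx orbT.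
Qed.

Lemma box_size i sd k : boxl i sd k < boxr i sd k /\
  boxr i sd k - boxl i sd k <= 13 * scale k.
Proof.
have s0 := scale_gt0 k; have sh := scale_ge k; have hpos := h00.
rewrite /boxl /boxr; case bi : (bounded_gap i); last by case: ifP => _; split; lra.
have [xx' _ _ _] := gap_length bi; case: sd.
  split.
    by rewrite -ltrBlDr lt_min; apply/andP; split; lra.
  rewrite lerBlDr -lerBrDr ge_min; apply/orP; left; lra.
split.
  by rewrite ltrBlDr gt_max; apply/andP; split; lra.
have : X i - 8 * scale k <= Num.max (X i - 8 * scale k) (X i.-1).
  by rewrite le_max lexx.
lra.
Qed.

(** The boxes of a bounded gap stay within the gap up to a fraction of its length,
    so that a point meets the boxes of at most two neighbouring bounded gaps, beside
    those of the two unbounded ones. *)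
Lemma card_boxes k x :
  (#|[set j : 'I_N.+2 * bool | (boxl j.1 j.2 k <= x <= boxr j.1 j.2 k)%R]%SET| <= 8)%N.
Proof.
pose P (i : 'I_N.+2) := bounded_gap i && ((X i.-1 - 2 * h0 <= x) && (x <= X i + h0)).
have [i0 Pi0] : exists i0 : 'I_N.+2, forall i, P i -> (i0 <= i <= i0.+1)%N.
  have [j0 Pj0|none] := pickP P; last by exists ord0 => i; rewrite none.
  have [i0 Pi0 imin] := arg_minnP (fun i : 'I_N.+2 => i : nat) Pj0.
  exists i0 => i Pi; rewrite imin//=; rewrite leqNgt; apply/negP => lt.
  have /andP[/andP[_ iN] /andP[h1 _]] := Pi.
  have /andP[/andP[_ _] /andP[_ h2]] := Pi0.
  have ii : (i0 < i.-1)%N by rewrite -ltnS prednK// (leq_ltn_trans _ lt).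
  have := X_far ii (leq_trans (leq_pred i) iN); have := h00; lra.
pose L : seq 'I_N.+2 := [:: ord0; ord_max; i0; inord i0.+1].
have sub : [set j : 'I_N.+2 * bool | (boxl j.1 j.2 k <= x <= boxr j.1 j.2 k)%R]%SET
    \subset finset.setX [set i in L]%SET (finset.setTfor bool).
  apply/fintype.subsetP => -[i sd]; rewrite inE /= => /andP[h1 h2].
  rewrite finset.in_setX finset.in_setT andbT !inE.
  case bi : (bounded_gap i).
    have [b1 b2] := box_bounds sd k bi.
    have /Pi0/andP[] : P i.
      by rewrite /P bi (le_trans b1)//= (le_trans h2).
    rewrite leq_eqVlt => /orP[/eqP/val_inj ->|]; first by rewrite eqxx !orbT.
    move=> lt1 lt2; have e : i = i0.+1 :> nat by apply/eqP; rewrite eqn_leq lt1 lt2.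
    by rewrite -e inord_val eqxx !orbT.
  move/negbT: bi; rewrite /bounded_gap negb_and -leqNgt leqn0 -ltnNge => /orP[/eqP i00|Ni].
    by rewrite (_ : i = ord0) ?eqxx//; exact: val_inj.
  rewrite (_ : i = ord_max) ?eqxx ?orbT//; apply: val_inj => /=.
  by apply/eqP; rewrite eqn_leq Ni -ltnS ltn_ord.
rewrite (leq_trans (subset_leq_card sub))// cardsX cardsT card_bool.
rewrite (leq_trans (n := 4 * 2))// leq_mul2r /= cardsE.
exact: (leq_trans (card_size L)).
Qed.

Variables (o : R) (M : nat).

Definition node k (n : nat) : R := o + n%:R * scale k.
Definition diff2 (g : R -> R) k n := g (node k n) - 2 * g (node k n.+1) + g (node k n.+2).

Let nodeS k n : node k n.+1 = node k n + scale k.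
Proof. by rewrite /node -natr1; ring. Qed.

Definition near_set k n := [exists j : 'I_N.+1, `|node k n + 2 * h0 - X j| <= 2 * scale k].
Definition node_gap k n := gap_index (node k n + 2 * h0).
Definition node_defect k n : R :=
  if near_set k n then `|defect (node_gap k n) (node k n)| else 0.

(** When the three nodes share their gap, the sampled function is affine there and its
    second difference is zero. Otherwise a point of the set lies between them, so that
    all three nodes are near the set, and the second difference of the sampled function
    is that of [G] plus that of the defects. *)
Lemma diff2_sample_le k n : `|diff2 sample k n| `^ p <= 4 `^ p *
  (`|diff2 G k n| `^ p + (node_defect k n `^ p +
   (2 `^ p * node_defect k n.+1 `^ p + node_defect k n.+2 `^ p))).
Proof.
have s0 := scale_gt0 k; have hpos := h00.
have rhs0 : 0 <= 4 `^ p * (`|diff2 G k n| `^ p + (node_defect k n `^ p +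
   (2 `^ p * node_defect k n.+1 `^ p + node_defect k n.+2 `^ p))).
  by rewrite !(mulr_ge0, addr_ge0)// ?powR_ge0.
have [same|ne] := eqVneq (node_gap k n) (node_gap k n.+2).
  have same1 : node_gap k n.+1 = node_gap k n.
    apply/eqP; rewrite eqn_leq {1}same !gap_index_mono// !nodeS; lra.
  rewrite /diff2 /sample -!/(node_gap _ _) same1 -same.
  have -> : gap_line (node_gap k n) (node k n) - 2 * gap_line (node_gap k n) (node k n.+1)
      + gap_line (node_gap k n) (node k n.+2) = 0 by rewrite /gap_line !nodeS; ring.
  by rewrite normr0 powR0// gt_eqF.
have [|j jN /andP[j1 j2]] := gap_index_neq _ ne; first by rewrite !nodeS; lra.
have near l : node k n <= node k l <= node k n.+2 -> near_set k l.
  move=> /andP[l1 l2]; apply/existsP; exists (Ordinal (jN : (j < N.+1)%N)) => /=.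
  move: l2 j2; rewrite !nodeS => l2 j2.
  by rewrite ler_norml; apply/andP; split; lra.
have ND l : node k n <= node k l <= node k n.+2 ->
    node_defect k l = `|defect (node_gap k l) (node k l)|.
  by move=> /near; rewrite /node_defect => ->.
have i0 : node k n <= node k n <= node k n.+2 by rewrite !nodeS; apply/andP; split; lra.
have i1 : node k n <= node k n.+1 <= node k n.+2 by rewrite !nodeS; apply/andP; split; lra.
have i2 : node k n <= node k n.+2 <= node k n.+2 by rewrite !nodeS; apply/andP; split; lra.
rewrite (ND _ i0) (ND _ i1) (ND _ i2).
have -> : 2 `^ p * `|defect (node_gap k n.+1) (node k n.+1)| `^ p =
    `|2 * defect (node_gap k n.+1) (node k n.+1)| `^ p.
  by rewrite normrM powRM// ger0_norm.
pose v (j : 'I_4) := nth 0 [:: diff2 G k n; defect (node_gap k n) (node k n);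
  - (2 * defect (node_gap k n.+1) (node k n.+1)); defect (node_gap k n.+2) (node k n.+2)] j.
have := @powR_sum_le R _ v 4 p p0.
rewrite (leq_trans (max_card _)) ?card_ord// => /(_ isT).
rewrite !big_ord_recl !big_ord0 /v /= !addr0 normrN; apply: le_trans.
rewrite le_eqVlt; apply/orP; left; apply/eqP; congr (`|_| `^ _).
by rewrite /diff2 /sample /defect /node_gap; ring.
Qed.

Lemma diff2_trace_le k n :
  `|diff2 G k n| <= 2 * C0 * m (node k n) (node k n.+2 + h0) (13 * scale k).
Proof.
have s0 := scale_gt0 k.
have n1 : node k n < node k n.+1 by rewrite nodeS ltrDl.
have n2 : node k n.+1 < node k n.+2 by rewrite [ltRHS]nodeS ltrDl.
have := TP n1 n2.
have -> : (node k n.+2 - node k n.+1) / (node k n.+2 - node k n) = 2^-1.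
  by rewrite !nodeS; field; rewrite !gt_eqF//; lra.
have -> : (node k n.+1 - node k n) / (node k n.+2 - node k n) = 2^-1.
  by rewrite !nodeS; field; rewrite !gt_eqF//; lra.
have -> : diff2 G k n = - 2 * (G (node k n.+1) - (2^-1 * G (node k n) + 2^-1 * G (node k n.+2))).
  by rewrite /diff2; field.
move=> h; rewrite normrM normrN (ger0_norm (ler0n _ 2)) -mulrA ler_pM2l//.
apply: (le_trans h); rewrite ler_wpM2l ?(ltW C00)//.
apply: (@mass_le R H _ _ _ _ _ _ LH H0); rewrite ?lexx// !nodeS; lra.
Qed.

Definition trace_const : R := 4 `^ p * ((2 * C0) `^ p * CH +
  (2 + 2 `^ p) * (5 * ray_const * ((9 * C0) `^ p * CH))).

Lemma trace_const_gt0 : 0 < trace_const.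
Proof.
have r0 : 0 < ray_const by rewrite mulr_gt0 ?powR_gt0// addr_gt0.
have c1 := C00; have c2 := CH0.
by rewrite !(mulr_gt0, addr_gt0, powR_gt0).
Qed.

(** The second differences of [G] and, through [ray_exists], the defects near the
    set are bounded by masses of boxes, to which the Hardy inequality [HS] applies. *)
Lemma trace_inequality :
  ((\sum_(k < K.+1) \sum_(n < M) weight k * `|diff2 sample k n| `^ p)%:E
   <= trace_const%:E * \int[mu2]_z (H z `^ p)%:E)%E.
Proof.
have I0 : (0 <= \int[mu2]_z (H z `^ p)%:E)%E.
  by apply: integral_ge0 => z _; rewrite lee_fin powR_ge0.
case IE : (\int[mu2]_z (H z `^ p)%:E)%E I0 => [I| |//] I0; last first.
  by rewrite mulry gtr0_sg ?mul1e ?leey// trace_const_gt0.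
move: I0; rewrite lee_fin -EFinM lee_fin => I0.
have HSr (T : finType) (kk : T -> nat) (al be : T -> R) :
    (forall j, al j < be j) -> (forall j, be j - al j <= 13 * scale (kk j)) ->
    (forall k x, (#|[set j | (kk j == k) && (al j <= x <= be j)%R]%SET| <= 8)%N) ->
    \sum_j weight (kk j) * m (al j) (be j) (13 * scale (kk j)) `^ p <= CH * I.
  move=> h1 h2 h3; have := HS h1 h2 h3.
  by rewrite IE sumEFin -EFinM lee_fin.
have claimA : \sum_(j : 'I_N.+2 * bool) \sum_(k < K.+1) weight k * boxmass j.1 j.2 k `^ p
    <= (9 * C0) `^ p * CH * I.
  rewrite exchange_big pair_big_dep/= -mulrA.
  have := @HSr ('I_K.+1 * ('I_N.+2 * bool))%type (fun j => j.1)
    (fun j => boxl j.2.1 j.2.2 j.1) (fun j => boxr j.2.1 j.2.2 j.1).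
  move=> /(_ (fun j => (box_size j.2.1 j.2.2 j.1).1) (fun j => (box_size j.2.1 j.2.2 j.1).2)).
  move=> h; apply: (@le_trans _ _ ((9 * C0) `^ p * (\sum_(j : 'I_K.+1 * ('I_N.+2 * bool))
      weight j.1 * m (boxl j.2.1 j.2.2 j.1) (boxr j.2.1 j.2.2 j.1) (13 * scale j.1) `^ p))).
    rewrite mulr_sumr; apply: ler_sum => j _; rewrite /boxmass [9 * _]mulrA.
    by rewrite powRM ?mulr_ge0 ?(ltW C00)// mulrCA.
  rewrite ler_wpM2l ?powR_ge0//; apply: h => k x.
  apply: leq_trans (card_boxes k x).
  have inj : {in [set j : 'I_K.+1 * ('I_N.+2 * bool) | (j.1 == k :> nat) &&
      (boxl j.2.1 j.2.2 j.1 <= x <= boxr j.2.1 j.2.2 j.1)%R]%SET &, injective snd}.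
    move=> [a b] [a' b'] /=; rewrite !inE /= => /andP[/eqP h1 _] /andP[/eqP h2 _] ->.
    by congr pair; apply: val_inj; rewrite /= h1 h2.
  rewrite -(card_in_imset inj); apply: subset_leq_card.
  apply/fintype.subsetP => _ /imsetP[[a b] + ->]; rewrite inE /= => /andP[/eqP ak h1].
  by rewrite inE /= -ak.
have claimB : \sum_(k < K.+1) \sum_(n < M) weight k * `|diff2 G k n| `^ p
    <= (2 * C0) `^ p * CH * I.
  rewrite pair_big_dep/= -mulrA.
  have := @HSr ('I_K.+1 * 'I_M)%type (fun j => j.1)
    (fun j => node j.1 j.2) (fun j => node j.1 (j.2 : nat).+2 + h0).
  move=> h; apply: (@le_trans _ _ ((2 * C0) `^ p * (\sum_(j : 'I_K.+1 * 'I_M)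
      weight j.1 * m (node j.1 j.2) (node j.1 (j.2 : nat).+2 + h0) (13 * scale j.1) `^ p))).
    rewrite mulr_sumr; apply: ler_sum => j _.
    rewrite mulrCA ler_wpM2l ?weight_ge0// -powRM ?mulr_ge0 ?(ltW C00)//.
    by apply: ler_powR_norm; [exact: ltW|by []|exact: diff2_trace_le].
  rewrite ler_wpM2l ?powR_ge0//; apply: h => [j|j|k x].
  - by have := scale_gt0 j.1; have := h00; rewrite !nodeS; lra.
  - by have := scale_gt0 j.1; have := scale_ge j.1; rewrite !nodeS; lra.
  - have c := @card_grid_le R M 2 o (scale k) (x - scale k) (scale_gt0 k).
    apply: leq_trans (leq_trans c _) => //.
    have inj : {in [set j : 'I_K.+1 * 'I_M | (j.1 == k :> nat) &&
        (node j.1 j.2 <= x <= node j.1 (j.2 : nat).+2 + h0)%R]%SET &, injective snd}.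
      move=> [a b] [a' b'] /=; rewrite !inE /= => /andP[/eqP h1 _] /andP[/eqP h2 _] ->.
      by congr pair; apply: val_inj; rewrite /= h1 h2.
    rewrite -(card_in_imset inj); apply: subset_leq_card.
    apply/fintype.subsetP => _ /imsetP[[a b] + ->]; rewrite inE /= => /andP[/eqP ak h1].
    move: h1; rewrite inE /= ak !nodeS /node => /andP[h1 h2].
    have := scale_gt0 k; have := scale_ge k.
    by rewrite ler_norml => *; apply/andP; split; lra.
(* A given base point is close to at most five nodes of each scale. *)
have /choice[E HE] : forall j : 'I_N.+2 * bool, exists E : nat -> R,
    [/\ forall k, 0 <= E k,
      \sum_(k < K.+1) weight k * E k `^ p
        <= ray_const * \sum_(k < K.+1) weight k * boxmass j.1 j.2 k `^ p &
      forall k t, (k <= K)%N -> in_gap j.1 (t + 2 * h0) ->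
      `|t + 2 * h0 - base j.1 j.2| <= 2 * scale k -> `|defect j.1 t| <= E k].
  move=> [i sd]; have [|E [E0 ES] EN] := @ray_exists i sd; first by rewrite -ltnS.
  by exists E; split.
have claimC M' : \sum_(k < K.+1) \sum_(n < M') weight k * node_defect k n `^ p
    <= 5 * ray_const * ((9 * C0) `^ p * CH * I).
  have r0 : 0 < ray_const by rewrite mulr_gt0 ?powR_gt0// addr_gt0.
  apply: (@le_trans _ _ (5 * \sum_(j : 'I_N.+2 * bool) \sum_(k < K.+1) weight k * E j k `^ p)); last first.
    rewrite -mulrA ler_pM2l//; apply: le_trans (ler_wpM2l (ltW r0) claimA).
    by rewrite mulr_sumr; apply: ler_sum => j _; have [] := HE j.
  rewrite [in leRHS]exchange_big/= mulr_sumr; apply: ler_sum => k _.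
  rewrite -!mulr_sumr mulrCA ler_wpM2l ?weight_ge0//.
  pose A n (j : 'I_N.+2 * bool) := `|node k n + 2 * h0 - base j.1 j.2| <= 2 * scale k.
  apply: (@le_trans _ _ (\sum_(n < M') \sum_(j : 'I_N.+2 * bool | A n j) E j k `^ p)).
    apply: ler_sum => n _; rewrite /node_defect; case: ifPn => [/existsP[j hj]|_]; last first.
      by rewrite powR0 ?gt_eqF// sumr_ge0// => j _; exact: powR_ge0.
    have [sd hsd] := near_base (gap_index_le _) (gap_indexP _) (ltn_ord j : (j <= N)%N) hj.
    pose i : 'I_N.+2 := Ordinal (gap_index_le (node k n + 2 * h0) : (_ < N.+2)%N).
    rewrite (bigD1 (i, sd))//=; apply: ler_wpDr.
      by apply: sumr_ge0 => *; exact: powR_ge0.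
    have [E0 _ EN] := HE (i, sd).
    apply: ler_powR_norm; [exact: ltW|by []|].
    by apply: EN; [rewrite -ltnS|exact: gap_indexP|].
  under eq_bigr do rewrite big_mkcond.
  rewrite exchange_big/= mulr_sumr; apply: ler_sum => j _.
  rewrite -big_mkcond/= sumr_const -[leLHS]mulr_natl ler_wpM2r ?powR_ge0//.
  rewrite ler_nat.
  have := @card_grid_le R M' 2 o (scale k) (base j.1 j.2 - 2 * h0) (scale_gt0 k).
  apply: leq_trans; rewrite -cardsE subset_leq_card//; apply/fintype.subsetP => n.
  rewrite !inE /A /node => h; apply: le_trans h.
  by rewrite le_eqVlt; apply/orP; left; apply/eqP; congr `|_|; ring.
apply: (@le_trans _ _ (4 `^ p * (\sum_(k < K.+1) \sum_(n < M) weight k * `|diff2 G k n| `^ p +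
   (2 + 2 `^ p) * \sum_(k < K.+1) \sum_(n < M.+2) weight k * node_defect k n `^ p))).
  rewrite mulrDr [X in _ <= X + _]mulr_sumr [in X in _ <= _ + X]mulrCA mulr_sumr mulr_sumr -big_split/=.
  apply: ler_sum => k _; rewrite -!mulr_sumr.
  rewrite [leRHS](_ : _ = weight k * (4 `^ p * (\sum_(n < M) `|diff2 G k n| `^ p +
    (2 + 2 `^ p) * \sum_(n < M.+2) node_defect k n `^ p))); last by ring.
  rewrite ler_wpM2l ?weight_ge0//.
  apply: (@le_trans _ _ (\sum_(n < M) 4 `^ p * (`|diff2 G k n| `^ p + (node_defect k n `^ p +
      (2 `^ p * node_defect k n.+1 `^ p + node_defect k n.+2 `^ p))))).
    by apply: ler_sum => n _; exact: diff2_sample_le.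
  rewrite -mulr_sumr ler_wpM2l ?powR_ge0// !big_split/= lerD2l -mulr_sumr.
  set S := \sum_(n < M.+2) _.
  have ndp n : 0 <= node_defect k n `^ p by exact: powR_ge0.
  have S0 : \sum_(n < M) node_defect k n `^ p <= S.
    by rewrite /S !big_ord_recr/= -addrA lerDl addr_ge0.
  have S1 : \sum_(n < M) node_defect k n.+1 `^ p <= S.
    rewrite /S big_ord_recl big_ord_recr/=; apply: ler_wpDl => //.
    by apply: ler_wpDr.
  have S2 : \sum_(n < M) node_defect k n.+2 `^ p <= S.
    rewrite /S big_ord_recl big_ord_recl/=; apply: ler_wpDl => //.
    by apply: ler_wpDl.
  have := ler_wpM2l (powR_ge0 2 p) S1; lra.
rewrite /trace_const -[leRHS]mulrA ler_wpM2l ?powR_ge0//.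
rewrite [leRHS](_ : _ = (2 * C0) `^ p * CH * I +
  (2 + 2 `^ p) * (5 * ray_const * ((9 * C0) `^ p * CH * I))); last by ring.
by apply: lerD => //; rewrite ler_wpM2l ?claimC.
Qed.

End TraceInequality.

(** The constant depends on [p] only, through [recursion_sum] and [hardy_sum]. *)
Theorem trace_bound (R : realType) (p : R) : 1 < p < 2 ->
  exists2 C : R, 0 < C & forall (X Y : nat -> R) (N K : nat) (h0 : R),
  (0 < N)%N -> 0 < h0 ->
  (forall i, (i < N)%N -> 16 * h0 <= X i.+1 - X i) ->
  X N - X 0%N <= scale h0 K <= 2 * (X N - X 0%N) ->
  forall F g20 g11 : R * R -> R, continuous F ->
  is_weak_partial (2, 0)%N F g20 -> is_weak_partial (1, 1)%N F g11 ->
  (forall i, Y i = F (X i, 0)) -> forall (o : R) (M : nat),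
  ((\sum_(k < K.+1) \sum_(n < M)
     weight h0 p k * `|diff2 h0 o (sample X Y N h0) k n| `^ p)%:E
   <= C%:E * \int[lebesgue2]_z ((`|g20 z| + `|g11 z|) `^ p)%:E)%E.
Proof.
move=> p12; have /andP[p1 _] := p12.
have [CR CR0 RS] := recursion_sum p12.
have A1 : (1 : R) <= 13 by rewrite ler1n.
have [CH CH0 HS] := @hardy_sum R p 13 8 p1 A1.
have [C0 C00 TP] := three_point R.
exists (trace_const C0 p CR CH); first exact: trace_const_gt0.
move=> X Y N K h0 N0 h00 gap topK F g20 g11 cF w20 w11 YF o M.
have [_ L20 _] := w20; have [_ L11 _] := w11.
apply: (@trace_inequality R X Y N h0 K N0 h00 gap topK (fun t => F (t, 0))
  (fun z => `|g20 z| + `|g11 z|) C0 p) => //.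
- exact: L1loc_normD.
- by move=> a c b ac cb; apply: (TP F) => //; rewrite ac.
- by move=> T kk al be *; apply: HS => //; exact: L1loc_normD.
Qed.

(** * Cubic splines *)

Section Splines.
Context {R : realType}.
Implicit Types (s t x : R) (a c : nat -> R).

Lemma is_derive_quadratic (f : R -> R) x d :
  (forall h, `|f (h + x) - f x - h * d| <= h ^+ 2) -> is_derive x (1 : R) f d.
Proof.
move=> fq; have cv : (fun h : R => h^-1 *: (f (h *: (1 : R) + x) - f x)) @ 0^' --> d.
  apply/cvgrPdist_le => e e0; near=> h.
  have h0 : h != 0 by near: h; exact: nbhs_dnbhs_neq.
  have he : `|h| <= e.
    by near: h; apply: dnbhs0_le.
  apply: le_trans he; rewrite -(ler_pM2l (_ : 0 < `|h|)) ?normr_gt0//.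
  rewrite distrC -!normrM -expr2 (ger0_norm (sqr_ge0 h)).
  apply: le_trans (fq h); rewrite le_eqVlt; apply/orP; left; apply/eqP.
  by congr `|_|; rewrite /GRing.scale/= mulr1 mulrBr mulVKf.
split; first by apply/cvg_ex; exists d.
exact: cvg_lim cv.
Unshelve. all: by end_near.
Qed.

Definition pos t : R := Num.max t 0.

Lemma posE t : 0 <= t -> pos t = t. Proof. by move=> t0; exact/max_idPl. Qed.
Lemma pos_le0 t : t <= 0 -> pos t = 0. Proof. by move=> t0; exact/max_idPr. Qed.

Lemma posP t : (0 <= t /\ pos t = t) \/ (t <= 0 /\ pos t = 0).
Proof.
have [t0|/ltW t0] := leP 0 t; [left|right]; first by rewrite posE.
by rewrite pos_le0.
Qed.

Lemma pos_double t : pos (2 * t) = 2 * pos t.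
Proof. by rewrite /pos maxr_pMr// mulr0. Qed.

Lemma is_derive_pos2 x : is_derive x (1 : R) (fun t => pos t ^+ 2) (2 * pos x).
Proof.
apply: is_derive_quadratic => h.
by rewrite ler_norml; have [[? ->]|[? ->]] := posP (h + x); have [[? ->]|[? ->]] := posP x;
  apply/andP; split; nra.
Qed.

Lemma is_derive_pos3 x : is_derive x (1 : R) (fun t => pos t ^+ 3) (3 * pos x ^+ 2).
Proof.
have -> : (fun t => pos t ^+ 3) = (id : R -> R) * (fun t => pos t ^+ 2).
  apply/funext => t; rewrite /GRing.mul/=.
  by have [[_ ->]|[_ ->]] := posP t; rewrite exprS// !(mul0r, expr0n, mulr0).
have h := is_deriveM (is_derive_id x (1 : R)) (is_derive_pos2 x).
apply: (is_derive_eq h); rewrite /GRing.scale/=.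
by have [[_ ->]|[_ ->]] := posP x; ring.
Qed.

Lemma continuous_pos : continuous pos.
Proof.
by move=> x; apply: (@continuous_max _ _ (id : R -> R) (cst 0)) => //; exact: cvg_cst.
Qed.

(** The spline that rises from [0] at [-2] to [1] at [1]. The cubic B-spline and the
    cut-off are differences of two of its translates. *)
Definition step t := (pos (t + 2) ^+ 3 - 3 * pos (t + 1) ^+ 3 + 3 * pos (t + 0) ^+ 3
  - pos (t + -1) ^+ 3) / 6.
(** First and second derivatives of [step]. *)
Definition step1 t := (pos (t + 2) ^+ 2 - 3 * pos (t + 1) ^+ 2 + 3 * pos (t + 0) ^+ 2
  - pos (t + -1) ^+ 2) / 2.
Definition step2 t := pos (t + 2) - 3 * pos (t + 1) + 3 * pos (t + 0) - pos (t + -1).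

Lemma is_derive_shift (f df : R -> R) b x : (forall x, is_derive x (1 : R) f (df x)) ->
  is_derive x (1 : R) (fun x => f (x + b)) (df (x + b)).
Proof.
move=> fE; have h1 := is_derive_affine 1 b x.
have h : is_derive x (1 : R) (f \o (fun x => 1 * x + b)) (df (1 * x + b) * 1).
  exact: is_derive1_comp.
have e : (fun x => f (x + b)) = f \o (fun x => 1 * x + b).
  by apply/funext => y /=; rewrite mul1r.
by rewrite e; apply: (is_derive_eq h); rewrite mul1r mulr1.
Qed.

Lemma is_derive_diff4 (f df : R -> R) q x : (forall x, is_derive x (1 : R) f (df x)) ->
  is_derive x (1 : R) (fun t => (f (t + 2) - 3 * f (t + 1) + 3 * f (t + 0) - f (t + -1)) / q)
   ((df (x + 2) - 3 * df (x + 1) + 3 * df (x + 0) - df (x + -1)) / q).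
Proof.
move=> fE; have h b := is_derive_shift b x fE.
have := is_deriveZ q^-1 (is_deriveB (is_deriveD (is_deriveB (h 2) (is_deriveZ 3 (h 1)))
  (is_deriveZ 3 (h 0))) (h (-1))).
have -> : (fun t => (f (t + 2) - 3 * f (t + 1) + 3 * f (t + 0) - f (t + -1)) / q) =
  q^-1 *: ((fun t => f (t + 2)) - 3 *: (fun t => f (t + 1)) + 3 *: (fun t => f (t + 0)) - (fun t => f (t + -1))).
  by apply/funext => t /=; rewrite mulrC.
by move=> H; apply: (is_derive_eq H); rewrite /GRing.scale/= mulrC.
Qed.

Lemma is_derive_step x : is_derive x (1 : R) step (step1 x).
Proof.
apply: (is_derive_eq (is_derive_diff4 6 x is_derive_pos3)).
by rewrite /step1; field.
Qed.

Lemma is_derive_step1 x : is_derive x (1 : R) step1 (step2 x).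
Proof.
apply: (is_derive_eq (is_derive_diff4 2 x is_derive_pos2)).
by rewrite /step2; field.
Qed.

Lemma continuous_step2 : continuous step2.
Proof.
move=> x; have h b : {for x, continuous (fun t => pos (t + b))}.
  apply: (@continuous_comp _ _ _ (fun t => t + b) pos); last exact: continuous_pos.
  by apply: cvgD => //; exact: cvg_cst.
apply: cvgB (h (-1)); apply: cvgD; last by apply: cvgM (h 0); exact: cvg_cst.
by apply: cvgB (h 2) _; apply: cvgM (h 1); exact: cvg_cst.
Qed.

Lemma step_left t : t <= -2 -> [/\ step t = 0, step1 t = 0 & step2 t = 0].
Proof.
move=> t2; rewrite /step /step1 /step2 !pos_le0; try lra.
by rewrite !expr0n/=; split; lra.
Qed.

Lemma step_right t : 1 <= t -> [/\ step t = 1, step1 t = 0 & step2 t = 0].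
Proof.
move=> t1; rewrite /step /step1 /step2 !posE; try lra.
by split; field.
Qed.

Lemma step_bound t : [/\ `|step t| <= 9, `|step1 t| <= 12 & `|step2 t| <= 4].
Proof.
have [t2|t2] := leP t (-2).
  by have [-> -> ->] := step_left t2; rewrite normr0; split; rewrite ler0n.
have [t1|t1] := leP 1 t.
  by have [-> -> ->] := step_right t1; rewrite normr0 normr1; split; rewrite ?ler0n ?ler1n.
have h b : b <= 2 -> 0 <= pos (t + b) <= 1 + b \/ pos (t + b) = 0.
  by move=> b2; have [[? ->]|[? ->]] := posP (t + b); [left|right] => //; apply/andP; split; lra.
have h2 : 0 <= pos (t + 2) <= 3.
  by have [|/andP[? ?]|->] := h 2 => //; [apply/andP; split; lra|rewrite lexx ler0n].
have h1 : 0 <= pos (t + 1) <= 2.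
  by have [|/andP[? ?]|->] := h 1; [rewrite ler1n|apply/andP; split; lra|rewrite lexx ler0n].
have h0 : 0 <= pos (t + 0) <= 1.
  by have [|/andP[? ?]|->] := h 0; [rewrite ler0n|apply/andP; split; lra|rewrite lexx ler01].
rewrite /step /step1 /step2 (@pos_le0 (t + -1)); last lra.
have sq (m : nat) (y : R) n : 0 <= y <= m%:R -> 0 <= y ^+ n <= (m ^ n)%:R.
  by move=> /andP[y0 ym]; rewrite exprn_ge0//= natrX lerXn2r// ?nnegrE.
have c2 := sq 3%N _ 3%N h2; have c1 := sq 2%N _ 3%N h1; have c0 := sq 1%N _ 3%N h0.
have d2 := sq 3%N _ 2%N h2; have d1 := sq 2%N _ 2%N h1; have d0 := sq 1%N _ 2%N h0.
split; rewrite ?expr0n/=.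
- move: c2 c1 c0 => /andP[? ?] /andP[? ?] /andP[? ?]; rewrite ler_norml; apply/andP; split; lra.
- move: d2 d1 d0 => /andP[? ?] /andP[? ?] /andP[? ?]; rewrite ler_norml; apply/andP; split; lra.
rewrite ler_norml posE; last lra.
have [[? ->]|[? ->]] := posP (t + 1);
  have [[? ->]|[? ->]] := posP (t + 0); apply/andP; split; lra.
Qed.

Definition bspline t := step t - step (t + -1).
Definition bspline1 t := step1 t - step1 (t + -1).
Definition bspline2 t := step2 t - step2 (t + -1).
Definition hat t := pos (t + 1) - 2 * pos t + pos (t - 1).

(** Equal to [1] on [-2, 2] and to [0] outside of [-5, 5]. *)
Definition cutoff t := step (t + 3) - step (t + -4).
Definition cutoff1 t := step1 (t + 3) - step1 (t + -4).
Definition cutoff2 t := step2 (t + 3) - step2 (t + -4).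

Lemma is_derive_diff2 (f df : R -> R) b b' x : (forall x, is_derive x (1 : R) f (df x)) ->
  is_derive x (1 : R) (fun t => f (t + b) - f (t + b')) (df (x + b) - df (x + b')).
Proof. by move=> fE; apply: is_deriveB; exact: is_derive_shift. Qed.

Lemma is_derive_bspline x : is_derive x (1 : R) bspline (bspline1 x).
Proof. by apply: is_deriveB; [exact: is_derive_step|exact: (is_derive_shift _ _ is_derive_step)]. Qed.

Lemma is_derive_bspline1 x : is_derive x (1 : R) bspline1 (bspline2 x).
Proof. by apply: is_deriveB; [exact: is_derive_step1|exact: (is_derive_shift _ _ is_derive_step1)]. Qed.

Lemma is_derive_cutoff x : is_derive x (1 : R) cutoff (cutoff1 x).
Proof. exact: is_derive_diff2 is_derive_step. Qed.

Lemma is_derive_cutoff1 x : is_derive x (1 : R) cutoff1 (cutoff2 x).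
Proof. exact: is_derive_diff2 is_derive_step1. Qed.

Lemma continuous_step2_shift b : continuous (fun t => step2 (t + b)).
Proof.
move=> x; apply: (@continuous_comp _ _ _ (fun t => t + b) step2).
  by apply: cvgD => //; exact: cvg_cst.
exact: continuous_step2.
Qed.

Lemma continuous_bspline2 : continuous bspline2.
Proof.
by move=> x; apply: cvgB; [exact: continuous_step2|exact: continuous_step2_shift].
Qed.

Lemma continuous_cutoff2 : continuous cutoff2.
Proof. by move=> x; apply: cvgB; exact: continuous_step2_shift. Qed.

Lemma bspline_off t : 2 <= `|t| -> [/\ bspline t = 0, bspline1 t = 0 & bspline2 t = 0].
Proof.
rewrite /bspline /bspline1 /bspline2 ler_normr => /orP[t2|t2].
  have [|-> -> ->] := @step_right t; first lra.
  have [|-> -> ->] := @step_right (t + -1); first lra.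
  by rewrite !subrr.
have [|-> -> ->] := @step_left t; first lra.
have [|-> -> ->] := @step_left (t + -1); first lra.
by rewrite !subrr.
Qed.

Lemma bspline_bound t : [/\ `|bspline t| <= 18, `|bspline1 t| <= 24 & `|bspline2 t| <= 8].
Proof.
have [a1 a2 a3] := step_bound t; have [b1 b2 b3] := step_bound (t + -1).
split; apply: (le_trans (ler_normB _ _)); lra.
Qed.

Lemma cutoff_in t : `|t| <= 2 -> [/\ cutoff t = 1, cutoff1 t = 0 & cutoff2 t = 0].
Proof.
rewrite /cutoff /cutoff1 /cutoff2 ler_norml => /andP[t1 t2].
have [|-> -> ->] := @step_right (t + 3); first lra.
have [|-> -> ->] := @step_left (t + -4); first lra.
by rewrite !subr0.
Qed.

Lemma cutoff_off t : 5 <= `|t| -> [/\ cutoff t = 0, cutoff1 t = 0 & cutoff2 t = 0].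
Proof.
rewrite /cutoff /cutoff1 /cutoff2 ler_normr => /orP[t2|t2].
  have [|-> -> ->] := @step_right (t + 3); first lra.
  have [|-> -> ->] := @step_right (t + -4); first lra.
  by rewrite !subrr.
have [|-> -> ->] := @step_left (t + 3); first lra.
have [|-> -> ->] := @step_left (t + -4); first lra.
by rewrite !subrr.
Qed.

Lemma cutoff_bound t : [/\ `|cutoff t| <= 18, `|cutoff1 t| <= 24 & `|cutoff2 t| <= 8].
Proof.
have [a1 a2 a3] := step_bound (t + 3); have [b1 b2 b3] := step_bound (t + -4).
split; apply: (le_trans (ler_normB _ _)); lra.
Qed.

Lemma hat_off t : 1 <= `|t| -> hat t = 0.
Proof.
rewrite /hat ler_normr => /orP[t2|t2].
  by rewrite !posE; lra.
by rewrite !pos_le0; lra.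
Qed.

Lemma hat_bound t : `|hat t| <= 1.
Proof.
rewrite /hat ler_norml; have [[? ->]|[? ->]] := posP (t + 1); have [[? ->]|[? ->]] := posP t;
  have [[? ->]|[? ->]] := posP (t - 1); apply/andP; split; lra.
Qed.

(** The second derivative of the cubic B-spline is the second difference of the
    piecewise linear one. *)
Lemma bspline2E t : bspline2 t = hat (t + 1) - 2 * hat t + hat (t - 1).
Proof.
rewrite /bspline2 /step2 /hat.
have e1 : t + -1 + 2 = t + 1 by ring.
have e2 : t + -1 + 1 = t by ring.
have e3 : t + -1 + 0 = t - 1 by ring.
have e5 : t + 1 + 1 = t + 2 by ring.
have e6 : t + 1 - 1 = t by ring.
rewrite e1 e2 e3 e5 e6 addr0; ring.
Qed.

(** The fourth difference of [pos t ^+ 3] with step [1] is a binomial average of the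
    fourth differences with step [1/2]. *)
Lemma two_scale t : bspline t = (bspline (2 * t - 2) + 4 * bspline (2 * t - 1) +
  6 * bspline (2 * t) + 4 * bspline (2 * t + 1) + bspline (2 * t + 2)) / 8.
Proof.
have P3 u : pos (2 * u) ^+ 3 = 8 * pos u ^+ 3 by rewrite pos_double exprMn; ring.
have B u : bspline u = (pos (u + 2) ^+ 3 - 4 * pos (u + 1) ^+ 3 + 6 * pos u ^+ 3
    - 4 * pos (u - 1) ^+ 3 + pos (u - 2) ^+ 3) / 6.
  rewrite /bspline /step.
  have e1 : u + -1 + 2 = u + 1 by ring.
  have e2 : u + -1 + 1 = u by ring.
  have e3 : u + -1 + 0 = u - 1 by ring.
  have e4 : u + -1 + -1 = u - 2 by ring.
  by rewrite e1 e2 e3 e4 addr0; ring.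
have := P3 (t + 2); have := P3 (t + 1); have := P3 t; have := P3 (t - 1); have := P3 (t - 2).
rewrite !B.
have -> : 2 * (t + 2) = 2 * t + 4 by ring.
have -> : 2 * (t + 1) = 2 * t + 2 by ring.
have -> : 2 * (t - 1) = 2 * t - 2 by ring.
have -> : 2 * (t - 2) = 2 * t - 4 by ring.
have -> : 2 * t - 2 + 2 = 2 * t by ring.
have -> : 2 * t - 2 + 1 = 2 * t - 1 by ring.
have -> : 2 * t - 2 - 1 = 2 * t - 3 by ring.
have -> : 2 * t - 2 - 2 = 2 * t - 4 by ring.
have -> : 2 * t - 1 + 2 = 2 * t + 1 by ring.
have -> : 2 * t - 1 + 1 = 2 * t by ring.
have -> : 2 * t - 1 - 1 = 2 * t - 2 by ring.
have -> : 2 * t - 1 - 2 = 2 * t - 3 by ring.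
have -> : 2 * t + 1 + 2 = 2 * t + 3 by ring.
have -> : 2 * t + 1 + 1 = 2 * t + 2 by ring.
have -> : 2 * t + 1 - 1 = 2 * t by ring.
have -> : 2 * t + 1 - 2 = 2 * t - 1 by ring.
have -> : 2 * t + 2 + 2 = 2 * t + 4 by ring.
have -> : 2 * t + 2 + 1 = 2 * t + 3 by ring.
have -> : 2 * t + 2 - 1 = 2 * t + 1 by ring.
have -> : 2 * t + 2 - 2 = 2 * t by ring.
by move=> h1 h2 h3 h4 h5; lra.
Qed.

(** Summation by parts: [bspline] is the difference of [step], which is itself the
    difference of [step0]. The sum telescopes to boundary terms, in which the cubes
    add up to an affine function. *)
Lemma bspline_affine (c0 c1 s : R) M : 1 <= s <= M%:R - 2 ->
  \sum_(n < M) (c0 + c1 * n%:R) * bspline (s - n%:R) = c0 + c1 * s.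
Proof.
pose step0 t := (pos (t + 2) ^+ 3 - 2 * pos (t + 1) ^+ 3 + pos t ^+ 3) / 6.
have step0E t : step t = step0 t - step0 (t - 1).
  rewrite /step0 /step.
  have e1 : t - 1 + 2 = t + 1 by ring.
  have e2 : t - 1 + 1 = t by ring.
  by rewrite e1 e2 addr0; field.
have E m : \sum_(n < m) (c0 + c1 * n%:R) * bspline (s - n%:R) =
    c0 * (step s - step (s - m%:R)) +
    c1 * (step0 (s - 1) - step0 (s - m%:R) - (m%:R - 1) * step (s - m%:R)).
  elim: m => [|m IH].
    by rewrite big_ord0 subr0 subrr sub0r mulN1r (step0E s); ring.
  rewrite big_ord_recr /= IH /bspline -(natr1 m) (step0E (s - m%:R)).
  have -> : s - (m%:R + 1) = s - m%:R - 1 by ring.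
  ring.
move=> /andP[s1 sM]; rewrite E.
have [|-> _ _] := @step_right s; first exact: s1.
have [|-> _ _] := @step_left (s - M%:R); first lra.
have -> : step0 (s - 1) = s by rewrite /step0 !posE; [field|lra..].
have -> : step0 (s - M%:R) = 0 by rewrite /step0 !pos_le0; [rewrite !expr0n/=; field|lra..].
by ring.
Qed.

Definition sdiff2 a n := a n - 2 * a n.+1 + a n.+2.

(** Summation by parts twice, starting from [bspline2E]; [V] collects the boundary
    terms. *)
Lemma sum_bspline2 a s M : a 0%N = 0 -> a 1%N = 0 -> a M = 0 -> a M.+1 = 0 ->
  \sum_(n < M) a n * bspline2 (s - n%:R) =
  \sum_(n < M) sdiff2 a n * hat (s - n.+1%:R).
Proof.
move=> a0 a1 aM aM1.
pose V n := (2 * a n - a n.+1) * hat (s - n%:R) - a n * hat (s - n%:R + 1).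
have E m : \sum_(n < m) a n * bspline2 (s - n%:R) =
    \sum_(n < m) sdiff2 a n * hat (s - n.+1%:R) + V m.
  elim: m => [|m IH]; first by rewrite !big_ord0 /V a0 a1; ring.
  rewrite !big_ord_recr /= IH bspline2E /sdiff2 /V -(natr1 m).
  have -> : s - (m%:R + 1) = s - m%:R - 1 by ring.
  have -> : s - m%:R - 1 + 1 = s - m%:R by ring.
  ring.
by rewrite E /V aM aM1; ring.
Qed.

Lemma sum_even (h : nat -> R) M : \sum_(n < M.*2) (if odd n then 0 else h n) =
  \sum_(n < M) h n.*2.
Proof.
elim: M => [|M IH]; first by rewrite !big_ord0.
by rewrite doubleS !big_ord_recr /= IH odd_double /= addr0.
Qed.

Lemma sum_trunc (h : nat -> R) m M : (m <= M)%N -> (forall n, (m <= n)%N -> h n = 0) ->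
  \sum_(n < M) h n = \sum_(n < m) h n.
Proof.
move=> mM h0; rewrite (big_ord_widen _ h mM) [RHS]big_mkcond /=.
by apply: eq_bigr => n _; case: ltnP => // /h0.
Qed.

(** Discarding every other coefficient changes a spline only by second differences.
    After [two_scale], the coefficient of an even spline is compared with
    the average [(1, 6, 1) / 8] of its even neighbours, and that of an odd spline with
    the average of its two even neighbours; [W] collects the boundary terms. *)
Lemma bspline_coarsen c s M : c 0%N = 0 -> c 2%N = 0 -> c M.*2 = 0 -> c M.+1.*2 = 0 ->
  \sum_(n < M.*2) c n * bspline (s - n%:R) - \sum_(n < M) c n.*2 * bspline (s / 2 - n%:R) =
  - (8^-1 * \sum_(n < M) sdiff2 (c \o double) n * bspline (s - n.+1.*2%:R) +
     2^-1 * \sum_(n < M) sdiff2 c n.*2 * bspline (s - n.*2.+1%:R)).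
Proof.
move=> c0 c2 cM cM1.
pose W m := 8^-1 * ((c m.+1.*2 - 2 * c m.*2) * bspline (s - m.*2%:R) +
  4 * c m.*2 * bspline (s - m.*2%:R + 1) + c m.*2 * bspline (s - m.*2%:R + 2)).
have E m : \sum_(n < m.*2) c n * bspline (s - n%:R) -
    \sum_(n < m) c n.*2 * bspline (s / 2 - n%:R) =
  - (8^-1 * \sum_(n < m) sdiff2 (c \o double) n * bspline (s - n.+1.*2%:R) +
     2^-1 * \sum_(n < m) sdiff2 c n.*2 * bspline (s - n.*2.+1%:R)) + W m.
  elim: m => [|m IH]; first by rewrite !big_ord0 /W double0 c0 c2; ring.
  rewrite doubleS !big_ord_recr /=.
  have -> : bspline (s / 2 - m%:R) = (bspline (s - m.*2%:R - 2) +
    4 * bspline (s - m.*2%:R - 1) + 6 * bspline (s - m.*2%:R) +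
    4 * bspline (s - m.*2%:R + 1) + bspline (s - m.*2%:R + 2)) / 8.
    have -> : s - m.*2%:R = 2 * (s / 2 - m%:R) by rewrite -muln2 natrM; field.
    exact: two_scale.
  move: IH; rewrite /sdiff2 /W /= !doubleS -!(natr1 (m.*2).+1) -!(natr1 m.*2).
  have -> : s - (m.*2%:R + 1 + 1) = s - m.*2%:R - 2 by ring.
  have -> : s - (m.*2%:R + 1) = s - m.*2%:R - 1 by ring.
  have -> : s - m.*2%:R - 2 + 1 = s - m.*2%:R - 1 by ring.
  have -> : s - m.*2%:R - 2 + 2 = s - m.*2%:R by ring.
  by move=> IH; lra.
by rewrite E /W cM cM1; ring.
Qed.

End Splines.

(** * Calculus of weak derivatives *)

Section WeakPartials.
Context {R : realType}.
Local Notation plane := (R * R)%type.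
Local Notation mplane := (measurableTypeR R * measurableTypeR R)%type.
Local Notation mu2 := (@lebesgue2 R).
Implicit Types (F g : plane -> R) (al : nat * nat).

Lemma L1locD g1 g2 : L1loc g1 -> L1loc g2 -> L1loc (fun z => g1 z + g2 z).
Proof.
move=> [m1 i1] [m2 i2]; split; first exact: measurable_funD.
move=> K cK.
have mK := plane_compact_measurable cK.
have := integrableD mK (i1 K cK) (i2 K cK).
by congr (_.-integrable _ _); apply/funext => z.
Qed.

Lemma L1locZ c g : L1loc g -> L1loc (fun z => c * g z).
Proof.
move=> Lg; have -> : (fun z => c * g z) = (fun z => g z * (fun=> c) z).
  by apply/funext => z; rewrite mulrC.
by apply: L1locM => // z; exact: cvg_cst.
Qed.

Lemma partial_test al (phi : plane -> R) : test_function phi -> test_function (partial al phi).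
Proof.
move=> phiT; have [A A0 phi0] := test_function_box phiT; have [sphi _] := phiT.
suff [h1 h2] : smooth (partial al phi) /\ vanishes_off A (partial al phi).
  exact: box_test_function h2.
rewrite /partial; elim: al.1 => [|n [IH1 IH2]]; last first.
  by split; [exact: smooth_partial1|exact: vanishes_off_derive].
elim: al.2 => [//|n [IH1 IH2]].
by split; [exact: smooth_partial2|exact: vanishes_off_derive].
Qed.

Lemma pairing_integrable g phi : L1loc g -> test_function phi ->
  mu2.-integrable [set: mplane] (EFin \o (fun z => g z * phi z)).
Proof.
move=> Lg phiT; have [A A0 phi0] := test_function_box phiT; have [sphi _] := phiT.
apply: (@L1loc_integrable _ _ A); first exact: L1locM (smooth_continuous sphi).
exact: vanishes_offMr.
Qed.

Lemma is_weak_partialD al F g F' g' :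
  is_weak_partial al F g -> is_weak_partial al F' g' ->
  is_weak_partial al (fun z => F z + F' z) (fun z => g z + g' z).
Proof.
move=> [LF Lg E] [LF' Lg' E']; split; [exact: L1locD|exact: L1locD|].
move=> phi phiT; have phiP := partial_test al phiT.
transitivity (\int[mu2]_z (F z * partial al phi z) + \int[mu2]_z (F' z * partial al phi z)).
  rewrite -RintegralD//; try exact: pairing_integrable.
  by apply: eq_Rintegral => z _; rewrite mulrDl.
rewrite E// E'// -mulrDr; congr (_ * _).
rewrite -RintegralD//; try exact: pairing_integrable.
by apply: eq_Rintegral => z _; rewrite mulrDl.
Qed.

Lemma is_weak_partialZ al c F g :
  is_weak_partial al F g -> is_weak_partial al (fun z => c * F z) (fun z => c * g z).
Proof.
move=> [LF Lg E]; split; [exact: L1locZ|exact: L1locZ|].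
move=> phi phiT; have phiP := partial_test al phiT.
transitivity (c * \int[mu2]_z (F z * partial al phi z)).
  rewrite -RintegralZl//; last exact: pairing_integrable.
  by apply: eq_Rintegral => z _; rewrite mulrA.
rewrite E// mulrCA; congr (_ * _).
rewrite -RintegralZl//; last exact: pairing_integrable.
by apply: eq_Rintegral => z _; rewrite mulrA.
Qed.

Lemma is_weak_partial0 al : is_weak_partial al (fun=> 0) (fun=> (0 : R)).
Proof.
have L0 : L1loc (fun _ : plane => 0 : R) by apply: L1loc_continuous => z; exact: cvg_cst.
split => // phi _.
have E (f : plane -> R) : \int[mu2]_z (0 * f z) = 0.
  by under eq_Rintegral do rewrite mul0r; rewrite Rintegral_cst//= mul0r.
by rewrite !E mulr0.
Qed.

Lemma is_weak_partial_sum al (I : Type) (r : seq I) (F g : I -> plane -> R) :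
  (forall i, is_weak_partial al (F i) (g i)) ->
  is_weak_partial al (fun z => \sum_(i <- r) F i z) (fun z => \sum_(i <- r) g i z).
Proof.
move=> Fg; elim: r => [|i r IH].
  have -> : (fun z => \sum_(i <- [::]) F i z) = (fun=> 0) by apply/funext => z; rewrite big_nil.
  have -> : (fun z => \sum_(i <- [::]) g i z) = (fun=> 0) by apply/funext => z; rewrite big_nil.
  exact: is_weak_partial0.
have -> : (fun z => \sum_(i <- i :: r) F i z) = (fun z => F i z + \sum_(i <- r) F i z).
  by apply/funext => z; rewrite big_cons.
have -> : (fun z => \sum_(i <- i :: r) g i z) = (fun z => g i z + \sum_(i <- r) g i z).
  by apply/funext => z; rewrite big_cons.
exact: is_weak_partialD.
Qed.

Section Tensor.
Variables (u du ddu v dv ddv : R -> R).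
Hypotheses (uE : forall x, is_derive x (1 : R) u (du x))
  (duE : forall x, is_derive x (1 : R) du (ddu x)) (cddu : continuous ddu)
  (vE : forall x, is_derive x (1 : R) v (dv x))
  (dvE : forall x, is_derive x (1 : R) dv (ddv x)) (cddv : continuous ddv).

Let ct (f g : R -> R) : continuous f -> continuous g ->
  continuous (fun z : plane => f z.1 * g z.2).
Proof.
move=> cf cg z; apply: cvgM.
  by apply: (continuous_comp (f := fst)); [exact: cvg_fst|exact: cf].
by apply: (continuous_comp (f := snd)); [exact: cvg_snd|exact: cg].
Qed.

Let cu := is_derive1_continuous uE.
Let cdu := is_derive1_continuous duE.
Let cv := is_derive1_continuous vE.
Let cdv := is_derive1_continuous dvE.

Let parts1 (f df h : R -> R) (phi : plane -> R) : (forall x, is_derive x (1 : R) f (df x)) ->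
  continuous df -> continuous h -> test_function phi ->
  \int[mu2]_z (f z.1 * h z.2 * partial1 phi z) = - \int[mu2]_z (df z.1 * h z.2 * phi z).
Proof.
move=> fE cdf ch phiT; have [A A0 phi0] := test_function_box phiT; have [sphi _] := phiT.
have E := partial1_tensor h fE.
transitivity (- \int[mu2]_z ('D_(1, 0) (fun z => f z.1 * h z.2) z * phi z)); last first.
  by congr (- _); apply: eq_Rintegral => z _; rewrite -(congr1 (fun w => w z) E).
apply: (@integration_by_parts_plane R (1, 0) _ phi A (or_introl erefl)) => //.
- by move=> z; have [] := is_deriveM (is_derive_fst (fE z.1)) (is_derive_snd0 h z).
- by move=> z; exact: smooth_derivable1.
- exact: ct (is_derive1_continuous fE) ch.
- exact: smooth_continuous.
- by rewrite -[X in continuous X]/(partial1 (fun z => f z.1 * h z.2)) E; exact: ct.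
- exact/smooth_continuous/smooth_partial1.
Qed.

Let parts2 (f h dh : R -> R) (phi : plane -> R) : (forall x, is_derive x (1 : R) h (dh x)) ->
  continuous f -> continuous dh -> test_function phi ->
  \int[mu2]_z (f z.1 * h z.2 * partial2 phi z) = - \int[mu2]_z (f z.1 * dh z.2 * phi z).
Proof.
move=> hE cf cdh phiT; have [A A0 phi0] := test_function_box phiT; have [sphi _] := phiT.
have E := partial2_tensor f hE.
transitivity (- \int[mu2]_z ('D_(0, 1) (fun z => f z.1 * h z.2) z * phi z)); last first.
  by congr (- _); apply: eq_Rintegral => z _; rewrite -(congr1 (fun w => w z) E).
apply: (@integration_by_parts_plane R (0, 1) _ phi A (or_intror erefl)) => //.
- by move=> z; have [] := is_deriveM (is_derive_fst0 f z) (is_derive_snd (hE z.2)).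
- by move=> z; exact: smooth_derivable2.
- exact: ct cf (is_derive1_continuous hE).
- exact: smooth_continuous.
- by rewrite -[X in continuous X]/(partial2 (fun z => f z.1 * h z.2)) E; exact: ct.
- exact/smooth_continuous/smooth_partial2.
Qed.

(** Two integrations by parts for a product of functions of class C^2 of one
    variable each. *)
Lemma weak_partial_tensor : [/\
  is_weak_partial (2, 0)%N (fun z => u z.1 * v z.2) (fun z => ddu z.1 * v z.2),
  is_weak_partial (1, 1)%N (fun z => u z.1 * v z.2) (fun z => du z.1 * dv z.2) &
  is_weak_partial (0, 2)%N (fun z => u z.1 * v z.2) (fun z => u z.1 * ddv z.2)].
Proof.
have P1 := @partial_test (1, 0)%N; have P2 := @partial_test (0, 1)%N.
split; split; try by apply: L1loc_continuous; exact: ct.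
- move=> phi phiT; rewrite /partial /= (parts1 uE cdu cv (P1 _ phiT)).
  by rewrite (parts1 duE cddu cv phiT) opprK expr2 mulrNN !mul1r.
- move=> phi phiT; rewrite /partial /= (parts1 uE cdu cv (P2 _ phiT)).
  by rewrite (parts2 vE cdu cdv phiT) opprK expr2 mulrNN !mul1r.
- move=> phi phiT; rewrite /partial /= (parts2 vE cu cdv (P2 _ phiT)).
  by rewrite (parts2 dvE cu cddv phiT) opprK expr2 mulrNN !mul1r.
Qed.

End Tensor.

Lemma weak_partial_unique al F g g' : is_weak_partial al F g -> is_weak_partial al F g' ->
  {ae mu2, forall z, g z = g' z}.
Proof.
move=> [_ Lg E] [_ Lg' E'].
have : {ae mu2, forall z, g z + -1 * g' z = 0}.
  apply: weak_zero; first by apply: L1locD => //; exact: L1locZ.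
  move=> phi phiT.
  transitivity (\int[mu2]_z (g z * phi z) - \int[mu2]_z (g' z * phi z)).
    rewrite -RintegralB//; try exact: pairing_integrable.
    by apply: eq_Rintegral => z _; rewrite mulrDl mulN1r mulNr.
  apply/eqP; rewrite subr_eq0; apply/eqP.
  have s2 : (-1) ^+ (al.1 + al.2) * (-1) ^+ (al.1 + al.2) = 1 :> R by rewrite -expr2 sqrr_sign.
  rewrite -[LHS]mul1r -[RHS]mul1r -s2 -!mulrA; congr (_ * _).
  by rewrite -E// -E'.
by move=> h; apply: (@filterS _ _ (ae_filter_ringOfSetsType mu2) _ _ _ h) => z /eqP; rewrite mulN1r subr_eq0 => /eqP.
Qed.

Lemma weak_partialP al F g : is_weak_partial al F g -> is_weak_partial al F (weak_partial al F).
Proof. by move=> Fg; rewrite /weak_partial; apply: (@xgetPex _ (cst 0) [set g | is_weak_partial al F g]); exists g. Qed.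

(** Any weak derivative agrees almost everywhere with the one picked by
    [weak_partial]. *)
Lemma integral_weak_partial (p : R) al F g : is_weak_partial al F g ->
  (\int[mu2]_z (`|weak_partial al F z| `^ p)%:E = \int[mu2]_z (`|g z| `^ p)%:E)%E.
Proof.
move=> Fg; have Fw := weak_partialP Fg.
have [_ [mw _] _] := Fw; have [_ [mg _] _] := Fg.
have mp (f : plane -> R) : measurable_fun [set: mplane] f ->
    measurable_fun [set: mplane] (fun z => (`|f z| `^ p)%:E).
  move=> mf; apply/measurable_EFinP.
  by apply: (measurableT_comp (measurable_powR p)); exact: measurableT_comp.
apply: ae_eq_integral => //; [exact: mp|exact: mp|].
by have h := weak_partial_unique Fw Fg; apply: (@filterS _ _ (ae_filter_ringOfSetsType mu2) _ _ _ h) => z /= -> _.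
Qed.

End WeakPartials.

(** * The extension operator *)

Section Extension.
Context {R : realType}.
Local Notation plane := (R * R)%type.
Variables (X Y : nat -> R) (N : nat) (h0 : R) (K : nat).
Hypothesis N0 : (0 < N)%N.
Hypothesis h00 : 0 < h0.
Hypothesis gap16 : forall i, (i < N)%N -> 16 * h0 <= X i.+1 - X i.
Hypothesis top_scale : scale h0 K = X N - X 0%N.

Definition origin : R := X 0%N - 5 * scale h0 K.
(** The grids start at distance [5 * scale K] on the left of the set, and [nodes] nodes
    are enough at every scale: coefficients vanish beyond the set. *)
Definition nodes : nat := 8 * 2 ^ K.

Local Notation nd := (node h0 origin).
Local Notation M := nodes.

Definition chord t : R := gap_line X Y N 0 t.
Definition coef k n : R := sample X Y N h0 (nd k n) - chord (nd k n).
Definition grid_coord k (x : R) : R := (x - origin) / scale h0 k.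
Definition layer k x : R := \sum_(n < M) coef k n * bspline (grid_coord k x - n%:R).
(** For [k > 0] this is supported in the strip [scale k <= |y| <= 5 * scale k], and the
    first shells add up to a cut-off: at height [|y|] the extension looks at the grids
    of mesh comparable with [|y|]. *)
Definition shell k (y : R) : R :=
  cutoff (y / scale h0 k) - (if k == 0%N then 0 else cutoff (2 * (y / scale h0 k))).
Definition extension (z : plane) : R :=
  chord z.1 + \sum_(k < K.+1) shell k z.2 * layer k z.1.

Let sc0 k : 0 < scale h0 k. Proof. exact: scale_gt0. Qed.

Lemma grid_coordS k x : grid_coord k.+1 x = grid_coord k x / 2.
Proof. by rewrite /grid_coord scaleS; field; rewrite gt_eqF ?sc0. Qed.

Lemma resid_right t : X N <= t + 2 * h0 -> sample X Y N h0 t = chord t.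
Proof.
move=> XNt; have [_ h] := gap_indexP X N (t + 2 * h0); rewrite /sample.
move: h; set i := gap_index _ _ _ => h; have Ni : (N < i)%N.
  rewrite ltnNge; apply/negP => iN; have := h iN.
  by have := X_le h00 gap16 iN (leqnn N); move: XNt; lra.
by rewrite /chord /gap_line /gap_slope /anchorl /anchorr /bounded_gap (leqNgt i) Ni andbF.
Qed.

Lemma resid_left t : t + 2 * h0 < X 0%N -> sample X Y N h0 t = chord t.
Proof.
move=> tX0; have [h _] := gap_indexP X N (t + 2 * h0); rewrite /sample.
move: h; have := gap_index_le X N (t + 2 * h0).
set i := gap_index _ _ _ => iN; case: (posnP i) => [->//|i0] h; exfalso.
have := h isT; have := X_le h00 gap16 (leq0n i.-1).
rewrite -ltnS prednK// => /(_ iN); move: tX0; lra.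
Qed.

Lemma coef_lo k n : (k <= K)%N -> (n <= 2)%N -> coef k n = 0.
Proof.
move=> kK n2; apply/eqP; rewrite subr_eq0; apply/eqP; apply: resid_left.
have a := scale_le h00 kK; have b := scale_ge h00 K; have c := sc0 k.
have d : n%:R * scale h0 k <= 2 * scale h0 k by rewrite ler_pM2r// ler_nat.
by have := sc0 K; rewrite /node /origin; lra.
Qed.

Lemma coef_hi k n : (6 * 2 ^ K <= n)%N -> coef k n = 0.
Proof.
move=> nK; apply/eqP; rewrite subr_eq0; apply/eqP; apply: resid_right.
have a : 6 * scale h0 K <= n%:R * scale h0 k.
  rewrite {1}/scale mulrA ler_pM ?mulr_ge0 ?exprn_ge0 ?(ltW h00) ?scale_ge//.
  by rewrite -natrX -natrM ler_nat.
by have := h00; rewrite /node /origin; move: top_scale; lra.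
Qed.

Lemma coef_double k n : coef k.+1 n = coef k n.*2.
Proof.
suff e : nd k.+1 n = nd k n.*2 by rewrite /coef e.
by rewrite /node scaleS -muln2 natrM; ring.
Qed.

Local Notation d k := (sdiff2 (coef k)).

Lemma sdiff2_coef k n : d k n = diff2 h0 origin (sample X Y N h0) k n.
Proof. by rewrite /sdiff2 /coef /diff2 /chord /gap_line /node -!natr1; ring. Qed.

Lemma sdiff2_hi k n : (6 * 2 ^ K <= n)%N -> d k n = 0.
Proof. by move=> nK; rewrite /sdiff2 !coef_hi ?subrr ?addr0 ?mulr0 ?subr0// leqW// leqW. Qed.

Let M6 : (6 * 2 ^ K <= M)%N. Proof. by rewrite leq_mul2r orbT. Qed.

(** The mesh of the top grid is the diameter of the set, so that at most one of its
    coefficients is nonzero; it equals minus one half of the second difference centred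
    at its node. *)
Definition top_factor n : R := if coef K n.+1 == 0 then 0 else - 2^-1.

Lemma top_coef n : coef K n.+1 = top_factor n * d K n.
Proof.
rewrite /top_factor; case: eqVneq => [->|ne]; first by rewrite mul0r.
have in1 : X 0%N <= nd K n.+1 + 2 * h0.
  rewrite leNgt; apply/negP => /resid_left e; move/eqP: ne; apply.
  by rewrite /coef e subrr.
have in2 : nd K n.+1 + 2 * h0 < X N.
  rewrite ltNge; apply/negP => /resid_right e; move/eqP: ne; apply.
  by rewrite /coef e subrr.
have c0 : coef K n = 0.
  rewrite /coef resid_left ?subrr//; move: in1 in2 top_scale; rewrite /node -natr1; lra.
have c2 : coef K n.+2 = 0.
  rewrite /coef resid_right ?subrr//; move: in1 in2 top_scale; rewrite /node -!natr1; lra.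
by rewrite /sdiff2 c0 c2; field.
Qed.

(** The coefficients at scale [k.+1] are the even ones at scale [k]. *)
Lemma layer_coarsen k x : (k < K)%N -> layer k x - layer k.+1 x =
  - (8^-1 * \sum_(n < M) d k.+1 n * bspline (grid_coord k x - n.+1.*2%:R) +
     2^-1 * \sum_(n < M) (if odd n then 0 else d k n) * bspline (grid_coord k x - n.+1%:R)).
Proof.
move=> kK; have kK' := ltnW kK.
have MM : (6 * 2 ^ K <= M.*2)%N by rewrite (leq_trans M6)// -addnn leq_addr.
have := @bspline_coarsen R (coef k) (grid_coord k x) M.
have MM' : (6 * 2 ^ K <= M.+1.*2)%N by rewrite doubleS !leqW.
move=> /(_ (@coef_lo k 0 kK' isT) (@coef_lo k 2 kK' isT) (coef_hi k MM) (coef_hi k MM')).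
rewrite (@sum_trunc R (fun n => coef k n * bspline (grid_coord k x - n%:R)) M M.*2); last 2 first.
- by rewrite -addnn leq_addr.
- by move=> n Mn; rewrite coef_hi ?mul0r// (leq_trans M6).
rewrite -/(layer k x).
have -> : \sum_(n < M) coef k n.*2 * bspline (grid_coord k x / 2 - n%:R) = layer k.+1 x.
  by apply: eq_bigr => n _; rewrite coef_double grid_coordS.
move=> ->; congr (- (_ * _ + _ * _)).
  by apply: eq_bigr => n _; rewrite /sdiff2 /= !coef_double.
pose h n := d k n * bspline (grid_coord k x - n.+1%:R).
rewrite -(sum_even h M) (@sum_trunc R (fun n => if odd n then 0 else h n) M M.*2); last 2 first.
- by rewrite -addnn leq_addr.
- by move=> n Mn; rewrite /h sdiff2_hi ?mul0r ?if_same// (leq_trans M6).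
by apply: eq_bigr => n _; case: ifP => // _; rewrite mul0r.
Qed.

Lemma layer_top x : layer K x =
  \sum_(n < M) top_factor n * d K n * bspline (grid_coord K x - n.+1%:R).
Proof.
pose h n := coef K n * bspline (grid_coord K x - n%:R).
have : \sum_(n < M.+1) h n = \sum_(n < M) h n by rewrite big_ord_recr /= /h (coef_hi _ M6) mul0r addr0.
rewrite /layer -/h => <-; rewrite big_ord_recl /h coef_lo// mul0r add0r.
by apply: eq_bigr => n _; rewrite lift0 top_coef.
Qed.

Lemma abel_sum (c l : nat -> R) m :
  \sum_(k < m.+1) (c k - (if (k : nat) == 0%N then 0 else c k.-1)) * l k =
  \sum_(k < m) c k * (l k - l k.+1) + c m * l m.
Proof.
elim: m => [|m IH]; first by rewrite big_ord_recl !big_ord0 /= subr0 addr0 add0r.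
by rewrite big_ord_recr IH [in RHS]big_ord_recr /=; ring.
Qed.

Definition fine_factor k n : R := if (k < K)%N then (if odd n then 0 else - 2^-1) else top_factor n.
Definition coarse_factor k : R := if k == 0%N then 0 else - 8^-1.

(** A second difference at scale [k] enters the difference of the layers [k] and
    [k.+1] through the first term, and that of the layers [k.-1] and [k] through the
    second one, whence the doubled variables. *)
Definition profile (f g : R -> R) (a b : R) (z : R * R) : R :=
  a * (f z.1 * g z.2) + b * (f (2 * z.1) * g (2 * z.2)).

Definition local_coord k n (z : plane) : plane := (grid_coord k z.1 - n.+1%:R, z.2 / scale h0 k).

(** Summation by parts in [k]. In this form every term carries a second difference,
    so that derivatives in [y] only see second differences as well. *)
Lemma extension_regrouped z : extension z = chord z.1 +
  \sum_(k < K.+1) \sum_(n < M) d k n *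
    profile bspline cutoff (fine_factor k n) (coarse_factor k) (local_coord k n z).
Proof.
rewrite /extension; congr (_ + _).
pose c k := cutoff (z.2 / scale h0 k).
have cS k : cutoff (2 * (z.2 / scale h0 k.+1)) = c k.
  by rewrite /c scaleS; congr cutoff; field; rewrite gt_eqF ?sc0.
transitivity (\sum_(k < K.+1) (c k - (if (k : nat) == 0%N then 0 else c k.-1)) * layer k z.1).
  by apply: eq_bigr => -[[|k] kK] _ //=; rewrite /shell /= cS.
rewrite (abel_sum c (layer^~ z.1)).
pose A k := \sum_(n < M) d k n * (fine_factor k n * (bspline (grid_coord k z.1 - n.+1%:R) * c k)).
pose B k := \sum_(n < M) d k.+1 n * (- 8^-1 * (bspline (grid_coord k z.1 - n.+1.*2%:R) * c k)).
transitivity (\sum_(k < K.+1) A k + \sum_(k < K) B k).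
  rewrite [\sum_(k < K.+1) A k]big_ord_recr /= -addrA [A K + _]addrC addrA -big_split /=; congr (_ + _).
    apply: eq_bigr => -[k kK] _ /=; rewrite layer_coarsen//.
    rewrite /A /B /fine_factor kK mulrN mulrDr opprD addrC !mulr_sumr -!sumrN -!big_split /=.
    by apply: eq_bigr => n _; case: ifP => _; ring.
  rewrite layer_top /A /fine_factor ltnn mulr_sumr.
  by apply: eq_bigr => n _; ring.
rewrite [X in _ + X](_ : _ = \sum_(k < K.+1) (if (k : nat) == 0%N then 0 else B k.-1)); last first.
  by rewrite big_ord_recl /= add0r.
rewrite -big_split /=; apply: eq_bigr => -[[|k] kK] _ /=.
  rewrite addr0; apply: eq_bigr => n _.
  by rewrite /profile /coarse_factor /local_coord /= mul0r addr0.
rewrite -big_split /=; apply: eq_bigr => n _.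
have -> : grid_coord k z.1 - n.+1.*2%:R = 2 * (grid_coord k.+1 z.1 - n.+1%:R).
  by rewrite grid_coordS -muln2 natrM; field.
by rewrite -(cS k) -mulrDr.
Qed.

Lemma node0 k : nd k 0 = origin. Proof. by rewrite /node mul0r addr0. Qed.

(** On the line only the finest layer is left. The nodes that contribute at [X i] all use
    the line of the gap on its right, which the splines reproduce. *)
Lemma extension_interpolates i : (i <= N)%N -> extension (X i, 0) = Y i.
Proof.
move=> iN; rewrite /extension /= big_ord_recl /=.
have hpos := h00; have c0 : cutoff (0 : R) = 1.
  by have [|-> _ _] := @cutoff_in R 0; rewrite ?normr0.
rewrite big1 ?addr0; last first.
  move=> k _; rewrite /shell /= /bump /= !mul0r mulr0.
  by rewrite c0 subrr mul0r.
rewrite /shell /= mul0r c0 subr0 mul1r.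
have scale0 : scale h0 0 = h0 by rewrite /scale expr0 mul1r.
pose s := grid_coord 0 (X i).
have sE : s * h0 = X i - origin by rewrite /s /grid_coord scale0 divfK// gt_eqF.
have X0i := X_le h00 gap16 (leq0n i) iN; have XiN := X_le h00 gap16 iN (leqnn N).
have K0 := scale_ge h00 K.
pose c1 := (gap_slope X Y N i.+1 - gap_slope X Y N 0) * h0.
pose g := fun n : nat => gap_line X Y N i.+1 (nd 0 n) - chord (nd 0 n).
have gE n : g n = g 0%N + c1 * n%:R.
  by rewrite /g /c1 /chord /gap_line /node scale0; ring.
have -> : layer 0 (X i) = \sum_(n < M) (g 0%N + c1 * n%:R) * bspline (s - n%:R).
  apply: eq_bigr => n _; have [far|nearn] := leP 2 `|s - n%:R|.
    by have [-> _ _] := bspline_off far; rewrite !mulr0.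
  congr (_ * _); rewrite -gE /coef /g; congr (_ - _); rewrite /sample.
  suff -> : gap_index X N (nd 0 n + 2 * h0) = i.+1 by [].
  move: nearn; rewrite ltr_norml => /andP[n1 n2].
  have m1 : nd 0 n + 2 * h0 > X i.
    have : (s - n%:R) * h0 < 2 * h0 by rewrite ltr_pM2r.
    by rewrite mulrBl sE /node scale0; lra.
  have m2 : nd 0 n + 2 * h0 < X i + 4 * h0.
    have : - 2 * h0 < (s - n%:R) * h0 by rewrite ltr_pM2r.
    by rewrite mulrBl sE /node scale0; lra.
  have [l1 l2] := gap_indexP X N (nd 0 n + 2 * h0).
  move: l1 l2 (gap_index_le X N (nd 0 n + 2 * h0)).
  set j := gap_index _ _ _ => l1 l2 jN.
  apply/eqP; rewrite eqn_leq; apply/andP; split; last first.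
    rewrite ltnNge; apply/negP => ji; have jN' := leq_trans ji iN.
    by have := l2 jN'; have := X_le h00 gap16 ji iN; move: m1; lra.
  rewrite leqNgt; apply/negP => ij; have j0 : (0 < j)%N by apply: leq_ltn_trans ij.
  have ij1 : (i < j.-1)%N by rewrite -ltnS prednK.
  have jN1 : (j.-1 <= N)%N by rewrite -ltnS prednK.
  by have := l1 j0; have := X_far h00 gap16 ij1 jN1; move: m2; lra.
rewrite bspline_affine; last first.
  have MK : (M%:R : R) * h0 = 8 * scale h0 K by rewrite /M natrM natrX /scale; ring.
  apply/andP; split.
    by rewrite -(ler_pM2r h00) sE /origin mul1r; lra.
  by rewrite -(ler_pM2r h00) sE mulrBl MK /origin; move: top_scale; lra.
have -> : g 0%N + c1 * s = gap_line X Y N i.+1 (X i) - chord (X i).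
  have e : c1 * s = (gap_slope X Y N i.+1 - gap_slope X Y N 0) * (X i - origin).
    by rewrite -sE /c1; ring.
  by rewrite e /g node0 /chord /gap_line; ring.
rewrite addrC subrK.
rewrite /gap_line /gap_slope /anchorl /anchorr /bounded_gap /=.
case: ltnP => [_|Ni]; first by rewrite subrr mulr0 addr0.
have -> : i = N by apply/eqP; rewrite eqn_leq iN.
rewrite divfK; first by rewrite addrC subrK.
by rewrite gt_eqF// subr_gt0; have := X_far h00 gap16 N0 (leqnn N); lra.
Qed.

End Extension.

(** * Superpositions of bumps with bounded overlap *)

Section ExtensionEstimates.
Context {R : realType}.
Local Notation plane := (R * R)%type.
Local Notation mplane := (measurableTypeR R * measurableTypeR R)%type.
Local Notation mu2 := (@lebesgue2 R).

Lemma is_derive_comp_affine (f df : R -> R) a b x :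
  (forall x, is_derive x (1 : R) f (df x)) ->
  is_derive x (1 : R) (fun x => f (a * x + b)) (a * df (a * x + b)).
Proof.
move=> fE; have h := is_derive1_comp (g := fun x => a * x + b) (fE (a * x + b)) (is_derive_affine a b x).
by apply: (is_derive_eq h); rewrite mulrC.
Qed.

Lemma continuous_comp_affine (f : R -> R) (a b : R) : continuous f ->
  continuous (fun x : R => f (a * x + b)).
Proof.
move=> cf x; apply: (@continuous_comp _ _ _ (fun x => a * x + b) f); last exact: cf.
exact: (is_derive1_continuous (is_derive_affine a b)).
Qed.

Lemma weak_partial_spline (a b c e : R) : [/\
  is_weak_partial (2, 0)%N (fun z => bspline (a * z.1 + b) * cutoff (c * z.2 + e))
    (fun z => a * (a * bspline2 (a * z.1 + b)) * cutoff (c * z.2 + e)),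
  is_weak_partial (1, 1)%N (fun z => bspline (a * z.1 + b) * cutoff (c * z.2 + e))
    (fun z => a * bspline1 (a * z.1 + b) * (c * cutoff1 (c * z.2 + e))) &
  is_weak_partial (0, 2)%N (fun z => bspline (a * z.1 + b) * cutoff (c * z.2 + e))
    (fun z => bspline (a * z.1 + b) * (c * (c * cutoff2 (c * z.2 + e))))].
Proof.
apply: (weak_partial_tensor (u := fun x => bspline (a * x + b))
  (du := fun x => a * bspline1 (a * x + b)) (ddu := fun x => a * (a * bspline2 (a * x + b)))
  (v := fun y => cutoff (c * y + e)) (dv := fun y => c * cutoff1 (c * y + e))
  (ddv := fun y => c * (c * cutoff2 (c * y + e)))).
- move=> x; exact: is_derive_comp_affine is_derive_bspline.
- move=> x; apply: is_deriveZ; exact: is_derive_comp_affine is_derive_bspline1.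
- move=> x; apply: cvgM; first exact: cvg_cst.
  apply: cvgM; first exact: cvg_cst.
  exact: (@continuous_comp_affine bspline2 a b (@continuous_bspline2 R)).
- move=> x; exact: is_derive_comp_affine is_derive_cutoff.
- move=> x; apply: is_deriveZ; exact: is_derive_comp_affine is_derive_cutoff1.
- move=> x; apply: cvgM; first exact: cvg_cst.
  apply: cvgM; first exact: cvg_cst.
  exact: (@continuous_comp_affine cutoff2 c e (@continuous_cutoff2 R)).
Qed.

Lemma weak_partial_affine (a b : R) al : (al.1 + al.2 = 2)%N ->
  is_weak_partial al (fun z : plane => a * z.1 + b) (fun=> 0).
Proof.
have c0 : continuous (fun _ : R => (0 : R)) by move=> x; exact: cvg_cst.
have dc (k x : R) : is_derive x (1 : R) (fun=> k) 0 by exact: is_derive_cst.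
have [w1 w2 w3] := @weak_partial_tensor R (fun x => a * x + b) (fun=> a) (fun=> 0)
    (fun=> 1) (fun=> 0) (fun=> 0) (is_derive_affine a b) (dc a) c0 (dc 1) (dc 0) c0.
have e1 : (fun z : plane => (a * z.1 + b) * 1) = (fun z => a * z.1 + b).
  by apply/funext => z; rewrite mulr1.
have e2 : (fun _ : plane => 0 * 1) = (fun=> (0 : R)) by apply/funext => z; rewrite mul0r.
have e3 : (fun _ : plane => a * 0) = (fun=> (0 : R)) by apply/funext => z; rewrite mulr0.
have e4 : (fun z : plane => (a * z.1 + b) * 0) = (fun=> (0 : R)) by apply/funext => z; rewrite mulr0.
move: w1 w2 w3; rewrite e1 e2 e3 e4.
by case: al => [[|[|[|n]]] [|[|[|m]]]].
Qed.

Lemma continuous_sum (I : Type) (r : seq I) (F : I -> plane -> R) :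
  (forall i, continuous (F i)) -> continuous (fun z => \sum_(i <- r) F i z).
Proof.
move=> cF; elim: r => [|i r IH].
  have -> : (fun z => \sum_(i <- [::]) F i z) = (fun=> 0) by apply/funext => z; rewrite big_nil.
  by move=> z; exact: cvg_cst.
have -> : (fun z => \sum_(i <- i :: r) F i z) = (fun z => F i z + \sum_(i <- r) F i z).
  by apply/funext => z; rewrite big_cons.
by move=> z; apply: cvgD; [exact: cF|exact: IH].
Qed.

Section Overlap.
Variables (h0 : R) (K M : nat).
Hypothesis h00 : 0 < h0.

Definition active_scale (y : R) (k : nat) :=
  (`|y / scale h0 k| <= 5) && ((0 < k)%N ==> (1 <= `|y / scale h0 k|)).

Lemma card_scales y : (#|[set k : 'I_K.+1 | active_scale y k]%SET| <= 4)%N.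
Proof.
set S := [set k | _]%SET.
have [k0 Hk0] : exists k0 : nat, forall k : 'I_K.+1, k \in S -> (0 < k)%N -> (k0 <= k <= k0.+2)%N.
  have [k1 /andP[k1S k10]|none] := pickP (fun k : 'I_K.+1 => (k \in S) && (0 < k)%N); last first.
    by exists 0%N => k kS k0; have := none k; rewrite kS k0.
  have [|k0 /andP[k0S k00] kmin] := @arg_minnP _ k1 (fun k => (k \in S) && (0 < k)%N) (fun k => k : nat).
    by rewrite k1S.
  exists k0 => k kS kpos; rewrite kmin ?kS//= leqNgt; apply/negP => lt.
  have s0 := scale_gt0 h00 k0; have s1 := scale_gt0 h00 k; have := scale_le h00 lt.
  rewrite !scaleS; move: kS k0S; rewrite !inE /active_scale kpos k00 /=.
  rewrite !normrM !normfV !(gtr0_norm (scale_gt0 h00 _)) => /andP[_ a] /andP[b _].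
  by move: a b; rewrite ler_pdivrMr// ler_pdivlMr// mul1r; lra.
have : {subset map val (enum S) <= [:: 0; k0; k0.+1; k0.+2]%N}.
  move=> m /mapP[k]; rewrite mem_enum => kS ->; rewrite !inE.
  have [->//|kpos] := posnP (val k).
  have /andP[h1 h2] := Hk0 k kS kpos; apply/orP; right.
  by move: h1 h2; rewrite /=; lia.
move=> /uniq_leq_size; rewrite size_map -cardE; apply.
by rewrite map_inj_uniq ?enum_uniq//; exact: val_inj.
Qed.

(** A height is active at scale [0] and at no more than three other scales, and five nodes
    at most of a given scale are close to a point. *)
Lemma overlap (ox : nat -> R) y :
  (#|[set j : 'I_K.+1 * 'I_M | (`|ox j.1 - j.2%:R| <= 2)%R && active_scale y j.1]%SET| <= 20)%N.
Proof.
rewrite -sum1dep_card.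
have -> : (\sum_(j : 'I_K.+1 * 'I_M | (`|ox j.1 - j.2%:R| <= 2)%R && active_scale y j.1) 1 =
   \sum_(k : 'I_K.+1 | active_scale y k) \sum_(n : 'I_M | (`|ox k - n%:R| <= 2)%R) 1)%N.
  by rewrite pair_big_dep /=; apply: eq_bigl => j; rewrite andbC.
apply: (@leq_trans (\sum_(k : 'I_K.+1 | active_scale y k) 5)%N).
  apply: leq_sum => k _; rewrite sum1dep_card.
  apply: leq_trans (@card_grid_le R M 2 0 1 (ox k) ltr01); apply: subset_leq_card.
  by apply/fintype.subsetP => n; rewrite !inE add0r !mulr1 distrC.
by rewrite sum_nat_const -cardsE -[20%N]/(4 * 5)%N leq_mul2r /= card_scales.
Qed.

End Overlap.

Section Superposition.
Variables (h0 p : R) (K M : nat) (ox A : R).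
Hypotheses (h00 : 0 < h0) (p0 : 0 < p) (A0 : 0 <= A).

Let local k (n : nat) (z : plane) := (`|(z.1 - ox) / scale h0 k - n.+1%:R| <= 2) && active_scale h0 z.2 k.

Definition superposition_const : R := 20 `^ p * A `^ p * 40.

(** At each point at most twenty terms are nonzero, whence
    [|g| `^ p <= 20 `^ p * sum of |c k n * Psi k n| `^ p]; the bump of index [(k, n)] is
    bounded by [A / scale k ^+ 2] on a set of measure at most [40 * scale k ^+ 2]. *)
Lemma superposition_bound (c : nat -> nat -> R) (Psi : nat -> nat -> plane -> R) (g : plane -> R) :
  measurable_fun [set: mplane] g ->
  (forall z, g z = \sum_(k < K.+1) \sum_(n < M) c k n * Psi k n z) ->
  (forall k n z, `|Psi k n z| <= A / scale h0 k ^+ 2) ->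
  (forall k n z, ~~ local k n z -> Psi k n z = 0) ->
  (\int[mu2]_z (`|g z| `^ p)%:E <= superposition_const%:E *
     (\sum_(k < K.+1) \sum_(n < M) weight h0 p k * `|c k n| `^ p)%:E)%E.
Proof.
move=> mg gE PA Poff.
pose T := ('I_K.+1 * 'I_M)%type.
pose r (j : T) : set plane :=
  `[ox + (j.2.+1%:R - 2) * scale h0 j.1, ox + (j.2.+1%:R + 2) * scale h0 j.1] `*`
  `[- (5 * scale h0 j.1), 5 * scale h0 j.1].
have sc k : 0 < scale h0 k by exact: scale_gt0.
have localr (j : T) z : local j.1 j.2 z -> r j z.
  move=> /andP[]; rewrite ler_norml => /andP[a1 a2] /andP[]; rewrite ler_norml => /andP[b1 b2] _.
  have s0 := sc j.1; move: a1 a2 b1 b2.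
  rewrite lerBrDr ler_pdivlMr// lerBlDr !ler_pdivrMr// ler_pdivlMr// => a1 a2 b1 b2.
  by split; rewrite /= in_itv/=; apply/andP; split; lra.
pose w (j : T) : R := 20 `^ p * (`|c j.1 j.2| `^ p * (A / scale h0 j.1 ^+ 2) `^ p).
have w0 j : 0 <= w j by rewrite !mulr_ge0 ?powR_ge0.
have mr j : measurable (r j : set mplane) by apply: measurableX; exact: measurable_itv.
have pw z : `|g z| `^ p <= \sum_(j : T) w j * \1_(r j) z.
  rewrite gE pair_big /=.
  have := @powR_sum_le R T (fun j => c j.1 j.2 * Psi j.1 j.2 z) 20 p p0.
  move=> /(_ _)/le_trans; apply.
    apply: leq_trans (@overlap h0 K M h00 (fun k => (z.1 - ox) / scale h0 k - 1) z.2).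
    apply: subset_leq_card; apply/fintype.subsetP => j; rewrite !inE.
    apply: contraR => nl; rewrite Poff ?mulr0//; apply: contra nl.
    by rewrite /local -natr1 [_ + 1]addrC opprD addrA.
  rewrite mulr_sumr; apply: ler_sum => j _.
  rewrite /w -mulrA ler_wpM2l ?powR_ge0// indicE.
  have [lj|nlj] := boolP (local j.1 j.2 z); last first.
    by rewrite Poff// mulr0 normr0 powR0 ?gt_eqF// !mulr_ge0 ?powR_ge0.
  rewrite mem_set ?mulr1; last exact: localr.
  rewrite normrM (powRM p (normr_ge0 _) (normr_ge0 _)) ler_wpM2l ?powR_ge0//.
  by apply: ler_powR_norm; [exact: ltW|by []|exact: PA].
have mw j : measurable_fun [set: mplane] (fun z => (w j * \1_(r j) z)%:E).
  by apply/measurable_EFinP; apply: measurable_funM => //; exact: measurable_indic.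
apply: (@le_trans _ _ (\int[mu2]_z (\sum_(j : T) w j * \1_(r j) z)%:E)%E).
  apply: ge0_le_integral => //.
  - apply/measurable_EFinP; apply: (measurableT_comp (measurable_powR p)).
    exact: measurableT_comp.
  - apply/measurable_EFinP; apply: measurable_sum => j; apply: measurable_funM => //.
  - by move=> z _; rewrite lee_fin.
under eq_integral do rewrite -sumEFin.
rewrite ge0_integral_sum//; last first.
  by move=> j z _; rewrite lee_fin mulr_ge0.
rewrite -EFinM pair_big /= mulr_sumr -sumEFin; apply: lee_sum => j _.
under eq_integral do rewrite EFinM.
rewrite ge0_integralZl//; last 2 first.
- by apply/measurable_EFinP; exact: measurable_indic.
- by rewrite lee_fin.
rewrite integral_indic// setIT.
have s0 := sc j.1.
have E : mu2 (r j) = (4 * scale h0 j.1 * (10 * scale h0 j.1))%:E.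
  rewrite /lebesgue2 /r product_measure1E; try exact: measurable_itv.
  set i1 := `[_, _]; set i2 := `[_, _].
  have e1 := lebesgue_measure_itv (i1 : interval R); have e2 := lebesgue_measure_itv (i2 : interval R).
  rewrite EFinM; congr (_ * _)%E.
    by apply: (etrans e1); rewrite /i1 /= lte_fin ifT; [rewrite -EFinD; congr (_%:E); ring|lra].
  by apply: (etrans e2); rewrite /i2 /= lte_fin ifT; [rewrite -EFinD; congr (_%:E); ring|lra].
rewrite [X in (_ * X)%E](_ : _ = (4 * scale h0 j.1 * (10 * scale h0 j.1))%:E); last exact: E.
rewrite -EFinM lee_fin /superposition_const /w /weight.
rewrite powRM ?invr_ge0 ?exprn_ge0 ?(ltW s0)//.
have -> : (scale h0 j.1 ^+ 2)^-1 `^ p = scale h0 j.1 `^ (2 - 2 * p) / scale h0 j.1 ^+ 2.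
  rewrite powRD; last by rewrite (gt_eqF s0) implybT.
  rewrite -!(powR_mulrn 2 (ltW s0)) mulrAC divff ?mul1r ?gt_eqF ?powR_gt0//.
  by rewrite -powRN -powRrM; congr (_ `^ _); ring.
rewrite le_eqVlt; apply/orP; left; apply/eqP; field.
by rewrite gt_eqF.
Qed.

End Superposition.

End ExtensionEstimates.

(** * Second derivatives of the extension *)

Section ExtensionDerivatives.
Context {R : realType}.
Local Notation plane := (R * R)%type.
Local Notation mplane := (measurableTypeR R * measurableTypeR R)%type.
Local Notation mu2 := (@lebesgue2 R).
Variables (X Y : nat -> R) (N : nat) (h0 : R) (K : nat).
Hypothesis N0 : (0 < N)%N.
Hypothesis h00 : 0 < h0.
Hypothesis gap16 : forall i, (i < N)%N -> 16 * h0 <= X i.+1 - X i.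
Hypothesis top_scale : scale h0 K = X N - X 0%N.

Local Notation M := (nodes K).
Local Notation ext := (extension X Y N h0 K).
Local Notation d k := (sdiff2 (coef X Y N h0 K k)).
Local Notation crd := (grid_coord X h0 K).
Local Notation lc := (local_coord X h0 K).
Local Notation alpha := (fine_factor X Y N h0 K).
Local Notation beta := (@coarse_factor R).

Let sc0 k : 0 < scale h0 k. Proof. exact: scale_gt0. Qed.

Definition psi20 k n (z : plane) : R := (hat (lc k n z).1 * shell h0 k z.2) / scale h0 k ^+ 2.
Definition psi11 k n (z : plane) : R :=
  profile bspline1 cutoff1 (alpha k n) (4 * beta k) (lc k n z) / scale h0 k ^+ 2.
Definition psi02 k n (z : plane) : R :=
  profile bspline cutoff2 (alpha k n) (4 * beta k) (lc k n z) / scale h0 k ^+ 2.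

Definition superpose (psi : nat -> nat -> plane -> R) (z : plane) : R :=
  \sum_(k < K.+1) \sum_(n < M) d k n * psi k n z.

Lemma chord_affine : exists a b, forall t, chord X Y N t = a * t + b.
Proof.
exists (gap_slope X Y N 0), (Y (anchorl N 0) - gap_slope X Y N 0 * X (anchorl N 0)) => t.
by rewrite /chord /gap_line; ring.
Qed.

Lemma weak_partial_chord al : (al.1 + al.2 = 2)%N ->
  is_weak_partial al (fun z : plane => chord X Y N z.1) (fun=> 0).
Proof.
have [a [b ab]] := chord_affine.
have -> : (fun z : plane => chord X Y N z.1) = (fun z => a * z.1 + b) by apply/funext => z.
exact: weak_partial_affine.
Qed.

Lemma weak_partial_regrouped al psi : (al.1 + al.2 = 2)%N ->
  (forall k n, is_weak_partial al
    (fun z => profile bspline cutoff (alpha k n) (beta k) (lc k n z)) (psi k n)) ->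
  is_weak_partial al ext (superpose psi).
Proof.
move=> al2 H.
have -> : ext = (fun z => chord X Y N z.1 + \sum_(k < K.+1) \sum_(n < M) d k n *
    profile bspline cutoff (alpha k n) (beta k) (lc k n z)).
  by apply/funext => z; exact: extension_regrouped.
have -> : superpose psi = (fun z => 0 + superpose psi z) by apply/funext => z; rewrite add0r.
apply: is_weak_partialD; first exact: weak_partial_chord.
apply: (@is_weak_partial_sum R al _ _
  (fun (k : 'I_K.+1) z => \sum_(n < M) d k n * profile bspline cutoff (alpha k n) (beta k) (lc k n z))
  (fun (k : 'I_K.+1) z => \sum_(n < M) d k n * psi k n z)) => k.
apply: (@is_weak_partial_sum R al _ _
  (fun (n : 'I_M) z => d k n * profile bspline cutoff (alpha k n) (beta k) (lc k n z))
  (fun (n : 'I_M) z => d k n * psi k n z)) => n.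
exact: is_weak_partialZ.
Qed.

Lemma local_coordE e k n (z : plane) :
  e * (lc k n z).1 = e / scale h0 k * z.1 + e * (crd k 0 - n.+1%:R) /\
  e * (lc k n z).2 = e / scale h0 k * z.2 + 0.
Proof.
by rewrite /local_coord /grid_coord /= addr0; split; field; rewrite gt_eqF ?sc0.
Qed.

Lemma weak_partial_profile k n :
  is_weak_partial (1, 1)%N (fun z => profile bspline cutoff (alpha k n) (beta k) (lc k n z))
    (psi11 k n) /\
  is_weak_partial (0, 2)%N (fun z => profile bspline cutoff (alpha k n) (beta k) (lc k n z))
    (psi02 k n).
Proof.
pose b e := e * (crd k 0 - n.+1%:R); pose a e := e / scale h0 k.
have [_ w11 w02] := weak_partial_spline (a 1) (b 1) (a 1) 0.
have [_ v11 v02] := weak_partial_spline (a 2) (b 2) (a 2) 0.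
have E1 z := local_coordE 1 k n z; have E2 z := local_coordE 2 k n z.
have ne : scale h0 k != 0 by rewrite gt_eqF ?sc0.
have FE : (fun z => profile bspline cutoff (alpha k n) (beta k) (lc k n z)) =
    (fun z => alpha k n * (bspline (a 1 * z.1 + b 1) * cutoff (a 1 * z.2 + 0)) +
      beta k * (bspline (a 2 * z.1 + b 2) * cutoff (a 2 * z.2 + 0))).
  apply/funext => z; rewrite /profile; have [<- <-] := E1 z; have [<- <-] := E2 z.
  by rewrite !mul1r.
rewrite FE; split.
  have -> : psi11 k n = (fun z =>
    alpha k n * (a 1 * bspline1 (a 1 * z.1 + b 1) * (a 1 * cutoff1 (a 1 * z.2 + 0))) +
    beta k * (a 2 * bspline1 (a 2 * z.1 + b 2) * (a 2 * cutoff1 (a 2 * z.2 + 0)))).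
    apply/funext => z; rewrite /psi11 /profile; have [<- <-] := E1 z; have [<- <-] := E2 z.
    by rewrite !mul1r /a; field.
  by apply: is_weak_partialD; exact: is_weak_partialZ.
have -> : psi02 k n = (fun z =>
  alpha k n * (bspline (a 1 * z.1 + b 1) * (a 1 * (a 1 * cutoff2 (a 1 * z.2 + 0)))) +
  beta k * (bspline (a 2 * z.1 + b 2) * (a 2 * (a 2 * cutoff2 (a 2 * z.2 + 0))))).
  apply/funext => z; rewrite /psi02 /profile; have [<- <-] := E1 z; have [<- <-] := E2 z.
  by rewrite !mul1r /a; field.
by apply: is_weak_partialD; exact: is_weak_partialZ.
Qed.

(** In the regrouped sum the second derivative in [x] would not have bounded overlap: it
    is computed from the definition of the extension, where [sum_bspline2] brings out
    second differences. *)
Lemma weak_partial20 : is_weak_partial (2, 0)%N ext (superpose psi20).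
Proof.
pose g k n (z : plane) := bspline2 (crd k z.1 - n%:R) / scale h0 k ^+ 2 * shell h0 k z.2.
have wg k n : is_weak_partial (2, 0)%N
    (fun z => bspline (crd k z.1 - n%:R) * shell h0 k z.2) (g k n).
  pose a : R := (scale h0 k)^-1; pose b : R := crd k 0 - n%:R.
  pose gam : R := if k == 0%N then 0 else 1.
  have [w20 _ _] := weak_partial_spline a b a 0.
  have [v20 _ _] := weak_partial_spline a b (2 * a) 0.
  have ne : scale h0 k != 0 by rewrite gt_eqF ?sc0.
  have E1 z : crd k z - n%:R = a * z + b by rewrite /a /b /grid_coord; field.
  have ES y : shell h0 k y = cutoff (a * y + 0) + (- gam) * cutoff (2 * a * y + 0).
    rewrite /shell /gam !addr0 -mulrA [a * y]mulrC.
    by case: eqP => _; rewrite ?oppr0 ?mul0r ?mulN1r.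
  have -> : (fun z => bspline (crd k z.1 - n%:R) * shell h0 k z.2) =
    (fun z => bspline (a * z.1 + b) * cutoff (a * z.2 + 0) +
      (- gam) * (bspline (a * z.1 + b) * cutoff (2 * a * z.2 + 0))).
    by apply/funext => z; rewrite E1 ES; ring.
  have -> : g k n = (fun z => a * (a * bspline2 (a * z.1 + b)) * cutoff (a * z.2 + 0) +
      (- gam) * (a * (a * bspline2 (a * z.1 + b)) * cutoff (2 * a * z.2 + 0))).
    by apply/funext => z; rewrite /g E1 ES /a; field.
  by apply: is_weak_partialD => //; exact: is_weak_partialZ.
have -> : superpose psi20 = (fun z => 0 +
    \sum_(k < K.+1) \sum_(n < M) coef X Y N h0 K k n * g k n z).
  apply/funext => z; rewrite add0r; apply: eq_bigr => -[k kK] _ /=.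
  pose q := shell h0 k z.2 / scale h0 k ^+ 2.
  transitivity (q * \sum_(n < M) d k n * hat (crd k z.1 - n.+1%:R)).
    rewrite mulr_sumr; apply: eq_bigr => n _.
    by rewrite /psi20 /q /local_coord /=; ring.
  rewrite -sum_bspline2; first by rewrite mulr_sumr; apply: eq_bigr => n _; rewrite /g /q; ring.
  - exact: coef_lo.
  - exact: coef_lo.
  - by apply: coef_hi => //; rewrite leq_mul2r orbT.
  - by apply: coef_hi => //; rewrite leqW// leq_mul2r orbT.
have -> : ext = (fun z => chord X Y N z.1 + \sum_(k < K.+1) \sum_(n < M)
    coef X Y N h0 K k n * (bspline (crd k z.1 - n%:R) * shell h0 k z.2)).
  apply/funext => z; rewrite /extension; congr (_ + _); apply: eq_bigr => k _.
  by rewrite /layer mulr_sumr; apply: eq_bigr => n _; ring.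
apply: is_weak_partialD; first exact: weak_partial_chord.
apply: (@is_weak_partial_sum R _ _ _
  (fun (k : 'I_K.+1) z => \sum_(n < M) coef X Y N h0 K k n * (bspline (crd k z.1 - n%:R) * shell h0 k z.2))
  (fun (k : 'I_K.+1) z => \sum_(n < M) coef X Y N h0 K k n * g k n z)) => k.
apply: (@is_weak_partial_sum R _ _ _
  (fun (n : 'I_M) z => coef X Y N h0 K k n * (bspline (crd k z.1 - n%:R) * shell h0 k z.2))
  (fun (n : 'I_M) z => coef X Y N h0 K k n * g k n z)) => n.
exact: is_weak_partialZ.
Qed.

Lemma weak_partial11 : is_weak_partial (1, 1)%N ext (superpose psi11).
Proof. by apply: weak_partial_regrouped => // k n; have [] := weak_partial_profile k n. Qed.

Lemma weak_partial02 : is_weak_partial (0, 2)%N ext (superpose psi02).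
Proof. by apply: weak_partial_regrouped => // k n; have [] := weak_partial_profile k n. Qed.

Lemma shell_bound k y : `|shell h0 k y| <= 36.
Proof.
rewrite /shell; have [a _ _] := cutoff_bound (y / scale h0 k).
have [b _ _] := cutoff_bound (2 * (y / scale h0 k)).
by apply: (le_trans (ler_normB _ _)); case: eqP => _; rewrite ?normr0; lra.
Qed.

Lemma shell_off k y : ~~ active_scale h0 y k -> shell h0 k y = 0.
Proof.
rewrite /active_scale /shell negb_and -ltNge => /orP[far|].
  have [|-> _ _] := @cutoff_off R (y / scale h0 k); first exact: ltW.
  have [|-> _ _] := @cutoff_off R (2 * (y / scale h0 k)).
    by rewrite normrM ger0_norm//; move: far; lra.
  by rewrite if_same subrr.
rewrite negb_imply -ltNge => /andP[k0 small]; rewrite gtn_eqF//.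
have [|-> _ _] := @cutoff_in R (y / scale h0 k); first lra.
have [|-> _ _] := @cutoff_in R (2 * (y / scale h0 k)); last by rewrite subrr.
by rewrite normrM ger0_norm//; lra.
Qed.

Lemma fine_factor_bound k n : `|alpha k n| <= 2^-1.
Proof.
have h2 : 0 <= (2^-1 : R) by rewrite invr_ge0.
rewrite /fine_factor /top_factor.
by case: ifP => _; case: ifP => _; rewrite ?normr0 ?normrN ?ger0_norm.
Qed.

Lemma coarse_factor_bound k : `|4 * beta k| <= 2^-1.
Proof.
rewrite /coarse_factor; case: ifP => _; first by rewrite mulr0 normr0 invr_ge0.
rewrite ler_norml; apply/andP; split; lra.
Qed.

Lemma profile_bound (f g : R -> R) F G a b w : (forall t, `|f t| <= F) -> (forall t, `|g t| <= G) ->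
  `|a| <= 2^-1 -> `|b| <= 2^-1 -> `|profile f g a b w| <= F * G.
Proof.
move=> fF gG a2 b2; have h2 : 0 <= (2^-1 : R) by rewrite invr_ge0.
have FG x y : `|f x * g y| <= F * G by rewrite normrM; apply: ler_pM.
have [x1 x2] : `|a * (f w.1 * g w.2)| <= 2^-1 * (F * G) /\
    `|b * (f (2 * w.1) * g (2 * w.2))| <= 2^-1 * (F * G).
  by split; rewrite normrM; apply: ler_pM.
by apply: (le_trans (ler_normD _ _)); move: x1 x2; lra.
Qed.

(** Derivatives of the cut-off vanish near the line as well as far from it. *)
Lemma profile_off (f g : R -> R) a k n z :
  (forall t, 2 <= `|t| -> f t = 0) -> (forall t, 5 <= `|t| -> g t = 0) ->
  (forall t, `|t| <= 2 -> g t = 0) ->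
  ~~ ((`|(lc k n z).1| <= 2) && active_scale h0 z.2 k) ->
  profile f g a (4 * beta k) (lc k n z) = 0.
Proof.
move=> f2 g5 g2; rewrite /profile.
have n2 (t : R) : `|2 * t| = 2 * `|t| by rewrite normrM ger0_norm.
rewrite negb_and -ltNge => /orP[far|].
  rewrite !f2 ?n2; [by rewrite !mul0r !mulr0 addr0| move: far; lra | exact: ltW].
rewrite /active_scale negb_and -ltNge => /orP[far|].
  rewrite !g5 ?n2; [by rewrite !mulr0 addr0| |]; move: far; rewrite /local_coord /=; lra.
rewrite negb_imply -ltNge => /andP[k0 small].
by rewrite !g2 ?n2; [rewrite !mulr0 addr0| |]; move: small; rewrite /local_coord /=; lra.
Qed.

Lemma le_over_scale k (x : R) A : `|x| <= A -> `|x / scale h0 k ^+ 2| <= A / scale h0 k ^+ 2.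
Proof.
move=> xA; rewrite normrM [X in _ * X <= _]ger0_norm ?invr_ge0 ?exprn_ge0 ?(ltW (sc0 k))//.
by rewrite ler_wpM2r// invr_ge0 exprn_ge0// ltW.
Qed.

Lemma superpose_bound p psi : 0 < p -> measurable_fun [set: mplane] (superpose psi) ->
  (forall k n z, `|psi k n z| <= 576 / scale h0 k ^+ 2) ->
  (forall k n z, ~~ ((`|(lc k n z).1| <= 2) && active_scale h0 z.2 k) -> psi k n z = 0) ->
  (\int[mu2]_z (`|superpose psi z| `^ p)%:E <= (superposition_const p 576)%:E *
    (\sum_(k < K.+1) \sum_(n < M) weight h0 p k *
       `|diff2 h0 (origin X h0 K) (sample X Y N h0) k n| `^ p)%:E)%E.
Proof.
move=> p0 mg b1 b2.
have A0 : 0 <= (576 : R) by rewrite ler0n.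
have := @superposition_bound R h0 p K M (origin X h0 K) 576 h00 p0 A0 (fun k n => d k n) psi _ mg
  (fun z => erefl) b1 b2.
move/le_trans; apply; rewrite le_eqVlt; apply/orP; left; apply/eqP; congr (_ * _%:E)%E.
by apply: eq_bigr => k _; apply: eq_bigr => n _; rewrite sdiff2_coef.
Qed.

Theorem extension_bound p i : 0 < p -> (i < 3)%N -> exists2 g, is_weak_partial (i, 2 - i)%N ext g &
  (\int[mu2]_z (`|g z| `^ p)%:E <= (superposition_const p 576)%:E *
    (\sum_(k < K.+1) \sum_(n < M) weight h0 p k *
       `|diff2 h0 (origin X h0 K) (sample X Y N h0) k n| `^ p)%:E)%E.
Proof.
move=> p0; case: i => [|[|[|//]]] _.
- exists (superpose psi02); first exact: weak_partial02.
  have [_ [mg _] _] := weak_partial02; apply: superpose_bound => // k n z.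
    apply: le_over_scale; apply: (@le_trans _ _ (18 * 8)); last by lra.
    apply: profile_bound; rewrite ?fine_factor_bound ?coarse_factor_bound// => t.
      by have [] := bspline_bound t.
    by have [] := cutoff_bound t.
  move=> h; rewrite /psi02 profile_off ?mul0r// => t ht.
  - by have [] := bspline_off ht.
  - by have [] := cutoff_off ht.
  - by have [] := cutoff_in ht.
- exists (superpose psi11); first exact: weak_partial11.
  have [_ [mg _] _] := weak_partial11; apply: superpose_bound => // k n z.
    apply: le_over_scale; apply: (@le_trans _ _ (24 * 24)); last by lra.
    apply: profile_bound; rewrite ?fine_factor_bound ?coarse_factor_bound// => t.
      by have [] := bspline_bound t.
    by have [] := cutoff_bound t.
  move=> h; rewrite /psi11 profile_off ?mul0r// => t ht.
  - by have [] := bspline_off ht.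
  - by have [] := cutoff_off ht.
  - by have [] := cutoff_in ht.
- exists (superpose psi20); first exact: weak_partial20.
  have [_ [mg _] _] := weak_partial20; apply: superpose_bound => // k n z.
    apply: le_over_scale; rewrite normrM; apply: (@le_trans _ _ (1 * 36)); last by lra.
    by apply: ler_pM => //; [exact: hat_bound|exact: shell_bound].
  rewrite negb_and -ltNge => /orP[far|/shell_off e]; last by rewrite /psi20 e mulr0 mul0r.
  by rewrite /psi20 hat_off ?mul0r//; move: far; lra.
Qed.

Lemma continuous_extension : continuous ext.
Proof.
have [a [b ab]] := chord_affine.
have c1 (f : R -> R) : continuous f -> continuous (fun z : plane => f z.1).
  by move=> cf z; apply: (continuous_comp (f := fst)); [exact: cvg_fst|exact: cf].
have c2 (f : R -> R) : continuous f -> continuous (fun z : plane => f z.2).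
  by move=> cf z; apply: (continuous_comp (f := snd)); [exact: cvg_snd|exact: cf].
have -> : ext = (fun z => (a * z.1 + b) + \sum_(k < K.+1) \sum_(n < M) d k n *
    profile bspline cutoff (alpha k n) (beta k) (lc k n z)).
  by apply/funext => z; rewrite -ab; exact: extension_regrouped.
have cc k : continuous (fun _ : plane => k : R) by move=> z; exact: cvg_cst.
have cD (f g : plane -> R) : continuous f -> continuous g -> continuous (fun z => f z + g z).
  by move=> cf cg z; apply: cvgD; [exact: cf|exact: cg].
have cM (f g : plane -> R) : continuous f -> continuous g -> continuous (fun z => f z * g z).
  by move=> cf cg z; apply: cvgM; [exact: cf|exact: cg].
have cB := is_derive1_continuous (@is_derive_bspline R).
have cC := is_derive1_continuous (@is_derive_cutoff R).
apply: (cD _ _); first exact: c1 (is_derive1_continuous (is_derive_affine a b)).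
apply: continuous_sum => k; apply: continuous_sum => n.
apply: (cM _ _ (cc _)).
have E e z := local_coordE e k n z.
have -> : (fun z => profile bspline cutoff (alpha k n) (beta k) (lc k n z)) =
  (fun z => alpha k n * (bspline (1 / scale h0 k * z.1 + 1 * (crd k 0 - n.+1%:R)) *
      cutoff (1 / scale h0 k * z.2 + 0)) +
    beta k * (bspline (2 / scale h0 k * z.1 + 2 * (crd k 0 - n.+1%:R)) *
      cutoff (2 / scale h0 k * z.2 + 0))).
  apply/funext => z; rewrite /profile; have [<- <-] := E 1 z; have [<- <-] := E 2 z.
  by rewrite !mul1r.
apply: (cD _ _); apply: (cM _ _ (cc _)); apply: (cM _ _).
- exact: c1 (continuous_comp_affine cB).
- exact: c2 (continuous_comp_affine cC).
- exact: c1 (continuous_comp_affine cB).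
- exact: c2 (continuous_comp_affine cC).
Qed.

End ExtensionDerivatives.

(** * Comparison of seminorms *)

Section SeminormBound.
Context {R : realType}.
Local Notation plane := (R * R)%type.
Local Notation mplane := (measurableTypeR R * measurableTypeR R)%type.
Local Notation mu2 := (@lebesgue2 R).

Definition energy (p : R) (F : plane -> R) : \bar R :=
  (\sum_(i < 3) \int[mu2]_z (`|weak_partial (i : nat, 2 - i)%N F z| `^ p)%:E)%E.

Lemma energy_ge0 p F : (0 <= energy p F)%E.
Proof. by apply: sume_ge0 => i _; apply: integral_ge0 => z _; rewrite lee_fin powR_ge0. Qed.

Lemma seminorm_le_energy p C F G : 0 < p -> 0 <= C -> (energy p F <= C%:E * energy p G)%E ->
  (L2p_seminorm p F <= (C `^ p^-1)%:E * L2p_seminorm p G)%E.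
Proof.
move=> p0 C0 h.
have E K : L2p_seminorm p K = (energy p K `^ p^-1)%E by [].
rewrite !E -poweR_EFin -(poweRM p^-1 (_ : (0 <= C%:E)%E) (energy_ge0 p G)) ?lee_fin//.
have ip : 0 <= p^-1 by rewrite invr_ge0 ltW.
apply: (gt0_ler_poweR ip) h; first by rewrite in_itv /= energy_ge0 leey.
by rewrite in_itv /= leey andbT mule_ge0 ?energy_ge0 ?lee_fin.
Qed.

Lemma Lfun_of_integral (p : R) (g : plane -> R) : 0 < p ->
  measurable_fun [set: mplane] g -> (\int[mu2]_z (`|g z| `^ p)%:E < +oo)%E ->
  g \in Lfun mu2 p%:E.
Proof.
move=> p0 mg fin; rewrite inE; apply/andP; split; rewrite inE//=.
rewrite /finite_norm unlock /=.
exact: poweR_lty.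
Qed.

Lemma L2p_of_bounds p F (S : R) : 0 < p -> continuous F ->
  (forall i, (i < 3)%N -> exists2 g, is_weak_partial (i, 2 - i)%N F g &
    (\int[mu2]_z (`|g z| `^ p)%:E <= S%:E)%E) ->
  L2p p F /\ (energy p F <= (3 * S)%:E)%E.
Proof.
move=> p0 cF H; split.
  split=> // -[i j] /= ij; have i3 : (i < 3)%N by rewrite ltnS -ij leq_addr.
  have -> : j = (2 - i)%N by rewrite -ij addKn.
  have [g wg gS] := H i i3; exists g => //; apply: Lfun_of_integral => //.
    by have [_ []] := wg.
  by apply: le_lt_trans gS _; rewrite ltry.
apply: (@le_trans _ _ (\sum_(i < 3) S%:E)%E).
  apply: lee_sum => i _; have [g wg gS] := H i (ltn_ord i).
  by rewrite (integral_weak_partial p wg).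
by rewrite !big_ord_recl big_ord0 adde0 -!EFinD lee_fin; lra.
Qed.

Lemma energy_dominates p F : 0 < p -> L2p p F ->
  (\int[mu2]_z ((`|weak_partial (2, 0)%N F z| + `|weak_partial (1, 1)%N F z|) `^ p)%:E
   <= (2 `^ p)%:E * energy p F)%E.
Proof.
move=> p0 [_ H].
have [g20 /weak_partialP w20 _] := H (2, 0)%N erefl.
have [g11 /weak_partialP w11 _] := H (1, 1)%N erefl.
have [_ [m20 _] _] := w20; have [_ [m11 _] _] := w11.
have mp (f : plane -> R) : measurable_fun [set: mplane] f ->
    measurable_fun [set: mplane] (fun z => (`|f z| `^ p)%:E).
  move=> mf; apply/measurable_EFinP.
  by apply: (measurableT_comp (measurable_powR p)); exact: measurableT_comp.
apply: (@le_trans _ _ (\int[mu2]_z ((2 `^ p)%:E * ((`|weak_partial (2, 0)%N F z| `^ p)%:E +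
    (`|weak_partial (1, 1)%N F z| `^ p)%:E)))%E).
  apply: ge0_le_integral => //.
  - apply/measurable_EFinP; apply: (measurableT_comp (measurable_powR p)).
    by have [_ L20 _] := w20; have [_ L11 _] := w11; have [] := L1loc_normD L20 L11.
  - by apply: measurable_funeM; apply: emeasurable_funD; exact: mp.
  - by move=> z _; rewrite -EFinD -EFinM lee_fin powRD_le.
rewrite ge0_integralZl ?lee_fin ?powR_ge0//; last 2 first.
- by apply: emeasurable_funD; exact: mp.
- by move=> z _; rewrite adde_ge0// lee_fin powR_ge0.
rewrite lee_wpmul2l ?lee_fin ?powR_ge0// ge0_integralD//; try exact: mp;
  try by (move=> z _; rewrite lee_fin powR_ge0).
pose J (i : nat) := (\int[mu2]_z (`|weak_partial (i, 2 - i)%N F z| `^ p)%:E)%E.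
have J0 i : (0 <= J i)%E by apply: integral_ge0 => z _; rewrite lee_fin powR_ge0.
have -> : energy p F = (\sum_(i < 3) J i)%E by [].
change ((J 2%N + J 1%N <= \sum_(i < 3) J i)%E).
clearbody J; rewrite !big_ord_recl big_ord0 /= /bump /= adde0.
by rewrite [X in (X <= _)%E]addeC leeDr.
Qed.

Lemma superposition_const_gt0 (p A : R) : 0 < A -> 0 < superposition_const p A.
Proof.
move=> A0; apply: mulr_gt0; last by rewrite ltr0n.
by apply: mulr_gt0; apply: powR_gt0 => //; rewrite ltr0n.
Qed.

(** The energy of the extension is bounded by the second differences of the sampled data,
    by [extension_bound], and those by the energy of any competitor, by [trace_bound]. *)
Theorem extension_seminorm (p : R) : 1 < p < 2 -> exists2 C : R, 0 < C &
  forall (X Y : nat -> R) (N K : nat) (h0 : R), (0 < N)%N -> 0 < h0 ->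
  (forall i, (i < N)%N -> 16 * h0 <= X i.+1 - X i) -> scale h0 K = X N - X 0%N ->
  L2p p (extension X Y N h0 K) /\
  forall F, L2p p F -> (forall i, F (X i, 0) = Y i) ->
    (L2p_seminorm p (extension X Y N h0 K) <= C%:E * L2p_seminorm p F)%E.
Proof.
move=> p12; have /andP[p1 _] := p12; have p0 : 0 < p by rewrite (lt_trans _ p1).
have [C1 C10 TB] := trace_bound p12.
pose C2 := @superposition_const R p 576.
have C20 : 0 < C2 by apply: superposition_const_gt0; rewrite ltr0n.
pose C := 3 * (C2 * (C1 * 2 `^ p)).
have C0 : 0 < C.
  apply: mulr_gt0; first by rewrite ltr0n.
  by apply: mulr_gt0 C20 _; apply: mulr_gt0 C10 _; exact: powR_gt0.
exists (C `^ p^-1) => [|X Y N K h0 N0 h00 gap top]; first exact: powR_gt0.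
pose S := \sum_(k < K.+1) \sum_(n < nodes K) weight h0 p k *
       `|diff2 h0 (origin X h0 K) (sample X Y N h0) k n| `^ p.
have [L2 EN] : L2p p (extension X Y N h0 K) /\
    (energy p (extension X Y N h0 K) <= (3 * (C2 * S))%:E)%E.
  apply: L2p_of_bounds => //; first exact: continuous_extension.
  by move=> i i3; exact: (extension_bound Y h00 gap top p0 i3).
split=> // F LF YF; apply: seminorm_le_energy => //; first exact: ltW.
have -> : (C%:E * energy p F =
    3%:E * (C2%:E * (C1%:E * ((2 `^ p)%:E * energy p F))))%E.
  by rewrite !muleA -!EFinM /C !mulrA.
apply: (le_trans EN); rewrite [(3 * _)%:E]EFinM lee_wpmul2l ?lee_fin//.
rewrite [(C2 * S)%:E]EFinM.
rewrite lee_wpmul2l ?lee_fin ?(ltW C20)//.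
have [cF H] := LF.
have [g20 /weak_partialP w20 _] := H (2, 0)%N erefl.
have [g11 /weak_partialP w11 _] := H (1, 1)%N erefl.
have topK : X N - X 0%N <= scale h0 K <= 2 * (X N - X 0%N).
  have := scale_gt0 h00 K; rewrite top => ?; apply/andP; split; lra.
have := TB X Y N K h0 N0 h00 gap topK F _ _ cF w20 w11 (fun i => esym (YF i)) (origin X h0 K) (nodes K).
move=> /le_trans; apply; rewrite lee_wpmul2l ?lee_fin ?(ltW C10)//.
exact: energy_dominates.
Qed.

End SeminormBound.

(** * Linearity, bounded depth and conclusion *)

Section ExtensionMap.
Context {R : realType}.
Local Notation plane := (R * R)%type.

Lemma extension_linear (X : nat -> R) N h0 K (a : R) (Y1 Y2 : nat -> R) (z : plane) :
  extension X (fun i => a * Y1 i + Y2 i) N h0 K z =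
  a * extension X Y1 N h0 K z + extension X Y2 N h0 K z.
Proof.
have lineE i t : gap_line X (fun i => a * Y1 i + Y2 i) N i t =
    a * gap_line X Y1 N i t + gap_line X Y2 N i t.
  by rewrite /gap_line /gap_slope; ring.
have coefE k n : coef X (fun i => a * Y1 i + Y2 i) N h0 K k n =
    a * coef X Y1 N h0 K k n + coef X Y2 N h0 K k n.
  by rewrite /coef /sample /chord !lineE; ring.
have layerE k x : layer X (fun i => a * Y1 i + Y2 i) N h0 K k x =
    a * layer X Y1 N h0 K k x + layer X Y2 N h0 K k x.
  rewrite /layer mulr_sumr -big_split /=; apply: eq_bigr => n _.
  by rewrite coefE; ring.
have sumE : \sum_(k < K.+1) shell h0 k z.2 * layer X (fun i => a * Y1 i + Y2 i) N h0 K k z.1 =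
    a * (\sum_(k < K.+1) shell h0 k z.2 * layer X Y1 N h0 K k z.1) +
    \sum_(k < K.+1) shell h0 k z.2 * layer X Y2 N h0 K k z.1.
  by rewrite mulr_sumr -big_split /=; apply: eq_bigr => k _; rewrite layerE; ring.
by rewrite /extension /chord lineE sumE; ring.
Qed.

Definition active_nodes (X : nat -> R) h0 K (z : plane) : {set 'I_K.+1 * 'I_(nodes K)} :=
  [set j : 'I_K.+1 * 'I_(nodes K) | (`|grid_coord X h0 K j.1 z.1 - j.2%:R| <= 2)%R && active_scale h0 z.2 j.1]%SET.

Definition node_gap_index (X : nat -> R) N h0 K (j : 'I_K.+1 * 'I_(nodes K)) : nat :=
  gap_index X N (node h0 (origin X h0 K) j.1 j.2 + 2 * h0).

(** Near [z] there are few nodes, and a coefficient only depends on the values at the ends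
    of the gap of its node and, through the chord, at the ends of the whole set. *)
Lemma extension_local (X : nat -> R) N h0 K (Y1 Y2 : nat -> R) (z : plane) :
  Y1 0%N = Y2 0%N -> Y1 N = Y2 N ->
  (forall j, j \in active_nodes X h0 K z ->
     Y1 (anchorl N (node_gap_index X N h0 j)) = Y2 (anchorl N (node_gap_index X N h0 j)) /\
     Y1 (anchorr N (node_gap_index X N h0 j)) = Y2 (anchorr N (node_gap_index X N h0 j))) ->
  extension X Y1 N h0 K z = extension X Y2 N h0 K z.
Proof.
move=> e0 eN H.
have chordE t : chord X Y1 N t = chord X Y2 N t.
  by rewrite /chord /gap_line /gap_slope /anchorl /anchorr /bounded_gap /= e0 eN.
rewrite /extension chordE; congr (_ + _); apply: eq_bigr => k _.
have [act|nact] := boolP (active_scale h0 z.2 k); last by rewrite !shell_off// !mul0r.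
congr (_ * _); rewrite /layer; apply: eq_bigr => n _.
have [near|far] := leP `|grid_coord X h0 K k z.1 - n%:R| 2; last first.
  by have [-> _ _] := bspline_off (ltW far); rewrite !mulr0.
have /H[/= l r] : (k, n) \in active_nodes X h0 K z by rewrite inE near.
congr (_ * _); rewrite /coef chordE; congr (_ - _).
by rewrite /sample /gap_line /gap_slope -/(node_gap_index X N h0 (k, n)) l r.
Qed.

(** The diameter of the set divided by a power of [2] larger than sixteen times its
    ratio to the smallest gap. *)
Lemma adapted_scale (X : nat -> R) N : (0 < N)%N -> (forall i, (i < N)%N -> X i < X i.+1) ->
  exists h0 : R, exists K : nat, [/\ 0 < h0,
    forall i, (i < N)%N -> 16 * h0 <= X i.+1 - X i & scale h0 K = X N - X 0%N].
Proof.
move=> N0 Xlt.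
have [e e0 He] : exists2 e : R, 0 < e & forall i, (i < N)%N -> e <= X i.+1 - X i.
  elim: N Xlt {N0} => [|n IH] Xlt; first by exists 1.
  have [|e e0 He] := IH; first by move=> i ni; exact: Xlt (ltnW ni).
  exists (Num.min e (X n.+1 - X n)); first by rewrite lt_min e0 subr_gt0 Xlt.
  move=> i; rewrite ltnS leq_eqVlt => /orP[/eqP ->|ni]; first by rewrite ge_min lexx orbT.
  by rewrite ge_min He.
have l0 : 0 < X N - X 0%N.
  elim: N N0 Xlt {He} => // n IH _ Xlt.
  case: n IH Xlt => [_ Xlt|n IH Xlt]; first by rewrite subr_gt0 Xlt.
  have := IH isT (fun i ni => Xlt i (ltnW ni)); have := Xlt n.+1 (ltnSn _); lra.
pose q := 16 * (X N - X 0%N) / e.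
have q0 : 0 <= q by rewrite divr_ge0 ?(ltW e0)// mulr_ge0// ltW.
pose K := (Num.truncn q).+1.
have qK : q <= 2 ^+ K.
  apply: (le_trans (ltW (truncnS_gt q))); rewrite -/K -natrX ler_nat ltnW//.
  exact: ltn_expl.
have t0 : 0 < (2 : R) ^+ K by rewrite exprn_gt0.
exists ((X N - X 0%N) / 2 ^+ K), K; split.
- by rewrite divr_gt0.
- move=> i iN; apply: le_trans (He i iN).
  by rewrite mulrA ler_pdivrMr// [leRHS]mulrC -ler_pdivrMr.
- by rewrite /scale mulrC divfK// gt_eqF.
Qed.

Section FiniteSet.
Variables (E : {fset plane}) (x0 : E).

Definition sorted_points : seq plane := sort (fun a b => a.1 <= b.1) (enum_fset E).
Definition point (i : nat) : E := insubd x0 (nth (val x0) sorted_points i).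
Definition abscissa (i : nat) : R := (val (point i)).1.

Lemma mem_sorted_points z : (z \in sorted_points) = (z \in E).
Proof. by rewrite mem_sort. Qed.

Lemma val_point i : val (point i) = nth (val x0) sorted_points i.
Proof.
rewrite /point val_insubd; case: ifPn => // /negP[].
have [lt|ge] := ltnP i (size sorted_points); last by rewrite nth_default//; exact: (valP x0).
by rewrite -mem_sorted_points mem_nth.
Qed.

Lemma size_sorted_points : size sorted_points = #|` E|.
Proof. by rewrite size_sort. Qed.

Definition extension_map (N K : nat) (h0 : R) (f : {ffun E -> R^o}) : plane -> R^o :=
  extension abscissa (fun i => f (point i)) N h0 K.

Lemma extension_map_linear N K h0 : linear (extension_map N K h0).
Proof.
move=> a f g; apply/funext => z; rewrite /extension_map.
have -> : (fun i => (a *: f + g) (point i)) = (fun i => a * f (point i) + g (point i)).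
  by apply/funext => i; rewrite !ffunE.
exact: extension_linear.
Qed.

HB.instance Definition _ N K h0 := @GRing.isLinear.Build R {ffun E -> R^o} (plane -> R^o)
  *:%R (extension_map N K h0) (extension_map_linear N K h0).

Lemma extension_map_local N K h0 z : 0 < h0 -> exists2 S : {set E}, (#|S| <= 42)%N &
  forall f g : {ffun E -> R^o}, {in S, f =1 g} ->
    extension_map N K h0 f z = extension_map N K h0 g z.
Proof.
move=> h00.
pose A := active_nodes abscissa h0 K z.
pose gi (j : 'I_K.+1 * 'I_(nodes K)) := node_gap_index abscissa N h0 j.
have A20 : (#|A| <= 20)%N by exact: (overlap K (nodes K) h00 (fun k => grid_coord abscissa h0 K k z.1) z.2).
pose Sl : {set E} := [set point (anchorl N (gi j)) | j in A]%SET.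
pose Sr : {set E} := [set point (anchorr N (gi j)) | j in A]%SET.
exists ([set point 0; point N] :|: (Sl :|: Sr))%SET.
  have hl : (#|Sl| <= 20)%N := leq_trans (leq_imset_card _ _) A20.
  have hr : (#|Sr| <= 20)%N := leq_trans (leq_imset_card _ _) A20.
  have h2 : (#|[set point 0; point N]%SET| <= 2)%N by rewrite cards2; case: eqP.
  apply: (leq_trans (leq_card_setU _ _)); rewrite -[42%N]/(2 + (20 + 20))%N leq_add//.
  by apply: (leq_trans (leq_card_setU _ _)); rewrite leq_add.
move=> f g fg; apply: extension_local.
- by apply: fg; rewrite !inE eqxx.
- by apply: fg; rewrite !inE eqxx orbT.
- move=> j jA; split; apply: fg; rewrite !finset.in_setU.
    by rewrite (imset_f (fun j => point (anchorl N (gi j))) jA) orbT.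
  by rewrite (imset_f (fun j => point (anchorr N (gi j))) jA) !orbT.
Qed.

Hypothesis E0 : forall z, z \in E -> z.2 = 0.

Lemma abscissa_point i : (abscissa i, 0) = val (point i).
Proof. by have := E0 (valP (point i)); rewrite /abscissa; case: (val (point i)) => a b /= ->. Qed.

Lemma abscissa_lt i : (i.+1 < size sorted_points)%N -> abscissa i < abscissa i.+1.
Proof.
move=> iN; have iN' := ltnW iN.
have srt : sorted (fun a b : plane => a.1 <= b.1) sorted_points.
  by apply: sort_sorted => a b; exact: le_total.
rewrite lt_neqAle; apply/andP; split; last first.
  by rewrite /abscissa !val_point; move/sortedP : srt; exact.
apply/negP => /eqP e.
have : val (point i) = val (point i.+1) by rewrite -!abscissa_point e.
rewrite !val_point => /eqP; rewrite nth_uniq//; last by rewrite sort_uniq fset_uniq.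
by rewrite eqn_leq ltnn andbF.
Qed.

End FiniteSet.
End ExtensionMap.

Theorem theorem1 (R : realType) :
  exists (C : nat) (Cp : R -> R),
  forall E : {fset R * R},
    (forall z : R * R, z \in E -> z.2 = 0) ->
    (2 <= #|` E|)%N ->
    exists T : {linear {ffun E -> R^o} -> (R * R -> R^o)},
      [/\ forall (f : {ffun E -> R^o}) (x : E), T f (val x) = f x,
          forall p : R, 1 < p < 2 -> forall f : {ffun E -> R^o},
            L2p p (T f) /\
            (L2p_seminorm p (T f) <= (Cp p)%:E * L2p_trace_seminorm p f)%E
        & forall z : R * R, exists2 S : {set E}, (#|S| <= C)%N &
            forall f g : {ffun E -> R^o},
              {in S, f =1 g} -> T f z = T g z].
Proof.
pose good (p C : R) := 0 < C /\ forall (X Y : nat -> R) (N K : nat) (h0 : R),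
  (0 < N)%N -> 0 < h0 ->
  (forall i, (i < N)%N -> 16 * h0 <= X i.+1 - X i) -> scale h0 K = X N - X 0%N ->
  L2p p (extension X Y N h0 K) /\
  forall F, L2p p F -> (forall i, F (X i, 0) = Y i) ->
    (L2p_seminorm p (extension X Y N h0 K) <= C%:E * L2p_seminorm p F)%E.
have /choice[Cp HCp] : forall p : R, exists C, 1 < p < 2 -> good p C.
  move=> p; have [p12|np] := boolP (1 < p < 2); last by exists 0.
  by have [C C0 H] := extension_seminorm p12; exists C.
exists 42%N, Cp => E E0 E2.
have [x0 _] : exists x0 : E, True.
  have : (0 < #|{: E}|)%N by rewrite -cardfE ltnW.
  by move=> /card_gt0P[x0 _]; exists x0.
pose N := (#|` E|).-1.
have NE : N.+1 = size (sorted_points E) by rewrite size_sorted_points prednK// ltnW.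
have N0 : (0 < N)%N by rewrite /N -ltnS prednK// ltnW.
have lt i : (i < N)%N -> abscissa x0 i < abscissa x0 i.+1.
  by move=> iN; apply: abscissa_lt => //; rewrite -NE ltnS.
have [h0 [K [h00 gap top]]] := adapted_scale N0 lt.
exists (extension_map x0 N K h0 : {linear {ffun E -> R^o} -> (R * R -> R^o)}); split => /=.
- move=> f x.
  have xs : val x \in sorted_points E by rewrite mem_sorted_points; exact: (valP x).
  pose i := index (val x) (sorted_points E).
  have iN : (i <= N)%N by rewrite -ltnS NE index_mem.
  have px : point x0 i = x by apply: val_inj; rewrite val_point nth_index.
  have -> : val x = (abscissa x0 i, 0) by rewrite abscissa_point// px.
  by rewrite /extension_map extension_interpolates// px.
- move=> p p12 f; have [C0 H] := HCp p p12.
  have [L2 B] := H (abscissa x0) (fun i => f (point x0 i)) N K h0 N0 h00 gap top.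
  split => //; rewrite -lee_pdivrMl//; apply: le_ereal_inf_tmp => _ [F [LF Ff] <-].
  by rewrite lee_pdivrMl//; apply: B => // i; rewrite abscissa_point// Ff.
- by move=> z; exact: extension_map_local.
Qed.
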